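(* Let $d\in\mathbb{N}$, $d\ge 1$, let $(k,l)\in\mathbb{R}^2$, and let $T>0$. Assume that the Zakharov system $$i\partial_t u+\Delta u=nu,\qquad \partial_t^2 n-\Delta n=\Delta|u|^2,\qquad (u,n,\partial_t n)|_{t=0}\in H^{k,l},$$ with $u:\mathbb{R}\times\mathbb{R}^d\to\mathbb{C}$ and $n:\mathbb{R}\times\mathbb{R}^d\to\mathbb{R}$, is locally well-posed in $H^{k,l}$ in the time interval $[0,T]$. If $$l<-\tfrac12\qquad\text{or}\qquad l>2k-\tfrac12,$$ then for every fixed $t\in(0,T]$ the flow mapping $S^{t}:B_r\to H^{k,l}$ of the system fails to be $C^2$ at the origin of $H^{k,l}$.
   Context: Spaces. $H^{k,l}:=H^k(\mathbb{R}^d;\mathbb{C})\times H^l(\mathbb{R}^d;\mathbb{R})\times H^{l-1}(\mathbb{R}^d;\mathbb{R})$ (inhomogeneous $L^2$-based Sobolev spaces), with norm $\|(\varphi,\psi,\phi)\|_{H^{k,l}}^2=\|\varphi\|_{H^k}^2+\|\psi\|_{H^l}^2+\|\phi\|_{H^{l-1}}^2$, regarded as a real Banach space. $\mathcal{C}([0,T];H^{k,l})$ denotes $C([0,T];H^k(\mathbb{R}^d))\times C([0,T];H^l(\mathbb{R}^d))\times C([0,T];H^{l-1}(\mathbb{R}^d))$. For $r>0$, $B_r=\{(\varphi,\psi,\phi)\in H^{k,l}:\|(\varphi,\psi,\phi)\|_{H^{k,l}}<r\}$. $\Delta$ is the Laplacian in the space variable. Solutions. A local solution on $[0,T]$ with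 initial data $(u,n,\partial_t n)|_{t=0}=(\varphi,\psi,\phi)$ is a triple $(u,n,\partial_t n)\in\mathcal{C}([0,T];H^{k,l})$ satisfying, for all $t\in[0,T]$, the integral equations $$u(t)=e^{it\Delta}\varphi-i\int_0^t e^{i(t-s)\Delta}u(s)n(s)\,ds,$$ $$n(t)=W_0(t)\psi+W_1(t)\phi+\int_0^t W_1(t-s)\Delta|u|^2(s)\,ds,$$ $$\partial_t n(t)=W_0(t)\phi+W_1(t)\Delta\psi+\int_0^t W_0(t-s)\Delta|u|^2(s)\,ds,$$ where $e^{it\Delta}$, $W_0(t)$, $W_1(t)$ are the Fourier multiplier operators in $x$ with symbols $e^{-it|\xi|^2}$, $\cos(t|\xi|)$, $\sin(t|\xi|)/|\xi|$, respectively. Local well-posedness in $[0,T]$ is understood in the usual sense (existence, uniqueness and continuous dependence on the data): for some $r>0$, every $(\varphi,\psi,\phi)\in B_r$ gives rise to a unique local solution $(u_{(\varphi,\psi,\phi)},n_{(\varphi,\psi,\phi)},\partial_t n_{(\varphi,\psi,\phi)})\in\mathcal{C}([0,T];H^{k,l})$ on $[0,T]$, depending continuously on the data (in particular the zero data gives the zero solution). Flow mapping. For fixed $t\in[0,T]$, $$S^t:B_r\to H^{k,l},\qquad S^t(\varphi,\psi,\phi)=\big(u_{(\varphi,\psi,\phi)}(t),\,n_{(\varphi,\psi,\phi)}(t),\,\partial_t n_{(\varphi,\psi,\phi)}(t)\big).$$ ''Fails to be $C^2$ at the origin'' means: is not two times Fréchet differentiable at the origin $(0,0,0)$ of $H^{k,l}$.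 *)

(* Defs.v *)
(* The Zakharov system on R^d is set on the Fourier side.  The Fourier
   transform is the unitary one,
     (F f)(xi) = (2 pi)^(-d/2) \int e^(-i x.xi) f(x) dx,
   which maps H^s(R^d) isometrically onto L^2(<xi>^(2s) dxi); an element of H^s
   is the a.e. class of its Fourier transform.  In these terms f is real-valued
   iff (F f)(- xi) is the conjugate of (F f)(xi), the Fourier transform of the
   conjugate of f is the function xi |-> ((F f)(- xi))^*, and
   F (f g) = (2 pi)^(-d/2) (F f * F g).                                       *)

From HB Require Import structures.
From mathcomp Require Import all_boot all_order all_algebra complex.
From mathcomp Require Import all_classical all_reals all_analysis.
From mathcomp Require Import measurable_realfun.

Set Implicit Arguments.
Unset Strict Implicit.
Unset Printing Implicit Defensive.
Import Order.TTheory GRing.Theory Num.Theory.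
Import numFieldNormedType.Exports.
Local Open Scope classical_set_scope.
Local Open Scope ring_scope.

Section EuclideanSpace.
Context {R : realType}.

Definition Rn (n : nat) : Type := n.-tuple (measurableTypeR R).
HB.instance Definition _ n := Measurable.on (Rn n).

Definition vcons n (p : measurableTypeR R * Rn n) : Rn n.+1 :=
  [tuple of p.1 :: p.2].

Lemma measurable_vcons n : measurable_fun setT (@vcons n).
Proof.
exact: (@measurable_cons _ _ (measurableTypeR R * Rn n)%type
  (measurableTypeR R) fst n snd measurable_fst measurable_snd).
Qed.

HB.instance Definition _ n :=
  isMeasurableFun.Build _ _ _ _ (@vcons n) (@measurable_vcons n).

Definition vuncons n (x : Rn n.+1) : measurableTypeR R * Rn n :=
  (thead x, [tuple of behead x]).

Lemma vconsK n : cancel (@vcons n) (@vuncons n).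
Proof. by case=> a v; rewrite /vuncons theadE; congr pair; exact/val_inj. Qed.

Lemma measurable_vuncons n : measurable_fun setT (@vuncons n).
Proof.
apply/measurable_fun_pairP; split.
  exact: (@measurable_tnth _ (measurableTypeR R) n.+1 ord0).
exact: measurable_behead.
Qed.

Section PushCons.
Context n (mu : {sigma_finite_measure set (Rn n) -> \bar R}).
Let prodmu := (@lebesgue_measure R \x mu)%E.

(* Image of lebesgue_measure \x mu under (a, v) |-> a :: v. *)
Definition mcons : set (Rn n.+1) -> \bar R := pushforward prodmu (@vcons n).

Let pushcons : {measure set (Rn n.+1) -> \bar R} :=
  measure_function_pushforward__canonical__measure_function_Measure
    prodmu (@measurable_vcons n).

HB.instance Definition _ := isMeasure.Build _ _ _ mcons
  (measure0 pushcons) (measure_ge0 pushcons)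
  (@measure_semi_sigma_additive _ _ _ pushcons).

Lemma mcons_sigma_finite : sigma_finite setT mcons.
Proof.
have /sigma_finiteP[F [TF ndF Foo]] := sigma_finiteT (@lebesgue_measure R).
have /sigma_finiteP[G [TG ndG Goo]] := sigma_finiteT mu.
exists (fun k => @vuncons n @^-1` (F k `*` G k)).
  rewrite -preimage_bigcup; apply/esym; rewrite -subTset => v _ /=.
  have [i _ Fi] : (\bigcup_k F k) (vuncons v).1 by rewrite -TF.
  have [j _ Gj] : (\bigcup_k G k) (vuncons v).2 by rewrite -TG.
  exists (maxn i j) => //; split.
  - by move: Fi; exact/subsetPset/ndF/leq_maxl.
  - by move: Gj; exact/subsetPset/ndG/leq_maxr.
move=> k; have [mF Fk] := Foo k; have [mG Gk] := Goo k; split.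
  rewrite -[X in measurable X]setTI; apply: measurable_vuncons => //.
  exact: measurableX.
suff -> : mcons (@vuncons n @^-1` (F k `*` G k)) =
    (@lebesgue_measure R (F k) * mu (G k))%E.
  by rewrite lte_mul_pinfty// ge0_fin_numE.
rewrite -(product_measure1E (@lebesgue_measure R) mu mF mG).
rewrite /mcons /pushforward; congr (product_measure1 _ _ _).
apply/funext => x.
by rewrite -[LHS]/((F k `*` G k) (vuncons (vcons x))) vconsK.
Qed.

HB.instance Definition _ :=
  Measure_isSigmaFinite.Build _ _ _ mcons mcons_sigma_finite.

End PushCons.

(* Lebesgue measure on R^n, as an iterated product. *)
Fixpoint lebesgue_Rn n : {sigma_finite_measure set (Rn n) -> \bar R} :=
  match n with
  | 0 => \d_([tuple] : Rn 0)
  | n'.+1 => mcons (lebesgue_Rn n')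
  end.
End EuclideanSpace.

Section Sobolev.
Context {R : realType} (d : nat).
Implicit Types (xi eta : @Rn R d) (s : R) (isreal : bool).
Local Notation leb := (@lebesgue_Rn R d).

Definition vopp xi : Rn d := [tuple - tnth xi i | i < d].
Definition vsub xi eta : Rn d := [tuple tnth xi i - tnth eta i | i < d].
Definition sqnorm xi : R := \sum_(i < d) tnth xi i ^+ 2.
Definition vnorm xi : R := Num.sqrt (sqnorm xi).
(* The Japanese bracket <xi> = (1 + |xi|^2)^(1/2). *)
Definition japan xi : R := Num.sqrt (1 + sqnorm xi).

(* Rcomplex R is R[i] with its real vector space structure and real norm. *)
Definition cfun : Type := @Rn R d -> Rcomplex R.
HB.instance Definition _ := GRing.Lmodule.on cfun.
HB.instance Definition _ := Choice.on cfun.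

Definition wabs s (f : cfun) xi : R := japan xi `^ s * `|f xi|.

Definition sob_pred isreal s : {pred cfun} :=
  mem [set f : cfun |
    [/\ measurable_fun setT (fun xi => complex.Re (f xi)),
        measurable_fun setT (fun xi => complex.Im (f xi)),
        finite_norm leb 2%:E (wabs s f)
      & isreal -> {ae leb, forall xi, f (vopp xi) = (f xi)^*%C}]].

Lemma measurable_japan : measurable_fun setT japan.
Proof.
apply: (@measurableT_comp _ _ _ _ _ _ (@Num.sqrt R)).
  by apply: continuous_measurable_fun; exact: sqrt_continuous.
apply: measurable_funD => //.
apply: measurable_sum => i; apply: measurable_funX.
exact: (@measurable_tnth _ (measurableTypeR R) d i).
Qed.

Lemma japan_gt0 xi : 0 < japan xi.
Proof.
by rewrite sqrtr_gt0 ltr_wpDr// sumr_ge0// => i _; exact: sqr_ge0.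
Qed.

Lemma measurable_wabs s (f : cfun) :
  measurable_fun setT (fun xi => complex.Re (f xi)) ->
  measurable_fun setT (fun xi => complex.Im (f xi)) ->
  measurable_fun setT (wabs s f).
Proof.
move=> mRe mIm; apply: measurable_funM.
  by apply: (@measurableT_comp _ _ _ _ _ _ (@powR R ^~ s)) => //;
     exact: measurable_japan.
rewrite (_ : (fun x => _) =
    (fun x => Num.sqrt (complex.Re (f x) ^+ 2 +
                        complex.Im (f x) ^+ 2))); last first.
  by apply/funext => x; case: (f x).
apply: (@measurableT_comp _ _ _ _ _ _ (@Num.sqrt R)).
  by apply: continuous_measurable_fun; exact: sqrt_continuous.
by apply: measurable_funD; exact: measurable_funX.
Qed.

Lemma Lnorm2_mono (f g : @Rn R d -> R) :
  measurable_fun setT f -> measurable_fun setT g ->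
  (forall xi, 0 <= f xi <= g xi) ->
  ('N[leb]_2%:E[EFin \o f] <= 'N[leb]_2%:E[EFin \o g])%E.
Proof.
move=> mf mg fg; rewrite unlock /Lnorm.
have meas (h : @Rn R d -> R) : measurable_fun setT h ->
    measurable_fun setT (fun xi => (`|h xi| `^ 2)%:E).
  move=> mh; apply/measurable_EFinP.
  by apply: (@measurableT_comp _ _ _ _ _ _ (@powR R ^~ 2)) => //;
     exact: measurableT_comp.
have int_ge0 (h : @Rn R d -> R) : (0 <= \int[leb]_xi (`|h xi| `^ 2)%:E)%E.
  by apply: integral_ge0 => xi _; rewrite lee_fin powR_ge0.
apply: gt0_ler_poweR; rewrite ?invr_ge0//=;
  rewrite ?in_itv/= ?leey ?andbT; try exact: int_ge0.
apply: ge0_le_integral => //.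
- exact: meas.
- exact: meas.
move=> xi _; have /andP[f0 fgxi] := fg xi.
rewrite lee_fin ge0_ler_powR// ?nnegrE//.
by rewrite !ger0_norm// (le_trans f0).
Qed.

Lemma wabs_ge0 s (f : cfun) xi : 0 <= wabs s f xi.
Proof. by rewrite mulr_ge0 ?powR_ge0. Qed.

Lemma Lnorm_wabsD s (f g : cfun) :
  measurable_fun setT (wabs s f) -> measurable_fun setT (wabs s g) ->
  measurable_fun setT (wabs s (f + g)) ->
  ('N[leb]_2%:E[EFin \o wabs s (f + g)%R] <=
   'N[leb]_2%:E[EFin \o wabs s f] + 'N[leb]_2%:E[EFin \o wabs s g])%E.
Proof.
move=> mf mg mfg.
apply: le_trans (@minkowski_EFin _ _ _ leb _ _ _ mf mg _); last first.
  by rewrite ler1n.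
apply: Lnorm2_mono => //; first exact: measurable_funD.
move=> xi; rewrite wabs_ge0/= /wabs -mulrDr ler_wpM2l ?powR_ge0//.
exact: ler_normD.
Qed.

Lemma normRcomplexZ (a : R) (z : Rcomplex R) : `|a *: z| = `|a| * `|z|.
Proof.
case: z => x y; rewrite -[LHS]/(Num.sqrt ((a * x) ^+ 2 + (a * y) ^+ 2)).
by rewrite !exprMn -mulrDr sqrtrM ?sqr_ge0// sqrtr_sqr.
Qed.

Lemma Lnorm_wabsZ s (a : R) (f : cfun) :
  measurable_fun setT (wabs s f) -> finite_norm leb 2%:E (wabs s f) ->
  ('N[leb]_2%:E[EFin \o wabs s (a *: f)%R] =
   `|a|%:E * 'N[leb]_2%:E[EFin \o wabs s f])%E.
Proof.
move=> mf ff.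
have fL : wabs s f \in Lfun leb 2%:E by apply/andP; rewrite !inE.
rewrite -(normr_id a).
rewrite -(LnormZ (Lfun_Sub (lee1n 2) fL) `|a|).
apply: eq_Lnorm => xi /=; congr EFin.
by rewrite /wabs [(a *: f) xi]/(a *: (f xi)) normRcomplexZ mulrCA.
Qed.

Lemma measurable_ReIm_lin (a : R) (f g : cfun) :
  measurable_fun setT (fun xi => complex.Re (f xi)) ->
  measurable_fun setT (fun xi => complex.Im (f xi)) ->
  measurable_fun setT (fun xi => complex.Re (g xi)) ->
  measurable_fun setT (fun xi => complex.Im (g xi)) ->
  measurable_fun setT (fun xi => complex.Re ((a *: f + g) xi)) /\
  measurable_fun setT (fun xi => complex.Im ((a *: f + g) xi)).
Proof.
move=> mRf mIf mRg mIg; split.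
- rewrite (_ : (fun _ => _) =
      (fun xi => a * complex.Re (f xi) + complex.Re (g xi))).
    by apply: measurable_funD => //; exact: measurable_funM.
  by apply/funext => xi; rewrite -[(_ + _) xi]/(a *: f xi + g xi);
    case: (f xi) (g xi) => [? ?] [? ?].
- rewrite (_ : (fun _ => _) =
      (fun xi => a * complex.Im (f xi) + complex.Im (g xi))).
    by apply: measurable_funD => //; exact: measurable_funM.
  by apply/funext => xi; rewrite -[(_ + _) xi]/(a *: f xi + g xi);
    case: (f xi) (g xi) => [? ?] [? ?].
Qed.

Lemma sob_submod_closed isreal s : submod_closed (sob_pred isreal s).
Proof.
have m0R : measurable_fun setT (fun xi => complex.Re ((0 : cfun) xi)).
  by rewrite (_ : (fun _ => _) = cst 0).
have m0I : measurable_fun setT (fun xi => complex.Im ((0 : cfun) xi)).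
  by rewrite (_ : (fun _ => _) = cst 0).
split.
  rewrite inE /=; split => //; rewrite ?/finite_norm.
  - rewrite (_ : _ \o _ = cst 0%E) ?Lnorm0//.
    by apply/funext => xi /=; rewrite /wabs normr0 mulr0.
  - by move=> _; apply/nearW => xi; rewrite -[RHS]/((0 : R[i])^*%C) rmorph0.
move=> a f g; rewrite !inE /= => -[mRf mIf ff hf] [mRg mIg fg hg].
have [mR mI] := measurable_ReIm_lin a mRf mIf mRg mIg.
have [] := measurable_ReIm_lin a mRf mIf m0R m0I; rewrite addr0 => mRa mIa.
split => //.
  rewrite /finite_norm; apply: le_lt_trans (Lnorm_wabsD _ _ _) _;
    try exact: measurable_wabs.
  rewrite Lnorm_wabsZ//; last exact: measurable_wabs.
  by rewrite lte_add_pinfty// lte_mul_pinfty ?lee_fin.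
move=> ir; have := hf ir; have := hg ir; apply: filterS2 => xi hg' hf'.
rewrite -[LHS]/(a *: f (vopp xi) + g (vopp xi)) hf' hg'.
rewrite -[(_ + _) xi]/(a *: f xi + g xi).
case: (f xi) (g xi) => [? ?] [? ?]; congr Complex.
by rewrite opprD mulrN.
Qed.

HB.instance Definition _ isreal s :=
  GRing.isSubmodClosed.Build R cfun (sob_pred isreal s)
    (sob_submod_closed isreal s).

Record sobfun isreal s := SobFun {
  sobval : cfun ; sobvalP : sobval \in sob_pred isreal s }.

HB.instance Definition _ isreal s := [isSub for @sobval isreal s].
HB.instance Definition _ isreal s := [Choice of sobfun isreal s by <:].
HB.instance Definition _ isreal s :=
  [SubChoice_isSubLmodule of sobfun isreal s by <:].
End Sobolev.

Section SobolevSpace.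
Context {R : realType} (d : nat) (isreal : bool) (s : R).
Local Notation V := (@sobfun R d isreal s).
Local Notation leb := (@lebesgue_Rn R d).
Local Open Scope quotient_scope.

Definition sobeq (f g : V) : bool :=
  `[< {ae leb, forall xi, sobval f xi = sobval g xi} >].

Lemma sobeq_refl : reflexive sobeq.
Proof. by move=> f; apply/asboolP; exact: nearW. Qed.

Lemma sobeq_sym : symmetric sobeq.
Proof.
by move=> f g; apply/asboolP/asboolP; apply: filterS => xi ->.
Qed.

Lemma sobeq_trans : transitive sobeq.
Proof.
move=> g f h /asboolP fg /asboolP gh; apply/asboolP.
by move: fg gh; apply: filterS2 => xi -> ->.
Qed.

Canonical sobeq_equiv := EquivRel sobeq sobeq_refl sobeq_sym sobeq_trans.

(* H^s(R^d; C) if isreal = false and H^s(R^d; R) if isreal = true. *)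
Definition sobolev : Type := {eq_quot sobeq}.
HB.instance Definition _ := Choice.on sobolev.
HB.instance Definition _ := EqQuotient.on sobolev.
Implicit Types u v w : sobolev.

(* The Fourier transform of u, defined up to a null set. *)
Definition hat u : cfun d := sobval (repr u).

Lemma sob_piP (f g : V) :
  {ae leb, forall xi, sobval f xi = sobval g xi} ->
  \pi_sobolev f = \pi_sobolev g.
Proof. by move=> fg; apply/eqmodP/asboolP. Qed.

Lemma hat_pi (f : V) : {ae leb, forall xi, hat (\pi_sobolev f) xi = sobval f xi}.
Proof. by have /eqmodP/asboolP := reprK (\pi_sobolev f). Qed.

Definition sob_opp u : sobolev := \pi_sobolev (- repr u).
Definition sob_add u v : sobolev := \pi_sobolev (repr u + repr v).
Definition sob_scale (a : R) u : sobolev := \pi_sobolev (a *: repr u).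
Definition sob_zero : sobolev := \pi_sobolev 0.

Lemma sob_addA : associative sob_add.
Proof.
move=> u v w; apply: sob_piP.
have := hat_pi (repr v + repr w); have := hat_pi (repr u + repr v).
apply: filterS2 => xi E1 E2.
rewrite -[LHS]/(hat u xi + hat (sob_add v w) xi) E2.
by rewrite -[RHS]/(hat (sob_add u v) xi + hat w xi) E1 -addrA.
Qed.

Lemma sob_addC : commutative sob_add.
Proof. by move=> u v; rewrite /sob_add addrC. Qed.

Lemma sob_add0 : left_id sob_zero sob_add.
Proof.
move=> u; rewrite -[RHS]reprK; apply: sob_piP.
have := hat_pi 0; apply: filterS => xi E.
by rewrite -[LHS]/(hat sob_zero xi + hat u xi) E add0r.
Qed.

Lemma sob_addN : left_inverse sob_zero sob_opp sob_add.
Proof.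
move=> u; apply: sob_piP; have := hat_pi (- repr u); apply: filterS => xi E.
by rewrite -[LHS]/(hat (sob_opp u) xi + hat u xi) E -[RHS](addNr (hat u xi)).
Qed.

HB.instance Definition _ :=
  GRing.isZmodule.Build sobolev sob_addA sob_addC sob_add0 sob_addN.

Lemma sob_scaleA a b u : sob_scale a (sob_scale b u) = sob_scale (a * b) u.
Proof.
apply: sob_piP; have := hat_pi (b *: repr u); apply: filterS => xi E.
by rewrite -[LHS]/(a *: hat (sob_scale b u) xi) E -[RHS]scalerA.
Qed.

Lemma sob_scale1 : left_id 1 sob_scale.
Proof. by move=> u; rewrite /sob_scale scale1r reprK. Qed.

Lemma sob_scaleDr : right_distributive sob_scale +%R.
Proof.
move=> a u v; apply: sob_piP.
have := hat_pi (repr u + repr v).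
have := hat_pi (a *: repr u); have := hat_pi (a *: repr v).
apply: filterS3 => xi E1 E2 E3.
rewrite -[LHS]/(a *: hat (sob_add u v) xi) E3.
rewrite -[RHS]/(hat (sob_scale a u) xi + hat (sob_scale a v) xi) E1 E2.
exact: (scalerDr a (hat u xi) (hat v xi)).
Qed.

Lemma sob_scaleDl u : {morph sob_scale^~ u : a b / a + b}.
Proof.
move=> a b; apply: sob_piP.
have := hat_pi (a *: repr u); have := hat_pi (b *: repr u).
apply: filterS2 => xi E1 E2.
rewrite -[RHS]/(hat (sob_scale a u) xi + hat (sob_scale b u) xi) E1 E2.
exact: (scalerDl (hat u xi) a b).
Qed.

HB.instance Definition _ := GRing.Zmodule_isLmodule.Build R sobolev
  sob_scaleA sob_scale1 sob_scaleDr sob_scaleDl.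

Definition sob_norm u : R := fine ('N[leb]_2%:E[EFin \o wabs s (hat u)])%E.

Lemma hat_sob_pred u : hat u \in sob_pred isreal s.
Proof. exact: sobvalP. Qed.

Lemma hatP u :
  [/\ measurable_fun setT (fun xi => complex.Re (hat u xi)),
      measurable_fun setT (fun xi => complex.Im (hat u xi)),
      finite_norm leb 2%:E (wabs s (hat u))
    & isreal -> {ae leb, forall xi, hat u (vopp xi) = (hat u xi)^*%C}].
Proof. by have := hat_sob_pred u; rewrite inE. Qed.

Lemma measurable_wabs_hat u : measurable_fun setT (wabs s (hat u)).
Proof. by have [? ? _ _] := hatP u; exact: measurable_wabs. Qed.

Lemma sob_normE u :
  (sob_norm u)%:E = ('N[leb]_2%:E[EFin \o wabs s (hat u)])%E.
Proof.
rewrite /sob_norm fineK// ge0_fin_numE ?Lnorm_ge0//.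
by have [_ _ ? _] := hatP u.
Qed.

Lemma Lnorm2_ae (f g : @Rn R d -> R) :
  measurable_fun setT f -> measurable_fun setT g ->
  {ae leb, forall xi, f xi = g xi} ->
  ('N[leb]_2%:E[EFin \o f] = 'N[leb]_2%:E[EFin \o g])%E.
Proof.
move=> mf mg fg; rewrite unlock /Lnorm; congr (_ `^ _)%E.
have meas (h : @Rn R d -> R) : measurable_fun setT h ->
    measurable_fun setT (fun xi => (`|h xi| `^ 2)%:E).
  move=> mh; apply/measurable_EFinP.
  by apply: (@measurableT_comp _ _ _ _ _ _ (@powR R ^~ 2)) => //;
     exact: measurableT_comp.
apply: ge0_ae_eq_integral => //=; try exact: meas.
by move: fg; apply: filterS => xi -> _.
Qed.

Lemma sob_norm_pi (f : V) :
  (sob_norm (\pi_sobolev f))%:E = ('N[leb]_2%:E[EFin \o wabs s (sobval f)])%E.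
Proof.
rewrite sob_normE; apply: Lnorm2_ae.
- exact: measurable_wabs_hat.
- by have := sobvalP f; rewrite inE => -[? ? _ _]; exact: measurable_wabs.
by have := hat_pi f; apply: filterS => xi E; rewrite /wabs E.
Qed.

Lemma ler_sob_normD u v : sob_norm (u + v) <= sob_norm u + sob_norm v.
Proof.
rewrite -lee_fin EFinD sob_norm_pi !sob_normE.
apply: Lnorm_wabsD; try exact: measurable_wabs_hat.
by have := sobvalP (repr u + repr v); rewrite inE => -[? ? _ _];
  exact: measurable_wabs.
Qed.

Lemma sob_normZ (a : R) u : sob_norm (a *: u) = `|a| * sob_norm u.
Proof.
apply: EFin_inj; rewrite EFinM sob_norm_pi sob_normE.
apply: Lnorm_wabsZ; first exact: measurable_wabs_hat.
by have [_ _ ? _] := hatP u.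
Qed.

Lemma sob_norm_eq0 u : sob_norm u = 0 -> u = 0.
Proof.
move=> u0; rewrite -[LHS]reprK; apply: sob_piP.
have := sob_normE u; rewrite u0 => /esym/Lnorm_eq0_eq0.
have /measurable_EFinP mw := measurable_wabs_hat u.
have two0 : (0 < 2%:E :> \bar R)%E by rewrite lte_fin.
move=> /(_ mw two0); apply: filterS => xi /(_ I) /=.
move=> [] /eqP; rewrite mulf_eq0 powR_eq0 (gt_eqF (japan_gt0 xi))/=.
by rewrite normr_eq0 => /eqP.
Qed.

HB.instance Definition _ := Lmodule_isNormed.Build R sobolev
  ler_sob_normD sob_normZ sob_norm_eq0.

End SobolevSpace.

Section ProductSpace.
Context {R : realType} (d : nat) (k l : R).

(* H^k(R^d; C) x H^l(R^d; R) x H^(l-1)(R^d; R); Hkl_norm, and not the max norm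
   of the product type, is the norm of Hkl. *)
Definition Hkl : Type :=
  (sobolev d false k * sobolev d true l * sobolev d true (l - 1))%type.
HB.instance Definition _ := GRing.Lmodule.on Hkl.

Definition Hkl_norm (x : Hkl) : R :=
  Num.sqrt (`|x.1.1| ^+ 2 + `|x.1.2| ^+ 2 + `|x.2| ^+ 2).

Lemma sqrt_sum3_le (a b c x y z : R) :
  0 <= a <= x -> 0 <= b <= y -> 0 <= c <= z ->
  Num.sqrt (a ^+ 2 + b ^+ 2 + c ^+ 2) <= Num.sqrt (x ^+ 2 + y ^+ 2 + z ^+ 2).
Proof.
move=> /andP[a0 ax] /andP[b0 bx] /andP[c0 cx].
by rewrite ler_wsqrtr// !lerD// lerXn2r// nnegrE
  (le_trans _ ax, le_trans _ bx, le_trans _ cx).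
Qed.

Lemma sqrt_sum3_normc (a b c : R) :
  Num.sqrt (a ^+ 2 + b ^+ 2 + c ^+ 2) =
  ComplexField.Normc.normc (ComplexField.Normc.normc (a +i* b)%C +i* c)%C.
Proof. by rewrite /= sqr_sqrtr// addr_ge0 ?sqr_ge0. Qed.

Lemma sqrt_sum3D (a b c x y z : R) :
  Num.sqrt ((a + x) ^+ 2 + (b + y) ^+ 2 + (c + z) ^+ 2) <=
  Num.sqrt (a ^+ 2 + b ^+ 2 + c ^+ 2) + Num.sqrt (x ^+ 2 + y ^+ 2 + z ^+ 2).
Proof.
rewrite !sqrt_sum3_normc; apply: le_trans (@le_normcD R _ _).
rewrite /= ler_wsqrtr// lerD2r lerXn2r ?nnegrE ?addr_ge0 ?sqrtr_ge0//.
exact: (@le_normcD R (a +i* b)%C (x +i* y)%C).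
Qed.

Lemma ler_Hkl_normD (x y : Hkl) : Hkl_norm (x + y) <= Hkl_norm x + Hkl_norm y.
Proof.
apply: le_trans (sqrt_sum3D _ _ _ _ _ _).
by apply: sqrt_sum3_le; rewrite normr_ge0 ler_normD.
Qed.

Lemma Hkl_normZ (a : R) (x : Hkl) : Hkl_norm (a *: x) = `|a| * Hkl_norm x.
Proof.
rewrite /Hkl_norm /= !normrZ !exprMn -!mulrDr sqrtrM ?sqr_ge0//.
by rewrite sqrtr_sqr normr_id.
Qed.

Lemma Hkl_norm_eq0 (x : Hkl) : Hkl_norm x = 0 -> x = 0.
Proof.
case: x => [[u n] m] /eqP; rewrite sqrtr_eq0 /= => h.
have : `|u| ^+ 2 + `|n| ^+ 2 + `|m| ^+ 2 == 0.
  by rewrite eq_le h !addr_ge0 ?sqr_ge0.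
rewrite !paddr_eq0 ?addr_ge0 ?sqr_ge0// !sqrf_eq0 !normr_eq0.
by move=> /andP[/andP[/eqP-> /eqP->] /eqP->].
Qed.

HB.instance Definition _ := Lmodule_isNormed.Build R Hkl
  ler_Hkl_normD Hkl_normZ Hkl_norm_eq0.

End ProductSpace.

Section Zakharov.
Context {R : realType} {d : nat}.
Implicit Types (xi eta : @Rn R d) (f g : @cfun R d) (N : nat) (s t : R).
Local Open Scope complex_scope.

Definition Cintegral dT (T : measurableType dT)
    (mu : {measure set T -> \bar R}) (D : set T) (F : T -> R[i]) : R[i] :=
  (\int[mu]_(x in D) complex.Re (F x)) +i* (\int[mu]_(x in D) complex.Im (F x)).

(* F (f g) in terms of F f and F g. *)
Definition conv f g : cfun d := fun xi =>
  ((2 * pi) `^ (- (d%:R / 2)))%:C *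
  Cintegral (lebesgue_Rn d) setT (fun eta => f (vsub xi eta) * g eta).

(* F (f^* ) in terms of F f. *)
Definition hatconj f : cfun d := fun xi => (f (vopp xi))^*.

(* For u in H^k and n in H^l with k, l arbitrary reals, the product u n need not
   be defined at a fixed time.  The quadratic terms of the integral equations
   are therefore read, as usual at low regularity, as limits in the sense of
   distributions: u and n are replaced by their frequency truncations P_N u and
   P_N n to |xi| <= N, for which (P_N u)(P_N n) is a product of smooth functions,
   and N goes to infinity in the Duhamel integral.  Whenever the product is
   continuous from H^k x H^l to some H^sigma, this is the usual meaning. *)
Definition trunc N f : cfun d := fun xi => if vnorm xi <= N%:R then f xi else 0.

(* F ((P_N u) (P_N v)), with f = F u and g = F v. *)
Definition hatprod N f g : cfun d := conv (trunc N f) (trunc N g).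

(* e^(- i t |xi|^2) *)
Definition schrod t xi : R[i] := cos (t * sqnorm xi) -i* sin (t * sqnorm xi).
Definition W0 t xi : R := cos (t * vnorm xi).
Definition W1 t xi : R :=
  if vnorm xi == 0 then t else sin (t * vnorm xi) / vnorm xi.

Definition time_int t (F : R -> R[i]) : R[i] :=
  Cintegral (@lebesgue_measure R) `[0, t] F.

(* Right-hand sides of the three integral equations, on the Fourier side, with
   the quadratic terms truncated at frequency N; f, g are the Fourier transforms
   of the data and - sqnorm xi is the symbol of the Laplacian. *)
Definition rhs_u N f (u n : R -> cfun d) t : cfun d := fun xi =>
  schrod t xi * f xi
  - 'i * time_int t (fun s =>
           schrod (t - s) xi * hatprod N (u s) (n s) xi).

Definition rhs_n N f g (u : R -> cfun d) t : cfun d := fun xi =>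
  (W0 t xi)%:C * f xi + (W1 t xi)%:C * g xi
  + time_int t (fun s => (W1 (t - s) xi * - sqnorm xi)%:C *
                         hatprod N (u s) (hatconj (u s)) xi).

Definition rhs_dtn N f g (u : R -> cfun d) t : cfun d := fun xi =>
  (W0 t xi)%:C * g xi + (W1 t xi * - sqnorm xi)%:C * f xi
  + time_int t (fun s => (W0 (t - s) xi * - sqnorm xi)%:C *
                         hatprod N (u s) (hatconj (u s)) xi).

(* F N --> f in some H^sigma, that is, in the union of all Sobolev spaces. *)
Definition cvg_Hminus (F : nat -> cfun d) f : Prop := exists sigma : R,
  ('N[lebesgue_Rn d]_2%:E[EFin \o wabs sigma (F N - f)%R])%E @[N --> \oo] --> 0%E.

Variables k l : R.
Local Notation H := (Hkl d k l).
Implicit Types (Phi Psi : H) (U V : R -> H) (T r : R).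

(* C([0,T]; H^k) x C([0,T]; H^l) x C([0,T]; H^(l-1)) *)
Definition Cspace T U : Prop :=
  [/\ {within `[0, T], continuous (fun t => (U t).1.1)},
      {within `[0, T], continuous (fun t => (U t).1.2)}
    & {within `[0, T], continuous (fun t => (U t).2)}].

Definition local_solution T Phi U : Prop :=
  Cspace T U /\
  let u t := hat (U t).1.1 in
  let n t := hat (U t).1.2 in
  let dtn t := hat (U t).2 in
  forall t, 0 <= t <= T ->
  [/\ cvg_Hminus (fun N => rhs_u N (hat Phi.1.1) u n t) (u t),
      cvg_Hminus (fun N => rhs_n N (hat Phi.1.2) (hat Phi.2) u t) (n t)
    & cvg_Hminus (fun N => rhs_dtn N (hat Phi.1.2) (hat Phi.2) u t) (dtn t)].

(* S^t; values at t outside [0, T] or at data without a solution are junk. *)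
Definition flow T t Phi : H := (get (local_solution T Phi)) t.

(* Well-posedness on [0, T] for the data in the ball B_r: existence, uniqueness,
   and continuity of the solution map from B_r to C([0,T]; H^{k,l}). *)
Definition locally_well_posed T r : Prop :=
  (forall Phi, `|Phi| < r -> exists2 U, local_solution T Phi U &
     forall V, local_solution T Phi V -> forall t, 0 <= t <= T -> V t = U t) /\
  (forall Phi, `|Phi| < r -> forall e, 0 < e -> exists2 delta, 0 < delta &
     forall Psi, `|Psi| < r -> `|Psi - Phi| < delta ->
     forall t, 0 <= t <= T -> `|flow T t Psi - flow T t Phi| < e).

End Zakharov.
Arguments flow {R} d k l T t Phi.
Arguments locally_well_posed {R} d k l T r.
Arguments local_solution {R d k l} T Phi U.

(* f is Frechet differentiable near x, and y |-> 'd f y is Frechet differentiable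
   at x for the operator norm on continuous linear maps: the bounded bilinear map
   B is its derivative h |-> (v |-> B h v), and the last inequality, uniform in
   v, is an operator-norm bound. *)
Definition twice_differentiable (R : realType) (V W : normedModType R)
    (f : V -> W) (x : V) : Prop :=
  (\forall y \near x, differentiable f y) /\
  exists B : {bilinear V -> V -> W},
    (exists C : R, forall h v, `|B h v| <= C * `|h| * `|v|) /\
    forall e : R, 0 < e -> \forall h \near (0 : V), forall v,
      `|'d f (x + h) v - 'd f x v - B h v| <= e * `|h| * `|v|.

(* Main.v *)
(* For a datum Phi whose Fourier transform is bounded and compactly supported, the
   integral equations can be solved by Picard iteration in a space of functions
   with exponentially decaying Fourier transform, whose radius of decay shrinks
   linearly in time to absorb the two derivatives lost in the wave equation.
   For data delta Phi this yields a solution delta L + delta^2 Q + O(delta^3) at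
   time t; by uniqueness it is the flow, so two derivatives at 0 would force
   |Q| <= C |Phi|^2.
   This fails on data supported in boxes of width about 1 / N along one axis and
   small in the other directions, on which the phase of the time integral stays
   small.  A Schroedinger wave at frequency - N and a half wave at 2 N + 1 produce
   a Schroedinger wave at N + 1, which gives |Q|^2 >= c N^(- 2 l - 1) |Phi|^4;
   Schroedinger waves at N + 1 and - N produce a half wave at 2 N + 1, which gives
   |Q|^2 >= c N^(2 l + 1 - 4 k) |Phi|^4. *)

From Pilot Require Import Defs.
From mathcomp Require Import all_boot all_order all_algebra complex ring lra.
From mathcomp Require Import all_classical all_reals all_analysis.
From mathcomp Require Import measurable_realfun.
Set Implicit Arguments.
Unset Strict Implicit.
Unset Printing Implicit Defensive.
Import Order.TTheory GRing.Theory Num.Theory.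
Import numFieldNormedType.Exports.
Local Open Scope classical_set_scope.
Local Open Scope ring_scope.

(* [convex.v] also defines a [conv]. *)
Local Notation conv := Pilot.Defs.conv.

(** The decay rate of the Fourier transforms serves as a budget. At time s it is T + 2 - s: one unit
    per unit of time pays for the derivative in the Duhamel terms of u and n. Of the 2 units left at
    time T, one pays for removing the frequency truncation, with error O(1 / N), one half for the
    polynomial growth of the kernels, and the last half dominates the Sobolev weight for any real k
    and l. The frequencies come from (N + 1)^2 - N^2 = 2 N + 1: at the centres of the boxes a
    difference of Schroedinger phases is exactly a wave phase. With boxes whose size depends on T
    but not on N, the phase stays below 1/2 up to time T. The real part of the integrand then has a
    pointwise lower bound, and no oscillatory integral has to be estimated. The obstacle is that n
    is real, so that both half waves are always present. In the first case they sit at opposite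
    frequencies, and the unwanted one misses the output box; in the second case a complex
    combination of n and its time derivative isolates one of them. The expansion of the flow is
    known only along one ray delta Phi at a time, with constants depending on Phi; the bound on Q
    must nevertheless be uniform in Phi. *)

(** * Lebesgue measure on R^n: reflections, product integrals, boxes *)

Section LebesgueRn.
Context {R : realType}.
Local Notation leb := (@lebesgue_measure R).

(** Both measures agree on half-open intervals, which determine Lebesgue measure. Reflections x |->
    c - x are what the substitution eta |-> xi - eta in a convolution requires. *)
Lemma lebesgue_measure_reflect (c : R) (A : set R) : measurable A ->
  pushforward leb ((fun x : R => (c - x)%R) : measurableTypeR R -> measurableTypeR R) A = leb A.
Proof.
move=> mA; have mr : measurable_fun setT ((fun x : R => (c - x)%R) : measurableTypeR R -> measurableTypeR R).
  by apply: measurable_funB.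
pose pf : {measure set (measurableTypeR R) -> \bar R} :=
  measure_function_pushforward__canonical__measure_function_Measure leb mr.
apply/esym; apply: (@lebesgue_measure_unique R pf) => // _ [[a b]] _ <-.
rewrite /pf/= /pushforward.
rewrite [X in _ = leb X](_ : _ = `[c - b, c - a[%classic); last first.
  apply/seteqP; split=> x /=; rewrite !in_itv/= => /andP[h1 h2];
    apply/andP; split; lra.
rewrite !lebesgue_measure_itv/= !lte_fin.
rewrite (_ : (c - b < c - a) = (a < b)); last by apply/idP/idP; lra.
by case: ifP => // _; rewrite -!EFinB; congr EFin; lra.
Qed.

Lemma ge0_integral_reflect (c : R) (f : R -> \bar R) :
  measurable_fun setT f -> (forall x, (0 <= f x)%E) ->
  (\int[leb]_x f (c - x)%R = \int[leb]_x f x)%E.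
Proof.
move=> mf f0; have mr : measurable_fun setT ((fun x : R => (c - x)%R) : measurableTypeR R -> measurableTypeR R).
  by apply: measurable_funB.
transitivity (\int[pushforward leb ((fun x : R => (c - x)%R) : measurableTypeR R -> measurableTypeR R)]_x f x)%E.
  by rewrite (ge0_integral_pushforward mr).
by apply: eq_measure_integral => A mA _; exact: lebesgue_measure_reflect.
Qed.

Lemma ge0_integral_Rn_cons n (f : @Rn R n.+1 -> \bar R) :
  measurable_fun setT f -> (forall x, (0 <= f x)%E) ->
  (\int[lebesgue_Rn n.+1]_x f x =
   \int[leb]_a \int[lebesgue_Rn n]_v f (vcons (a, v)))%E.
Proof.
move=> mf f0.
transitivity (\int[(leb \x lebesgue_Rn n)%E]_x (f \o @vcons R n) x)%E.
  by rewrite -(ge0_integral_pushforward (@measurable_vcons R n) _ (D := setT)).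
rewrite fubini_tonelli1//; first exact: (measurableT_comp mf (@measurable_vcons R n)).
by move=> x; exact: f0.
Qed.

Lemma measurable_vsub d : measurable_fun setT
  (fun z : @Rn R d * @Rn R d => vsub z.1 z.2).
Proof.
apply/measurable_fun_tnthP => i.
rewrite (_ : _ \o _ = (fun z : @Rn R d * @Rn R d => tnth z.1 i - tnth z.2 i)).
  apply: measurable_funB.
    exact: (measurableT_comp (@measurable_tnth _ (measurableTypeR R) d i) measurable_fst).
  exact: (measurableT_comp (@measurable_tnth _ (measurableTypeR R) d i) measurable_snd).
by apply/funext => z /=; rewrite tnth_mktuple.
Qed.

Lemma measurable_vsubr d (xi : @Rn R d) : measurable_fun setT (vsub xi).
Proof.
exact: (measurableT_comp (@measurable_vsub d) (measurable_pair1 xi)).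
Qed.

Lemma measurable_vopp d : measurable_fun setT (@vopp R d).
Proof.
apply/measurable_fun_tnthP => i.
rewrite (_ : _ \o _ = (fun z : @Rn R d => - tnth z i)).
  apply: measurable_funN; exact: (@measurable_tnth _ (measurableTypeR R) d i).
by apply/funext => z /=; rewrite tnth_mktuple.
Qed.

Lemma vsub_cons n (xi : @Rn R n.+1) a v :
  vsub xi (vcons (a, v)) = vcons (thead xi - a, vsub [tuple of behead xi] v).
Proof.
apply: eq_from_tnth => i; rewrite !tnth_mktuple.
case: (tupleP xi) => x0 x; rewrite theadE.
case: (unliftP ord0 i) => [j ->|->].
  by rewrite !tnthS/= tnth_mktuple; congr (tnth _ _ - _); exact: val_inj.
by rewrite !tnth0.
Qed.

(** Induction on the dimension: Tonelli splits off the first coordinate, which is treated by the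
    one-dimensional reflection, the others by the induction hypothesis. *)
Lemma ge0_integral_vsub d (xi : @Rn R d) (f : @Rn R d -> \bar R) :
  measurable_fun setT f -> (forall x, (0 <= f x)%E) ->
  (\int[lebesgue_Rn d]_eta f (vsub xi eta) = \int[lebesgue_Rn d]_eta f eta)%E.
Proof.
elim: d xi f => [|n IH] xi f mf f0.
  by apply: eq_integral => x _; rewrite (tuple0 x) (tuple0 (vsub _ _)).
have mfc : measurable_fun setT (f \o @vcons R n).
  exact: (measurableT_comp mf (@measurable_vcons R n)).
rewrite !ge0_integral_Rn_cons//; last first.
  exact: (measurableT_comp mf (measurable_vsubr xi)).
under eq_integral => a _ do under eq_integral => v _ do rewrite vsub_cons.
under eq_integral => a _.
  rewrite (IH [tuple of behead xi] (fun v => f (vcons (thead xi - a, v))))//.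
    over.
  exact: (measurableT_comp mfc (measurable_pair1 (thead xi - a))).
apply: (ge0_integral_reflect (thead xi)
  (f := fun a => \int[lebesgue_Rn n]_v f (vcons (a, v)))%E).
  have := @measurable_fun_fubini_tonelli_F _ _ _ _ _ (lebesgue_Rn n) (f \o @vcons R n) mfc (fun x => f0 _).
  exact.
by move=> x; apply: integral_ge0.
Qed.

Lemma ge0_integral_Rn_prod n (g : 'I_n -> R -> R) (c : 'I_n -> R) :
  (forall i, measurable_fun setT (g i)) -> (forall i x, 0 <= g i x) ->
  (forall i, (\int[leb]_x (g i x)%:E = (c i)%:E)%E) ->
  (\int[lebesgue_Rn n]_x (\prod_(i < n) g i (tnth x i))%:E =
   (\prod_(i < n) c i)%:E)%E.
Proof.
elim: n g c => [|n IH] g c mg g0 gc.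
  under eq_integral => x _ do rewrite big_ord0.
  by rewrite big_ord0 /= integral_dirac// diracT mul1e.
rewrite ge0_integral_Rn_cons; first last.
- by move=> x; rewrite lee_fin prodr_ge0.
- apply/measurable_EFinP/measurable_prod => i _.
  exact: (measurableT_comp (mg i) (@measurable_tnth _ (measurableTypeR R) n.+1 i)).
have c0 i : 0 <= c i.
  by rewrite -lee_fin -gc; apply: integral_ge0 => x _; rewrite lee_fin.
transitivity (\int[leb]_a ((\prod_(i < n) c (lift ord0 i))%:E * (g ord0 a)%:E))%E.
  apply: eq_integral => a _.
  rewrite -(IH (fun i => g (lift ord0 i)))//.
  rewrite muleC -ge0_integralZl_EFin//.
  - apply: eq_integral => v _; rewrite big_ord_recl tnth0 EFinM.
    by congr (_ * EFin _)%E; apply: eq_bigr => i _; rewrite tnthS.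
  - by move=> x _; rewrite lee_fin prodr_ge0.
  - apply/measurable_EFinP/measurable_prod => i _.
    exact: (measurableT_comp (mg _) (@measurable_tnth _ (measurableTypeR R) n i)).
rewrite ge0_integralZl_EFin//; first by rewrite gc big_ord_recl EFinM muleC.
- by move=> x _; rewrite lee_fin.
- exact: (iffRL (measurable_EFinP _ _) (mg ord0)).
- by rewrite prodr_ge0.
Qed.

Lemma lebesgue_Rn_box n (c h : 'I_n -> R) : (forall i, 0 <= h i) ->
  lebesgue_Rn n [set x | forall i, `|tnth x i - c i| <= h i] =
  (\prod_(i < n) (2 * h i))%:E.
Proof.
move=> h0.
have me i : [set x | `|x - c i| <= h i] = `[c i - h i, c i + h i]%classic.
  by apply/seteqP; split=> x /=; rewrite in_itv/= ler_norml => /andP[? ?];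
    apply/andP; split; lra.
have mi i : measurable [set x | `|x - c i| <= h i].
  by rewrite me.
have mb : measurable [set x : @Rn R n | forall i, `|tnth x i - c i| <= h i].
  rewrite (_ : [set x | _] = \bigcap_(i in [set: 'I_n])
     ((fun x : @Rn R n => tnth x i) @^-1` [set x | `|x - c i| <= h i])).
    apply: fin_bigcap_measurable => // i _; rewrite -[X in measurable X]setTI.
    by apply: (@measurable_tnth _ (measurableTypeR R) n i) => //; exact: mi.
  by apply/seteqP; split=> x /= H i; [move=> _|]; exact: H.
rewrite -(setIT [set x | _]) -integral_indic//.
rewrite -(ge0_integral_Rn_prod (g := fun i => \1_[set x | `|x - c i| <= h i]))//.
- apply: eq_integral => x _; congr EFin.
  rewrite indicE; have [xB|xB] := boolP (x \in _).
    rewrite big1// => i _; rewrite indicE mem_set//=.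
    by move: xB; rewrite inE.
  apply/esym/eqP; rewrite prodf_seq_eq0; apply/hasP.
  move: xB; rewrite notin_setE/= => /existsNP[i xi].
  by exists i; rewrite ?mem_index_enum//= indicE memNset.
- move=> i; transitivity (leb `[c i - h i, c i + h i]%classic).
    by rewrite -me -[in RHS](setIT [set x | _]); apply: integral_indic => //; exact: mi.
  rewrite lebesgue_measure_itv/= lte_fin.
  have := h0 i; rewrite le_eqVlt => /predU1P[<-|hi].
    by rewrite subr0 addr0 ltxx mulr0.
  by rewrite ifT; [rewrite -EFinB; congr EFin; lra|lra].
Qed.

(** By evenness, twice the integral over the half-line, where [atan] is an antiderivative.
    Finiteness is what the integrability of [weight0] uses. *)
Lemma integral_inv_sqr1_lty :
  exists2 c : R, 0 <= c & (\int[leb]_x ((1 + x ^+ 2)^-1)%:E = c%:E)%E.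
Proof.
exists (2 * (pi / 2 - atan 0)).
  by rewrite atan0 subr0 mulr_ge0// divr_ge0// pi_ge0.
have c0 (x : R) : 1 + x ^+ 2 != 0 by have := sqr_ge0 x; lra.
have cf : continuous (fun x : R => (1 + x ^+ 2)^-1).
  move=> x; apply: cvgV => //; apply: cvgD; first exact: cvg_cst.
  exact: (@exprn_continuous R 2 x).
rewrite ge0_symfun_integralT//.
- rewrite (_ : [set x | _] = `[0, +oo[%classic); last first.
    by apply/seteqP; split=> x /=; rewrite in_itv/= andbT.
  rewrite (ge0_continuous_FTC2y (F := atan) (l := pi / 2))//.
  + by move=> x _; rewrite invr_ge0; have := sqr_ge0 x; lra.
  + by apply: continuous_subspaceT => x; exact: cf.
  + exact: cvgy_atan.
  + apply: cvg_at_right_filter; apply: differentiable_continuous.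
    by apply/derivable1_diffP; exact: derivable_atan.
  + move=> x _; rewrite derive1E; exact: derive_val.
- by move=> x; rewrite invr_ge0; have := sqr_ge0 x; lra.
- by move=> x /=; rewrite sqrrN.
Qed.
End LebesgueRn.

(** * Measurability and integration of complex-valued functions *)

Section ComplexMeasurable.
Context {R : realType}.
Local Notation cabs := (@ComplexField.Normc.normc R).
Implicit Types z w : R[i].

Lemma cabs_ge0 z : 0 <= cabs z.
Proof. by case: z => a b; exact: sqrtr_ge0. Qed.

Lemma cabsD z w : cabs (z + w) <= cabs z + cabs w.
Proof. exact: le_normcD. Qed.

Lemma cabsN z : cabs (- z) = cabs z.
Proof. exact: normcN. Qed.

Lemma cabsB z w : cabs (z - w) <= cabs z + cabs w.
Proof. by rewrite -(cabsN w) cabsD. Qed.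

Lemma cabs_distC z w : cabs (z - w) = cabs (w - z).
Proof. by rewrite -cabsN opprB. Qed.

Lemma cabsJ z : cabs z^*%C = cabs z.
Proof. by case: z => a b /=; rewrite sqrrN. Qed.

Lemma cabs_real (x : R) : cabs x%:C%C = `|x|.
Proof. by rewrite /= expr0n /= addr0 sqrtr_sqr. Qed.

Lemma cabs_i : cabs 'i%C = 1.
Proof. by rewrite /= expr0n /= add0r expr1n sqrtr1. Qed.

Lemma cabs_le_add z : cabs z <= `|complex.Re z| + `|complex.Im z|.
Proof.
case: z => a b /=; rewrite -(ger0_norm (addr_ge0 (normr_ge0 a) (normr_ge0 b))).
rewrite -sqrtr_sqr ler_wsqrtr// sqrrD !real_normK ?num_real//.
by rewrite lerD2r lerDl mulrn_wge0// mulr_ge0.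
Qed.

Lemma Re_le_cabs z : `|complex.Re z| <= cabs z.
Proof.
by case: z => a b /=; rewrite -sqrtr_sqr ler_wsqrtr// lerDl sqr_ge0.
Qed.

Lemma Im_le_cabs z : `|complex.Im z| <= cabs z.
Proof.
by case: z => a b /=; rewrite -sqrtr_sqr ler_wsqrtr// lerDr sqr_ge0.
Qed.

Lemma cReM z w : complex.Re (z * w) =
  complex.Re z * complex.Re w - complex.Im z * complex.Im w.
Proof. by case: z w => [? ?] [? ?]. Qed.

Lemma cImM z w : complex.Im (z * w) =
  complex.Re z * complex.Im w + complex.Im z * complex.Re w.
Proof. by case: z w => [? ?] [? ?]. Qed.

Lemma cReB z w : complex.Re (z - w) = complex.Re z - complex.Re w.
Proof. by case: z w => [? ?] [? ?]. Qed.

Lemma cImB z w : complex.Im (z - w) = complex.Im z - complex.Im w.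
Proof. by case: z w => [? ?] [? ?]. Qed.

Lemma cReD z w : complex.Re (z + w) = complex.Re z + complex.Re w.
Proof. by case: z w => [? ?] [? ?]. Qed.

Lemma cImD z w : complex.Im (z + w) = complex.Im z + complex.Im w.
Proof. by case: z w => [? ?] [? ?]. Qed.

Lemma complexP z w : complex.Re z = complex.Re w -> complex.Im z = complex.Im w ->
  z = w.
Proof. by case: z w => [a b] [c e] /= -> ->. Qed.

Lemma conjcM_eq z w : (z * w)^*%C = z^*%C * w^*%C.
Proof. exact: (rmorphM (@conjc R)). Qed.

Lemma conjcD_eq z w : (z + w)^*%C = z^*%C + w^*%C.
Proof. exact: (rmorphD (@conjc R)). Qed.

Definition cmeas dT (T : measurableType dT) (F : T -> R[i]) : Prop :=
  measurable_fun setT (fun x => complex.Re (F x)) /\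
  measurable_fun setT (fun x => complex.Im (F x)).

Section Closure.
Context dT (T : measurableType dT).
Implicit Types F G : T -> R[i].

Lemma cmeasM F G : cmeas F -> cmeas G -> cmeas (fun x => F x * G x).
Proof.
move=> [FR FI] [GR GI]; split.
  under eq_fun do rewrite cReM.
  by apply: measurable_funB; exact: measurable_funM.
under eq_fun do rewrite cImM.
by apply: measurable_funD; exact: measurable_funM.
Qed.

Lemma cmeasD F G : cmeas F -> cmeas G -> cmeas (fun x => F x + G x).
Proof.
move=> [FR FI] [GR GI]; split.
  by under eq_fun do rewrite cReD; exact: measurable_funD.
by under eq_fun do rewrite cImD; exact: measurable_funD.
Qed.

Lemma cmeasB F G : cmeas F -> cmeas G -> cmeas (fun x => F x - G x).
Proof.
move=> [FR FI] [GR GI]; split.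
  by under eq_fun do rewrite cReB; exact: measurable_funB.
by under eq_fun do rewrite cImB; exact: measurable_funB.
Qed.

Lemma cmeas_cst z : cmeas (fun _ : T => z).
Proof. by split; exact: measurable_cst. Qed.

Lemma cmeas_conj F : cmeas F -> cmeas (fun x => (F x)^*%C).
Proof.
move=> [FR FI]; split.
  by rewrite (_ : (fun _ => _) = (fun x => complex.Re (F x)))//;
     apply/funext => x; case: (F x).
rewrite (_ : (fun _ => _) = (fun x => - complex.Im (F x))).
  exact: measurable_funN.
by apply/funext => x; case: (F x).
Qed.

Lemma cmeas_complex (f g : T -> R) : measurable_fun setT f ->
  measurable_fun setT g -> cmeas (fun x => (f x +i* g x)%C).
Proof. by []. Qed.

Lemma cmeas_real (f : T -> R) : measurable_fun setT f ->
  cmeas (fun x => (f x)%:C%C).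
Proof. by move=> mf; split => //; exact: measurable_cst. Qed.

Lemma cmeas_if (b : T -> bool) F G : measurable_fun setT b ->
  cmeas F -> cmeas G -> cmeas (fun x => if b x then F x else G x).
Proof.
move=> mb [FR FI] [GR GI]; split.
  rewrite (_ : (fun _ => _) =
    (fun x => if b x then complex.Re (F x) else complex.Re (G x))).
    exact: measurable_fun_ifT.
  by apply/funext => x; case: (b x).
rewrite (_ : (fun _ => _) =
    (fun x => if b x then complex.Im (F x) else complex.Im (G x))).
  exact: measurable_fun_ifT.
by apply/funext => x; case: (b x).
Qed.

Lemma cmeas_comp dU (U : measurableType dU) (g : U -> T) F :
  cmeas F -> measurable_fun setT g -> cmeas (fun x => F (g x)).
Proof.
by move=> [FR FI] mg; split;
  [exact: (measurableT_comp FR mg)|exact: (measurableT_comp FI mg)].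
Qed.
End Closure.

Section Rparam.
Context d1 d2 (T1 : measurableType d1) (T2 : measurableType d2)
  (m2 : {sigma_finite_measure set T2 -> \bar R}).

(** No integrability is assumed: the integrals of the positive and negative parts are measurable by
    Tonelli, and so are their difference and its image under [fine]. *)
Lemma measurable_Rintegral_param (f : T1 * T2 -> R) : measurable_fun setT f ->
  measurable_fun setT (fun x => \int[m2]_y f (x, y)).
Proof.
move=> mf; rewrite /Rintegral.
have mfE : measurable_fun setT (EFin \o f) by exact/measurable_EFinP.
apply: (measurableT_comp (f := fine)) => //.
rewrite (_ : (fun x => _) = (fun x => fubini_F m2 ((EFin \o f)^\+) x -
                         fubini_F m2 ((EFin \o f)^\-) x)%E); last first.
  apply/funext => x; rewrite /fubini_F [LHS]integralE.
  by congr (_ - _)%E; apply: eq_integral => y _; rewrite ?funeposE ?funenegE.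
apply: emeasurable_funB; apply: measurable_fun_fubini_tonelli_F => //.
- exact: measurable_funepos.
- exact: measurable_funeneg.
Qed.

Lemma cmeas_Cintegral (F : T1 * T2 -> R[i]) : cmeas F ->
  cmeas (fun x => Cintegral m2 setT (fun y => F (x, y))).
Proof.
by move=> [FR FI]; split;
  [exact: (measurable_Rintegral_param FR)|exact: (measurable_Rintegral_param FI)].
Qed.
End Rparam.

Section CintegralTheory.
Context dT (T : measurableType dT) (mu : {measure set T -> \bar R}).
Implicit Types (D : set T) (F G : T -> R[i]).

Definition cintegrable D F : Prop :=
  mu.-integrable D (EFin \o (fun x => complex.Re (F x))) /\
  mu.-integrable D (EFin \o (fun x => complex.Im (F x))).

Lemma cintegrable_le D F (g : T -> R) : measurable D -> cmeas F ->
  mu.-integrable D (EFin \o g) -> (forall x, D x -> cabs (F x) <= g x) ->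
  cintegrable D F.
Proof.
move=> mD [FR FI] ig Fg; split; apply: le_integrable ig => //.
- by apply/measurable_EFinP; exact: measurable_funTS.
- move=> x Dx /=; rewrite lee_fin (le_trans (Re_le_cabs _))//.
  exact: le_trans (Fg _ Dx) (ler_norm _).
- by apply/measurable_EFinP; exact: measurable_funTS.
- move=> x Dx /=; rewrite lee_fin (le_trans (Im_le_cabs _))//.
  exact: le_trans (Fg _ Dx) (ler_norm _).
Qed.

(** The factor 2 comes from bounding the real and imaginary parts separately; it reappears in all
    the constants below. *)
Lemma cabs_Cintegral_le D F (g : T -> R) : measurable D -> cmeas F ->
  mu.-integrable D (EFin \o g) -> (forall x, D x -> cabs (F x) <= g x) ->
  cabs (Cintegral mu D F) <= 2 * \int[mu]_(x in D) g x.
Proof.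
move=> mD mF ig Fg; have [iR iI] := cintegrable_le mD mF ig Fg.
apply: le_trans (cabs_le_add _) _; rewrite [X in _ <= X * _](_ : 2 = 1 + 1)// mulrDl !mul1r /=.
apply: lerD; (apply: le_trans (le_normr_Rintegral mD _) _ => //);
  apply: le_Rintegral => //.
- exact: (integrable_norm iR).
- by move=> x Dx; exact: le_trans (Re_le_cabs _) (Fg _ Dx).
- exact: (integrable_norm iI).
- by move=> x Dx; exact: le_trans (Im_le_cabs _) (Fg _ Dx).
Qed.

Lemma eq_Cintegral D F G : (forall x, D x -> F x = G x) ->
  Cintegral mu D F = Cintegral mu D G.
Proof.
move=> FG; rewrite /Cintegral; congr Complex; apply: eq_Rintegral => x;
  by rewrite inE => Dx; rewrite FG.
Qed.

Lemma CintegralB D F G : measurable D -> cintegrable D F -> cintegrable D G ->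
  Cintegral mu D (fun x => F x - G x) = Cintegral mu D F - Cintegral mu D G.
Proof.
move=> mD [FR FI] [GR GI]; apply: complexP; rewrite ?cReB ?cImB /=.
  by under eq_Rintegral do rewrite cReB; rewrite RintegralB.
by under eq_Rintegral do rewrite cImB; rewrite RintegralB.
Qed.

Lemma CintegralD D F G : measurable D -> cintegrable D F -> cintegrable D G ->
  Cintegral mu D (fun x => F x + G x) = Cintegral mu D F + Cintegral mu D G.
Proof.
move=> mD [FR FI] [GR GI]; apply: complexP; rewrite ?cReD ?cImD /=.
  by under eq_Rintegral do rewrite cReD; rewrite RintegralD.
by under eq_Rintegral do rewrite cImD; rewrite RintegralD.
Qed.

Lemma integrable_scale D (r : R) (f : T -> R) : measurable D ->
  mu.-integrable D (EFin \o f) -> mu.-integrable D (EFin \o (fun x => r * f x)).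
Proof.
move=> mD intf; rewrite (_ : _ \o _ = (fun x => r%:E * (EFin \o f) x)%E).
  exact: integrableZl.
by apply/funext => x; rewrite /= EFinM.
Qed.

Lemma integrable_add D (f g : T -> R) : measurable D ->
  mu.-integrable D (EFin \o f) -> mu.-integrable D (EFin \o g) ->
  mu.-integrable D (EFin \o (fun x => f x + g x)).
Proof.
move=> mD intf intg.
rewrite (_ : _ \o _ = (fun x => (EFin \o f) x + (EFin \o g) x)%E).
  exact: integrableD.
by apply/funext => x; rewrite /= EFinD.
Qed.

Lemma CintegralZ D z F : measurable D -> cintegrable D F ->
  Cintegral mu D (fun x => z * F x) = z * Cintegral mu D F.
Proof.
move=> mD [FR FI]; apply: complexP; rewrite ?cReM ?cImM /=.
  under eq_Rintegral do rewrite cReM.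
  by rewrite RintegralB ?RintegralZl//; exact: integrable_scale.
under eq_Rintegral do rewrite cImM.
by rewrite RintegralD ?RintegralZl//; exact: integrable_scale.
Qed.

Lemma cintegrableZ D z F : measurable D -> cintegrable D F ->
  cintegrable D (fun x => z * F x).
Proof.
move=> mD [FR FI]; split.
  rewrite (_ : _ \o _ = (fun x => (complex.Re z)%:E * (complex.Re (F x))%:E -
      (complex.Im z)%:E * (complex.Im (F x))%:E)%E).
    by apply: integrableB => //; exact: integrableZl.
  by apply/funext => x /=; rewrite cReM EFinB !EFinM.
rewrite (_ : _ \o _ = (fun x => (complex.Re z)%:E * (complex.Im (F x))%:E +
    (complex.Im z)%:E * (complex.Re (F x))%:E)%E).
  by apply: integrableD => //; exact: integrableZl.
by apply/funext => x /=; rewrite cImM EFinD !EFinM.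
Qed.

Lemma Cintegral_conj D F : measurable D -> cintegrable D F ->
  Cintegral mu D (fun x => (F x)^*%C) = (Cintegral mu D F)^*%C.
Proof.
move=> mD [FR FI]; apply: complexP => /=.
  by apply: eq_Rintegral => x _; case: (F x).
transitivity (\int[mu]_(x in D) (- 1 * complex.Im (F x))).
  by apply: eq_Rintegral => x _; rewrite mulN1r; case: (F x).
by rewrite RintegralZl// mulN1r.
Qed.

End CintegralTheory.
End ComplexMeasurable.

Lemma measurable_fun_inv_ge0 {R : realType} dT (T : measurableType dT)
    (f : T -> R) : (forall x, 0 <= f x) -> measurable_fun setT f ->
  measurable_fun setT (fun x => (f x)^-1).
Proof.
move=> f0 mf; under eq_fun do rewrite -powR_inv1//.
by apply: (@measurableT_comp _ _ _ _ _ _ (@powR R ^~ (- 1))).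
Qed.

(** * Exponential weights in frequency *)

Section Weights.
Context {R : realType} {d : nat}.
Local Notation leb := (@lebesgue_Rn R d).
Implicit Types xi eta : @Rn R d.

(** The added 1 makes [pnorm] at least 1, so that its powers increase with the exponent and dominate
    constants as well as powers of [vnorm]; the triangle inequality is preserved. *)
Definition pnorm xi : R := 1 + \sum_(i < d) `|tnth xi i|.
(* Weights stable under convolution: the exponential of pnorm is
   submultiplicative, and weight0 * weight0 is bounded by a multiple of weight0. *)
Definition weight0 xi : R := ((1 + sqnorm xi)^-1) ^+ d.
Definition weight (a : R) xi : R := expR (- a * pnorm xi) * weight0 xi.

Lemma weightE a xi : weight a xi = expR (- a * pnorm xi) * weight0 xi.
Proof. by []. Qed.

Lemma sqnorm_ge0 xi : 0 <= sqnorm xi.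
Proof. by rewrite sumr_ge0// => i _; exact: sqr_ge0. Qed.

Lemma vnorm_ge0 xi : 0 <= vnorm xi.
Proof. exact: sqrtr_ge0. Qed.

Lemma sqr_vnorm xi : vnorm xi ^+ 2 = sqnorm xi.
Proof. by rewrite sqr_sqrtr// sqnorm_ge0. Qed.

Lemma pnorm_ge1 xi : 1 <= pnorm xi.
Proof. by rewrite lerDl sumr_ge0. Qed.

Lemma pnorm_gt0 xi : 0 < pnorm xi.
Proof. exact: lt_le_trans ltr01 (pnorm_ge1 xi). Qed.

Lemma vnorm_le_pnorm xi : vnorm xi <= pnorm xi.
Proof.
rewrite -(ger0_norm (ltW (pnorm_gt0 xi))) -sqrtr_sqr ler_wsqrtr//.
have : sqnorm xi <= (\sum_(i < d) `|tnth xi i|) ^+ 2.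
  rewrite expr2 mulr_suml; apply: ler_sum => i _.
  rewrite -[X in X <= _]real_normK ?num_real// expr2 ler_wpM2l//.
  by rewrite (bigD1 i)//= lerDl sumr_ge0.
move=> h; apply: (le_trans h); rewrite /pnorm.
have : 0 <= \sum_(i < d) `|tnth xi i| by rewrite sumr_ge0.
by move: (\sum_(i < d) _) => s s0; nra.
Qed.

Lemma sqnorm_le_pnorm xi : sqnorm xi <= pnorm xi ^+ 2.
Proof.
by rewrite -sqr_vnorm lerXn2r// ?nnegrE ?vnorm_ge0 ?vnorm_le_pnorm ?ltW ?pnorm_gt0.
Qed.

Lemma pnorm_vsub xi eta : pnorm xi <= pnorm (vsub xi eta) + pnorm eta.
Proof.
rewrite /pnorm addrACA -[X in X <= _]addr0 -addrA.
have : \sum_(i < d) `|tnth xi i| <=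
    \sum_(i < d) `|tnth (vsub xi eta) i| + \sum_(i < d) `|tnth eta i|.
  rewrite -big_split/=; apply: ler_sum => i _; rewrite tnth_mktuple.
  by rewrite -{1}(subrK (tnth eta i) (tnth xi i)) ler_normD.
lra.
Qed.

Lemma pnorm_vopp xi : pnorm (vopp xi) = pnorm xi.
Proof.
by congr (_ + _); apply: eq_bigr => i _; rewrite tnth_mktuple normrN.
Qed.

Lemma sqnorm_vopp xi : sqnorm (vopp xi) = sqnorm xi.
Proof. by apply: eq_bigr => i _; rewrite tnth_mktuple sqrrN. Qed.

Lemma vnorm_vopp xi : vnorm (vopp xi) = vnorm xi.
Proof. by rewrite /vnorm sqnorm_vopp. Qed.

Lemma voppK : involutive (@vopp R d).
Proof. by move=> xi; apply: eq_from_tnth => i; rewrite !tnth_mktuple opprK. Qed.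

Lemma sqnorm_vsub xi eta :
  sqnorm xi <= 2 * sqnorm (vsub xi eta) + 2 * sqnorm eta.
Proof.
rewrite /sqnorm !mulr_sumr -big_split/=; apply: ler_sum => i _.
rewrite tnth_mktuple; move: (tnth xi i) (tnth eta i) => x y.
have : 0 <= (x - 2 * y) ^+ 2 by exact: sqr_ge0.
by rewrite -subr_ge0; congr (0 <= _); ring.
Qed.

Lemma weight0_gt0 xi : 0 < weight0 xi.
Proof. by rewrite exprn_gt0// invr_gt0 ltr_wpDr// sqnorm_ge0. Qed.

Lemma weight_gt0 a xi : 0 < weight a xi.
Proof. by rewrite mulr_gt0 ?expR_gt0 ?weight0_gt0. Qed.

Lemma weight_vopp a xi : weight a (vopp xi) = weight a xi.
Proof. by rewrite /weight /weight0 pnorm_vopp sqnorm_vopp. Qed.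

Lemma le_weight a b xi : b <= a -> weight a xi <= weight b xi.
Proof.
move=> ba; rewrite ler_wpM2r ?(ltW (weight0_gt0 _))// ler_expR.
by rewrite ler_wpM2r ?lerN2// ltW// pnorm_gt0.
Qed.

(** One of xi - eta and eta has at least a quarter of the squared norm of xi, so its factor is at
    most 4^d [weight0 xi]. The other factor is one of the two terms of the sum on the right. *)
Lemma weight0_quasi_sub xi eta :
  weight0 (vsub xi eta) * weight0 eta <=
  4 ^+ d * weight0 xi * (weight0 (vsub xi eta) + weight0 eta).
Proof.
rewrite /weight0; set X := sqnorm xi; set Y := sqnorm _; set Z := sqnorm eta.
have [X0 Y0 Z0] : [/\ 0 <= X, 0 <= Y & 0 <= Z] by rewrite !sqnorm_ge0.
have h : X <= 2 * Y + 2 * Z by exact: sqnorm_vsub.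
have key (y : R) : 0 <= y -> X <= 4 * y + 3 -> ((1 + y)^-1) ^+ d <= 4 ^+ d * ((1 + X)^-1) ^+ d.
  move=> y0 Xy; rewrite -exprMn lerXn2r ?nnegrE ?invr_ge0 ?mulr_ge0 ?invr_ge0 ?addr_ge0//.
  by rewrite -[X in X <= _]mul1r ler_pdivrMr ?ltr_wpDr// mulrAC ler_pdivlMr ?ltr_wpDr//; lra.
have p (y : R) : 0 <= y -> 0 <= (1 + y)^-1 ^+ d.
  by move=> y0; rewrite exprn_ge0// invr_ge0 addr_ge0.
have c0 : 0 <= 4 ^+ d * ((1 + X)^-1) ^+ d by apply: mulr_ge0; [exact: exprn_ge0|exact: p].
have [YZ|ZY] := leP Y Z.
  apply: le_trans (_ : _ <= ((1 + Y)^-1) ^+ d * (4 ^+ d * ((1 + X)^-1) ^+ d)) _.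
    by apply: ler_wpM2l; [exact: p|apply: key => //; lra].
  by rewrite mulrC ler_wpM2l// lerDl p.
apply: le_trans (_ : _ <= (4 ^+ d * ((1 + X)^-1) ^+ d) * ((1 + Z)^-1) ^+ d) _.
  by apply: ler_wpM2r; [exact: p|apply: key => //; lra].
by rewrite ler_wpM2l// lerDr p.
Qed.

Lemma weight_quasi_sub a xi eta : 0 <= a ->
  weight a (vsub xi eta) * weight a eta <=
  4 ^+ d * weight a xi * (weight0 (vsub xi eta) + weight0 eta).
Proof.
move=> a0; rewrite /weight mulrACA -expRD -mulrDr.
set W := weight0 _ + _.
rewrite (_ : 4 ^+ d * _ * W = expR (- a * pnorm xi) * (4 ^+ d * weight0 xi * W)); last by ring.
apply: ler_pM; rewrite ?expR_ge0//.
- by rewrite mulr_ge0// ltW// weight0_gt0.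
- by rewrite ler_expR !mulNr lerN2 ler_wpM2l// pnorm_vsub.
- exact: weight0_quasi_sub.
Qed.

Lemma measurable_tnthR (i : 'I_d) : measurable_fun setT (fun xi : Rn d => tnth xi i : R).
Proof. exact: (@measurable_tnth _ (measurableTypeR R) d i). Qed.

Lemma measurable_sqnorm : measurable_fun setT (@sqnorm R d).
Proof.
by apply: measurable_sum => i; apply: measurable_funX; exact: measurable_tnthR.
Qed.

Lemma measurable_vnorm : measurable_fun setT (@vnorm R d).
Proof.
apply: (@measurableT_comp _ _ _ _ _ _ (@Num.sqrt R)); last exact: measurable_sqnorm.
by apply: continuous_measurable_fun; exact: sqrt_continuous.
Qed.

Lemma measurable_weight0 : measurable_fun setT weight0.
Proof.
apply: measurable_funX; apply: measurable_fun_inv_ge0.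
  by move=> x; rewrite addr_ge0// sqnorm_ge0.
by apply: measurable_funD => //; exact: measurable_sqnorm.
Qed.

(** Each of the d factors of [weight0] is compared with one coordinate. This is the origin of the
    exponent d: the product on the right is integrable. *)
Lemma weight0_le_prod xi :
  weight0 xi <= \prod_(i < d) (1 + tnth xi i ^+ 2)^-1.
Proof.
rewrite /weight0 -[X in _ ^+ X](card_ord d) -prodr_const.
apply: ler_prod => i _; rewrite invr_ge0 addr_ge0 ?sqnorm_ge0//=.
rewrite lef_pV2 ?posrE ?ltr_wpDr ?sqnorm_ge0 ?sqr_ge0//.
by rewrite lerD2l /sqnorm (bigD1 i)//= lerDl sumr_ge0// => j _; exact: sqr_ge0.
Qed.

Lemma integral_weight0_lty : (\int[leb]_xi (weight0 xi)%:E < +oo)%E.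
Proof.
have [c c0 hc] := @integral_inv_sqr1_lty R.
have mg : measurable_fun setT (fun x : R => (1 + x ^+ 2)^-1).
  apply: measurable_fun_inv_ge0; first by move=> x; rewrite addr_ge0 ?sqr_ge0.
  by apply: measurable_funD => //; exact: measurable_funX.
have g0 (x : R) : 0 <= (1 + x ^+ 2)^-1 by rewrite invr_ge0 addr_ge0 ?sqr_ge0.
have := @ge0_integral_Rn_prod R d (fun=> fun x => (1 + x ^+ 2)^-1) (fun=> c)
  (fun=> mg) (fun _ => g0) (fun=> hc).
move=> H; apply: (@le_lt_trans _ _ (\int[leb]_x (\prod_(i < d) (1 + tnth x i ^+ 2)^-1)%:E)%E).
  apply: ge0_le_integral => //.
  - by move=> x _; rewrite lee_fin ltW// weight0_gt0.
  - apply/measurable_EFinP; exact: measurable_weight0.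
  - apply/measurable_EFinP/measurable_prod => i _.
    exact: (measurableT_comp mg (@measurable_tnthR i)).
  - by move=> x _; rewrite lee_fin weight0_le_prod.
by rewrite H ltry.
Qed.

Lemma integrable_weight0 : leb.-integrable setT (EFin \o weight0).
Proof.
apply/integrableP; split; first by apply/measurable_EFinP; exact: measurable_weight0.
under eq_integral => x _ do rewrite /= gtr0_norm ?weight0_gt0//.
exact: integral_weight0_lty.
Qed.

Lemma integrable_vsub xi (f : @Rn R d -> R) :
  leb.-integrable setT (EFin \o f) -> (forall x, 0 <= f x) ->
  leb.-integrable setT (EFin \o (fun eta => f (vsub xi eta))).
Proof.
move=> /integrableP[mf fy] f0; apply/integrableP; split.
  exact: (measurableT_comp mf (measurable_vsubr xi)).
move: fy; under eq_integral do rewrite gee0_abs ?lee_fin//=.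
under [X in _ -> (X < _)%E]eq_integral do rewrite gee0_abs ?lee_fin//=.
by rewrite (ge0_integral_vsub xi mf)//.
Qed.

Lemma Rintegral_vsub xi (f : @Rn R d -> R) : measurable_fun setT f ->
  \int[leb]_eta f (vsub xi eta) = \int[leb]_eta f eta.
Proof.
move=> mf; have mfE : measurable_fun setT (EFin \o f) by exact/measurable_EFinP.
congr fine; rewrite integralE [RHS]integralE; congr (_ - _)%E.
  rewrite -[RHS](ge0_integral_vsub xi (measurable_funepos mfE))//.
  by apply: eq_integral => x _; rewrite !funeposE.
rewrite -[RHS](ge0_integral_vsub xi (measurable_funeneg mfE))//.
by apply: eq_integral => x _; rewrite !funenegE.
Qed.

Lemma Cintegral_vsub xi (F : @Rn R d -> R[i]) : cmeas F ->
  Cintegral leb setT (fun eta => F (vsub xi eta)) = Cintegral leb setT F.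
Proof. by move=> [FR FI]; congr Complex; exact: Rintegral_vsub. Qed.

Lemma ae_vsub xi (P : @Rn R d -> Prop) :
  {ae leb, forall eta, P eta} -> {ae leb, forall eta, P (vsub xi eta)}.
Proof.
move=> [A [mA A0 PA]]; exists (vsub xi @^-1` A); split.
- by rewrite -[X in measurable X]setTI; exact: measurable_vsubr.
- have mV : measurable (vsub xi @^-1` A).
    by rewrite -[X in measurable X]setTI; exact: measurable_vsubr.
  rewrite -A0 -(setIT (_ @^-1` _)) -integral_indic// -[in RHS](setIT A) -integral_indic//.
  rewrite -(ge0_integral_vsub xi (f := EFin \o \1_A))//.
    exact/measurable_EFinP.
  by move=> x; rewrite lee_fin.
- by move=> eta /= nP; exact: PA.
Qed.

End Weights.

(** * Convolution and frequency truncation in the weighted spaces *)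

Section Convolution.
Context {R : realType} {d : nat}.
Local Notation leb := (@lebesgue_Rn R d).
Local Notation cabs := (@ComplexField.Normc.normc R).
Implicit Types (xi eta : @Rn R d) (f g : @cfun R d) (a A B : R).

Definition wbounded a A f : Prop := forall xi, cabs (f xi) <= A * weight a xi.

(** Product of the normalization of the Fourier transform, the 2 of [cabs_Cintegral_le], the 4^d of
    [weight0_quasi_sub], and the integral of the two terms in the sum of weights there. *)
Definition conv_const : R :=
  (2 * pi) `^ (- (d%:R / 2)) * (2 * (4 ^+ d * (2 * \int[leb]_eta weight0 eta))).

Lemma conv_const_ge0 : 0 <= conv_const.
Proof.
rewrite !mulr_ge0 ?powR_ge0 ?exprn_ge0// Rintegral_ge0// => x _.
exact/ltW/weight0_gt0.
Qed.

Lemma wbounded_le a b A B f : a <= b -> 0 <= A <= B -> wbounded b A f -> wbounded a B f.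
Proof.
move=> ab /andP[A0 AB] fb xi; apply: (le_trans (fb xi)).
by rewrite ler_pM// ?(ltW (weight_gt0 _ _))// le_weight.
Qed.

(** From b p <= exp(b p): one power of [pnorm] costs an amount b of decay rate and a factor 1 /
    b. *)
Lemma pnorm_weight a (b : R) xi : 0 < b ->
  pnorm xi * weight (a + b) xi <= b^-1 * weight a xi.
Proof.
move=> b0; rewrite /weight !mulrA ler_wpM2r ?(ltW (weight0_gt0 _))//.
rewrite (_ : - (a + b) * pnorm xi = - a * pnorm xi + - (b * pnorm xi)); last by ring.
rewrite expRD mulrCA mulrC ler_wpM2r ?expR_ge0//.
rewrite -(ler_pM2l b0) mulrA divff ?gt_eqF// expRN.
rewrite ler_pdivrMr ?expR_gt0// mul1r.
by apply: le_trans (expR_ge1Dx _); rewrite lerDr.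
Qed.

(** Three uses of [pnorm_weight], each giving up 1/6 of decay rate and costing a factor 6, whence
    216 = 6^3. The cube is the growth allowed for the Lipschitz constant in time of an
    [evol_kernel]. *)
Lemma pnorm3_weight xi : pnorm xi ^+ 3 * weight 1 xi <= 216 * weight 2^-1 xi.
Proof.
have p0 := ltW (pnorm_gt0 xi).
have h a b : b = a + 6^-1 -> pnorm xi * weight b xi <= 6 * weight a xi.
  move=> ->; have := @pnorm_weight a 6^-1 xi; rewrite invrK; apply; lra.
rewrite exprS exprS expr1 -!mulrA.
apply: (@le_trans _ _ (pnorm xi * (pnorm xi * (6 * weight (5/6) xi)))).
  by do 2 apply: ler_wpM2l => //; apply: h; lra.
apply: (@le_trans _ _ (pnorm xi * (6 * (6 * weight (4/6) xi)))).
  apply: ler_wpM2l => //; rewrite mulrCA; apply: ler_wpM2l => //; apply: h; lra.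
rewrite mulrCA (mulrCA (pnorm xi)) (_ : 216 = 6 * (6 * 6)); last by ring.
rewrite -!mulrA; do 2 apply: ler_wpM2l => //.
by apply: h; lra.
Qed.

Lemma conv_integrand_bound a (K : R) xi (F : @Rn R d -> R[i]) : 0 <= a -> 0 <= K ->
  cmeas F ->
  (forall eta, cabs (F eta) <= K * (weight a (vsub xi eta) * weight a eta)) ->
  cintegrable leb setT F /\
  cabs (((2 * pi) `^ (- (d%:R / 2)))%:C%C * Cintegral leb setT F) <=
    conv_const * K * weight a xi.
Proof.
move=> a0 K0 mF FK.
pose G eta := K * (4 ^+ d * weight a xi) * (weight0 (vsub xi eta) + weight0 eta).
have FG eta : cabs (F eta) <= G eta.
  apply: (le_trans (FK eta)); rewrite /G -mulrA ler_wpM2l//.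
  exact: weight_quasi_sub.
have w0 (x : @Rn R d) : 0 <= weight0 x by exact/ltW/weight0_gt0.
have iw := @integrable_weight0 R d.
have iwx := integrable_vsub xi iw w0.
have iS : leb.-integrable setT (EFin \o (fun eta => weight0 (vsub xi eta) + weight0 eta)).
  exact: integrable_add.
have iG : leb.-integrable setT (EFin \o G) by exact: integrable_scale.
split; first exact: (cintegrable_le measurableT mF iG (fun x _ => FG x)).
rewrite ComplexField.Normc.normcM cabs_real ger0_norm ?powR_ge0//.
have := cabs_Cintegral_le measurableT mF iG (fun x _ => FG x).
rewrite RintegralZl// RintegralD// Rintegral_vsub; last exact: measurable_weight0.
move=> H; rewrite /conv_const -!mulrA ler_wpM2l ?powR_ge0//.
by apply: (le_trans H); rewrite le_eqVlt; apply/orP; left; apply/eqP; ring.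
Qed.

Lemma cmeas_conv_integrand f g xi : cmeas f -> cmeas g ->
  @cmeas R _ _ (fun eta => (f (vsub xi eta) * g eta)%R : R[i]).
Proof.
by move=> mf mg; apply: cmeasM => //; exact: (cmeas_comp mf (measurable_vsubr xi)).
Qed.

Lemma wbounded_mul a A B f g xi : 0 <= A -> 0 <= B ->
  wbounded a A f -> wbounded a B g -> forall eta,
  cabs (f (vsub xi eta) * g eta) <= A * B * (weight a (vsub xi eta) * weight a eta).
Proof.
move=> A0 B0 fA gB eta; rewrite ComplexField.Normc.normcM mulrACA.
by apply: ler_pM; rewrite ?cabs_ge0.
Qed.

Lemma wbounded_conv a A B f g : 0 <= a -> 0 <= A -> 0 <= B ->
  cmeas f -> cmeas g -> wbounded a A f -> wbounded a B g ->
  wbounded a (conv_const * (A * B)) (conv f g).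
Proof.
move=> a0 A0 B0 mf mg fA gB xi.
have [] := @conv_integrand_bound a (A * B) xi (fun eta => f (vsub xi eta) * g eta) a0.
- by rewrite mulr_ge0.
- exact: cmeas_conv_integrand.
- exact: wbounded_mul.
by [].
Qed.

Lemma wbounded_convB a A B (e1 e2 : R) f g f' g' :
  0 <= a -> 0 <= A -> 0 <= B -> 0 <= e1 -> 0 <= e2 ->
  cmeas f -> cmeas g -> cmeas f' -> cmeas g' ->
  wbounded a A f' -> wbounded a B g ->
  wbounded a e1 (f - f') -> wbounded a e2 (g - g') ->
  wbounded a A f -> wbounded a B g' ->
  wbounded a (conv_const * (e1 * B + A * e2)) (conv f g - conv f' g').
Proof.
move=> a0 A0 B0 e10 e20 mf mg mf' mg' fA gB fe ge fA' gB' xi.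
have i1 : cintegrable leb setT (fun eta => f (vsub xi eta) * g eta).
  have [] := @conv_integrand_bound a (A * B) xi (fun eta => f (vsub xi eta) * g eta) a0 => //.
  - by rewrite mulr_ge0.
  - exact: cmeas_conv_integrand.
  - exact: wbounded_mul.
have i2 : cintegrable leb setT (fun eta => f' (vsub xi eta) * g' eta).
  have [] := @conv_integrand_bound a (A * B) xi (fun eta => f' (vsub xi eta) * g' eta) a0 => //.
  - by rewrite mulr_ge0.
  - exact: cmeas_conv_integrand.
  - exact: wbounded_mul.
rewrite [X in cabs X](_ : _ = ((2 * pi) `^ (- (d%:R / 2)))%:C%C * Cintegral leb setT
   (fun eta => f (vsub xi eta) * g eta - f' (vsub xi eta) * g' eta)); last first.
  rewrite (CintegralB measurableT i1 i2) mulrBr.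
  by [].
have [] := @conv_integrand_bound a (e1 * B + A * e2) xi
   (fun eta => f (vsub xi eta) * g eta - f' (vsub xi eta) * g' eta) a0 => //.
- by rewrite addr_ge0// mulr_ge0.
- by apply: cmeasB; exact: cmeas_conv_integrand.
move=> eta; rewrite (_ : _ - _ = (f (vsub xi eta) - f' (vsub xi eta)) * g eta +
   f' (vsub xi eta) * (g eta - g' eta)); last by rewrite mulrBl mulrBr addrA subrK.
apply: (le_trans (cabsD _ _)); rewrite [leRHS]mulrDl; apply: lerD.
- exact: (@wbounded_mul a e1 B (f - f') g).
- exact: (@wbounded_mul a A e2 f' (g - g')).
Qed.

(** The parameter is the time: the Duhamel integral requires sources that are measurable jointly in
    time and frequency. *)
Lemma cmeas_conv dT (T : measurableType dT) (f g : T * @Rn R d -> R[i]) :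
  cmeas f -> cmeas g ->
  cmeas (fun z : T * @Rn R d =>
    conv (fun x => f (z.1, x)) (fun x => g (z.1, x)) z.2 : R[i]).
Proof.
move=> mf mg; apply: cmeasM; first exact: cmeas_cst.
pose H (p : (T * @Rn R d) * @Rn R d) : R[i] :=
  f (p.1.1, vsub p.1.2 p.2) * g (p.1.1, p.2).
apply: (@cmeas_Cintegral R _ _ _ _ leb H).
have m11 : measurable_fun setT (fun p : (T * @Rn R d) * @Rn R d => p.1.1).
  exact: measurableT_comp measurable_fst measurable_fst.
have m12 : measurable_fun setT (fun p : (T * @Rn R d) * @Rn R d => p.1.2).
  exact: measurableT_comp measurable_snd measurable_fst.
have m2 : measurable_fun setT (fun p : (T * @Rn R d) * @Rn R d => p.2).
  exact: measurable_snd.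
apply: cmeasM.
- apply: (cmeas_comp mf (g := fun p => (p.1.1, vsub p.1.2 p.2))).
  apply: measurable_fun_pair => //.
  exact: (measurableT_comp (@measurable_vsub R d) (measurable_fun_pair m12 m2)).
- apply: (cmeas_comp mg (g := fun p => (p.1.1, p.2))).
  exact: measurable_fun_pair.
Qed.

Lemma cmeas_hatconj f : cmeas f -> cmeas (hatconj f).
Proof.
by move=> mf; apply: cmeas_conj; exact: (cmeas_comp mf (@measurable_vopp R d)).
Qed.

Lemma wbounded_hatconj a A f : wbounded a A f -> wbounded a A (hatconj f).
Proof. by move=> fA xi; rewrite cabsJ -weight_vopp; exact: fA. Qed.

(** The Fourier form of the fact that |u|^2 is real. The substitution needed is the translation eta
    |-> eta - xi, obtained by composing eta |-> - xi - eta with eta |-> - eta. *)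
Lemma conv_hatconj_vopp f xi : cmeas f ->
  cintegrable leb setT (fun eta => f (vsub xi eta) * hatconj f eta) ->
  conv f (hatconj f) (vopp xi) = (conv f (hatconj f) xi)^*%C.
Proof.
move=> mf iF; rewrite /conv.
set c := (_ `^ _); transitivity ((c%:C)^*%C *
  (Cintegral leb setT (fun eta => f (vsub xi eta) * hatconj f eta))^*%C)%C; last first.
  exact/esym/(rmorphM (@conjc R)).
rewrite -Cintegral_conj//; congr (_ * _); first by rewrite /= oppr0.
have mG : cmeas (fun eta => f (vsub (vopp xi) eta) * hatconj f eta : R[i]).
  by apply: cmeas_conv_integrand => //; exact: cmeas_hatconj.
rewrite -[LHS](Cintegral_vsub (vopp xi) mG).
have mG2 : cmeas (fun eta => f (vsub (vopp xi) (vsub (vopp xi) eta)) *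
   hatconj f (vsub (vopp xi) eta) : R[i]).
  exact: (cmeas_comp mG (measurable_vsubr (vopp xi))).
pose z0 : @Rn R d := [tuple 0 | i < d].
rewrite -[LHS](Cintegral_vsub z0 mG2); apply: eq_Cintegral => eta _.
rewrite rmorphM /hatconj /= conjcK mulrC; congr (_^*%C * _); congr (f _);
  apply: eq_from_tnth => i; rewrite !tnth_mktuple; ring.
Qed.

(** The substitution eta |-> xi - eta preserves null sets, so the integrands agree almost everywhere
    for each xi. The conclusion is an equality at every point, which later frees the Duhamel
    integrals from the choice of representatives. *)
Lemma conv_ae f f' g g' : cmeas f -> cmeas f' -> cmeas g -> cmeas g' ->
  {ae leb, forall xi, f xi = f' xi} -> {ae leb, forall xi, g xi = g' xi} ->
  conv f g = conv f' g'.
Proof.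
move=> mf mf' mg mg' ff gg; apply/funext => xi; rewrite /conv; congr (_ * _).
have [m1R m1I] := cmeas_conv_integrand xi mf mg.
have [m2R m2I] := cmeas_conv_integrand xi mf' mg'.
have E : {ae leb, forall eta, f (vsub xi eta) * g eta = f' (vsub xi eta) * g' eta}.
  move: (ae_vsub xi ff) gg; apply: filterS2 => eta -> ->.
  by [].
congr Complex; congr fine; apply: ae_eq_integral => //; try exact/measurable_EFinP;
  by apply: filterS E => eta -> _.
Qed.

Lemma measurable_vnorm_le (N : nat) :
  measurable_fun setT (fun xi : @Rn R d => vnorm xi <= N%:R).
Proof.
by apply: measurable_fun_ler => //; exact: measurable_vnorm.
Qed.

Lemma cmeas_trunc N f : cmeas f -> cmeas (trunc N f).
Proof.
move=> mf; apply: cmeas_if => //; exact: measurable_vnorm_le.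
Qed.

Lemma wbounded_trunc a A N f : 0 <= A -> wbounded a A f -> wbounded a A (trunc N f).
Proof.
move=> A0 fA xi; rewrite /trunc; case: ifP => _; first exact: fA.
by rewrite ComplexField.Normc.normc0 mulr_ge0// ltW// weight_gt0.
Qed.

(** Where the truncation removes something, [pnorm xi] exceeds N and is at least 1, so 1 <= 2
    [pnorm xi] / (N + 1); the factor [pnorm] is absorbed by lowering the decay rate from 2 to 1.
    Writing N + 1 rather than N keeps the bound meaningful at N = 0. *)
Lemma wbounded_trunc_tail A N f : 0 <= A -> wbounded 2 A f ->
  wbounded 1 (4 * A / N.+1%:R) (trunc N f - f).
Proof.
move=> A0 fA xi; rewrite -[(_ - _) xi]/(trunc N f xi - f xi) /trunc.
case: ifPn => [_|]; rewrite ?subrr ?sub0r.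
  by rewrite ComplexField.Normc.normc0 mulr_ge0 ?(ltW (weight_gt0 _ _))// divr_ge0// mulr_ge0.
rewrite -ltNge => Nxi; rewrite cabsN.
apply: (le_trans (fA xi)).
have h : weight 2 xi <= 2 * pnorm xi / N.+1%:R * weight 2 xi.
  rewrite -[X in X <= _]mul1r ler_wpM2r ?(ltW (weight_gt0 _ _))//.
  rewrite ler_pdivlMr ?ltr0n// mul1r -natr1.
  have := pnorm_ge1 xi; have := vnorm_le_pnorm xi; lra.
apply: (@le_trans _ _ (A * (2 * pnorm xi / N.+1%:R * weight 2 xi))).
  by rewrite ler_wpM2l.
have H := @pnorm_weight 1 1 xi ltr01; rewrite invr1 mul1r in H.
rewrite (_ : A * _ = (2 * A / N.+1%:R) * (pnorm xi * weight 2 xi)); last by ring.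
have w1 := weight_gt0 1 xi.
apply: (@le_trans _ _ ((2 * A / N.+1%:R) * weight 1 xi)).
  by apply: ler_wpM2l => //; rewrite divr_ge0// mulr_ge0.
by rewrite ler_wpM2r ?(ltW w1)// ler_wpM2r ?invr_ge0// ler_wpM2r// ler_nat.
Qed.

Lemma wbounded_hatprod_sub A B N f g : 0 <= A -> 0 <= B ->
  cmeas f -> cmeas g -> wbounded 2 A f -> wbounded 2 B g ->
  wbounded 1 (conv_const * (8 * A * B) / N.+1%:R) (hatprod N f g - conv f g).
Proof.
move=> A0 B0 mf mg fA gB.
have half : 1 <= 2 :> R by lra.
have fA' : wbounded 1 A f by apply: wbounded_le fA; rewrite ?A0 /=.
have gB' : wbounded 1 B g by apply: wbounded_le gB; rewrite ?B0 /=.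
rewrite (_ : conv_const * _ / _ = conv_const *
  ((4 * A / N.+1%:R) * B + A * (4 * B / N.+1%:R))); last by ring.
apply: wbounded_convB => //.
- by rewrite divr_ge0// mulr_ge0.
- by rewrite divr_ge0// mulr_ge0.
- exact: cmeas_trunc.
- exact: cmeas_trunc.
- exact: wbounded_trunc.
- exact: wbounded_trunc_tail.
- exact: wbounded_trunc_tail.
- exact: wbounded_trunc.
Qed.
End Convolution.

(** * Integrals over the time interval *)

Section TimeIntegral.
Context {R : realType}.
Local Notation mu := (@lebesgue_measure R).
Local Notation cabs := (@ComplexField.Normc.normc R).

Lemma sinB_le (x y : R) : `|sin x - sin y| <= `|x - y|.
Proof.
wlog yx : x y / y <= x => [H|].
  by have [/H//|/ltW/H] := leP y x; rewrite distrC (distrC y).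
have [c _ ->] := @MVT_segment R sin cos y x yx (fun z _ => is_derive_sin z)
  (continuous_subspaceT (@continuous_sin R)).
by rewrite normrM ler_piMl// cos_max.
Qed.

Lemma cosB_le (x y : R) : `|cos x - cos y| <= `|x - y|.
Proof.
wlog yx : x y / y <= x => [H|].
  by have [/H//|/ltW/H] := leP y x; rewrite distrC (distrC y).
have [c _ ->] := @MVT_segment R cos (fun z => - sin z) y x yx (fun z _ => is_derive_cos z)
  (continuous_subspaceT (@continuous_cos R)).
by rewrite normrM normrN ler_piMl// sin_max.
Qed.

Lemma time_int_mkcond t (F : R -> R[i]) : time_int t F =
  Cintegral mu setT (fun s => if 0 <= s <= t then F s else 0).
Proof.
rewrite /time_int /Cintegral; congr Complex; rewrite Rintegral_mkcond;
  apply: eq_Rintegral => s _; rewrite /patch mem_setE in_itv/=; by case: ifP.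
Qed.

Lemma integrable_cst_itv (M t : R) : mu.-integrable `[0, t] (EFin \o cst M).
Proof.
apply/integrableP; split; first exact/measurable_EFinP.
rewrite (_ : (\int[mu]_(x in `[0%R, t]) _)%E = (`|M|%:E * mu `[0%R, t]%classic)%E); last first.
  transitivity (\int[mu]_(x in `[0%R, t]) (cst `|M|%:E) x)%E; first by [].
  by rewrite integral_cst.
rewrite lebesgue_measure_itv/=; case: ifP => _.
  by rewrite -EFinB -EFinM ltry.
by rewrite mule0.
Qed.

Lemma cabs_time_int_cst (t : R) (F : R -> R[i]) (M : R) : 0 <= t -> cmeas F ->
  (forall s : R, 0 <= s <= t -> cabs (F s) <= M) -> cabs (time_int t F) <= 2 * (M * t).
Proof.
move=> t0 mF FM.
apply: (le_trans (@cabs_Cintegral_le R _ (measurableTypeR R) mu `[0, t]%classic F (cst M)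
  (measurable_itv _) mF (integrable_cst_itv M t) _)).
  by move=> s /=; rewrite in_itv/=; exact: FM.
rewrite ler_wpM2l//.
rewrite (_ : Rintegral _ _ _ = M * fine (mu `[0, t]%classic)); last exact: Rintegral_cst.
rewrite lebesgue_measure_itv/= lte_fin.
move: t0; rewrite le_eqVlt => /predU1P[<-|->]; first by rewrite ltxx mulr0.
by rewrite -EFinB /= subr0.
Qed.

Lemma cintegrable_time_cst (t : R) (F : R -> R[i]) (M : R) : cmeas F ->
  (forall s : R, 0 <= s <= t -> cabs (F s) <= M) -> cintegrable mu `[0, t] F.
Proof.
move=> mF FM.
apply: (@cintegrable_le R _ (measurableTypeR R) mu `[0, t]%classic F (cst M)
  (measurable_itv _) mF (integrable_cst_itv M t)) => s /=.
by rewrite in_itv/=; exact: FM.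
Qed.

Lemma integral_pexp (t p : R) : 0 < p -> 0 < t ->
  (\int[mu]_(s in `[0%R, t]) (p * expR (s * p))%:E = (expR (t * p) - 1)%:E)%E.
Proof.
move=> p0 t0.
have dE (s : R) : is_derive s (1 : R) (fun s => expR (s * p)) (p * expR (s * p)).
  have h1 : is_derive s (1 : R) (fun u : R => u * p) p.
    rewrite (_ : (fun u : R => u * p) = p \*: (@id R)); last by apply/funext => u; rewrite /= mulrC.
    by apply: is_derive_eq; rewrite /GRing.scale/= mulr1.
  have := @is_derive1_comp R expR (fun u : R => u * p) s _ _ (is_derive_expR _) h1.
  by rewrite mulrC; exact.
have cE : continuous (fun s : R => expR (s * p)).
  move=> s; apply: continuous_comp; last exact: continuous_expR.
  by apply: cvgM; [exact: cvg_id|exact: cvg_cst].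
rewrite (@continuous_FTC2 R _ (fun s => expR (s * p)))//.
- by rewrite mul0r expR0 EFinB.
- by apply: continuous_subspaceT => s; apply: cvgM; [exact: cvg_cst|exact: cE].
- split.
  + by move=> s _; case: (dE s).
  + by apply: cvg_at_right_filter; exact: cE.
  + by apply: cvg_at_left_filter; exact: cE.
- by move=> s _; rewrite derive1E; case: (dE s).
Qed.

Lemma cabs_time_int_pexp (t p : R) (F : R -> R[i]) (M : R) : 0 <= t -> 0 < p -> 0 <= M -> cmeas F ->
  (forall s : R, 0 <= s <= t -> cabs (F s) <= M * (p * expR (s * p))) ->
  cabs (time_int t F) <= 2 * M * expR (t * p).
Proof.
move=> t0 p0 M0 mF FM.
have [->|tn0] := eqVneq t 0.
  rewrite /time_int /Cintegral set_itv1 !Rintegral_set1 ComplexField.Normc.normc0.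
  by rewrite !mulr_ge0// expR_ge0.
have tpos : 0 < t by rewrite lt_neqAle eq_sym tn0.
have mpe : measurable_fun setT (fun s : R => p * expR (s * p)).
  apply: measurable_funM => //; apply: measurableT_comp => //.
  exact: measurable_funM.
have ipe : mu.-integrable `[0, t] (EFin \o (fun s => p * expR (s * p))).
  apply/integrableP; split.
    by apply/measurable_EFinP; exact: measurable_funTS.
  under eq_integral do rewrite /= ger0_norm ?mulr_ge0 ?expR_ge0 ?(ltW p0)//.
  by rewrite integral_pexp// ltry.
have iG : mu.-integrable `[0, t] (EFin \o (fun s => M * (p * expR (s * p)))).
  exact: integrable_scale.
apply: (le_trans (@cabs_Cintegral_le R _ (measurableTypeR R) mu `[0, t]%classic F
  (fun s => M * (p * expR (s * p))) (measurable_itv _) mF iG _)).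
  by move=> s /=; rewrite in_itv/=; exact: FM.
rewrite RintegralZl// /Rintegral integral_pexp//= -mulrA ler_wpM2l// ler_wpM2l//.
by rewrite gerBl.
Qed.
End TimeIntegral.

(** * The propagators and their bounds *)

Section Kernels.
Context {R : realType} {d : nat}.
Local Notation mu := (@lebesgue_measure R).
Local Notation cabs := (@ComplexField.Normc.normc R).
Implicit Types (xi : @Rn R d) (K : R -> @Rn R d -> R[i]) (c : R -> @cfun R d) (T : R).

Definition jmeas K : Prop := cmeas (fun z : R * @Rn R d => K z.1 z.2).

(** The exponents are those of the worst symbol, cos(t |xi|) |xi|^2, of size |xi|^2 and with time
    derivative of size |xi|^3. The factor 1 + T covers [W1], which is bounded only by the time; the
    2 is that of [schrodB], where real and imaginary parts are added. *)
Definition evol_kernel T K : Prop := [/\ jmeas K,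
  forall (t : R) xi, 0 <= t <= T -> cabs (K t xi) <= (1 + T) * pnorm xi ^+ 2 &
  forall (t t' : R) xi, cabs (K t xi - K t' xi) <= 2 * pnorm xi ^+ 3 * `|t - t'| ].

Lemma measurable_tvnorm : measurable_fun setT (fun z : R * @Rn R d => z.1 * vnorm z.2).
Proof.
by apply: measurable_funM => //; exact: (measurableT_comp (@measurable_vnorm R d)).
Qed.

Lemma measurable_tsqnorm : measurable_fun setT (fun z : R * @Rn R d => z.1 * sqnorm z.2).
Proof.
by apply: measurable_funM => //; exact: (measurableT_comp (@measurable_sqnorm R d)).
Qed.

Lemma jmeas_schrod : jmeas schrod.
Proof.
split => /=.
  apply: (measurableT_comp (f := cos)); last exact: measurable_tsqnorm.
  by apply: continuous_measurable_fun; exact: continuous_cos.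
apply: measurable_funN.
apply: (measurableT_comp (f := sin)); last exact: measurable_tsqnorm.
by apply: continuous_measurable_fun; exact: continuous_sin.
Qed.

Lemma measurable_W0 : measurable_fun setT (fun z : R * @Rn R d => W0 z.1 z.2).
Proof.
apply: (measurableT_comp (f := cos)); last exact: measurable_tvnorm.
by apply: continuous_measurable_fun; exact: continuous_cos.
Qed.

Lemma measurable_W1 : measurable_fun setT (fun z : R * @Rn R d => W1 z.1 z.2).
Proof.
have mv := measurableT_comp (@measurable_vnorm R d) (@measurable_snd _ _ R (@Rn R d)).
apply: measurable_fun_ifT => //.
- by apply: measurable_fun_eqr => //.
- apply: measurable_funM.
    apply: (measurableT_comp (f := sin)); last exact: measurable_tvnorm.
    by apply: continuous_measurable_fun; exact: continuous_sin.
  by apply: (measurable_fun_inv_ge0 (f := fun z : R * @Rn R d => vnorm z.2)) => // z; exact: vnorm_ge0.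
Qed.

Lemma pnorm_exp_le xi (m n : nat) : (m <= n)%N -> pnorm xi ^+ m <= pnorm xi ^+ n.
Proof. by move=> mn; rewrite ler_weXn2l// pnorm_ge1. Qed.

Lemma cabs_schrod t xi : cabs (schrod t xi) = 1.
Proof. by rewrite /= sqrrN cos2Dsin2 sqrtr1. Qed.

Lemma schrodB t t' xi : cabs (schrod t xi - schrod t' xi) <= 2 * sqnorm xi * `|t - t'|.
Proof.
apply: (le_trans (cabs_le_add _)); rewrite cReB cImB /= -mulrA (_ : 2 = 1 + 1)// mulrDl !mul1r.
rewrite [sqnorm xi * _](_ : _ = `|t * sqnorm xi - t' * sqnorm xi|); last first.
  by rewrite -mulrBl normrM mulrC (ger0_norm (sqnorm_ge0 xi)).
by apply: lerD; [exact: cosB_le|rewrite opprK addrC distrC; exact: sinB_le].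
Qed.

Lemma W0_le t xi : `|W0 t xi| <= 1.
Proof. exact: cos_max. Qed.

Lemma W0B t t' xi : `|W0 t xi - W0 t' xi| <= vnorm xi * `|t - t'|.
Proof.
apply: (le_trans (cosB_le _ _)).
by rewrite -mulrBl normrM mulrC (ger0_norm (vnorm_ge0 _)).
Qed.

Lemma W1B t t' xi : `|W1 t xi - W1 t' xi| <= `|t - t'|.
Proof.
rewrite /W1; case: eqP => [//|/eqP v0].
have vp : 0 < vnorm xi by rewrite lt_neqAle eq_sym v0 vnorm_ge0.
rewrite -mulrBl normrM normfV (gtr0_norm vp) ler_pdivrMr//.
by apply: (le_trans (sinB_le _ _)); rewrite -mulrBl normrM (gtr0_norm vp).
Qed.

Lemma W1_le t xi : `|W1 t xi| <= `|t|.
Proof.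
have := W1B t 0 xi; rewrite {2}/W1 mul0r sin0 mul0r !subr0.
by case: ifP; rewrite subr0.
Qed.

(** The division by |xi| in [W1] cancels one of the two powers of the Laplacian. Growth of order one
    is left, which is exactly what the shrinking weight can pay for. *)
Lemma W1_sqnorm t xi : W1 t xi * - sqnorm xi = - (sin (t * vnorm xi) * vnorm xi).
Proof.
rewrite /W1 -sqr_vnorm; case: eqP => [->|/eqP v0]; first by rewrite expr0n/= oppr0 !mulr0 oppr0.
by rewrite mulrN expr2 mulrA divfK.
Qed.

Lemma W1_sqnorm_le t xi : `|W1 t xi * - sqnorm xi| <= pnorm xi.
Proof.
rewrite W1_sqnorm normrN normrM (ger0_norm (vnorm_ge0 _)).
by apply: le_trans (vnorm_le_pnorm xi); rewrite ler_piMl ?vnorm_ge0 ?sin_max.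
Qed.

Lemma kernel_schrod T : 0 <= T -> evol_kernel T schrod.
Proof.
move=> T0; split; first exact: jmeas_schrod.
- move=> t xi _; rewrite cabs_schrod; have := exprn_ege1 2 (pnorm_ge1 xi); nra.
- move=> t t' xi; apply: (le_trans (schrodB _ _ _)); rewrite ler_wpM2r// ler_wpM2l//.
  exact: le_trans (sqnorm_le_pnorm _) (@pnorm_exp_le xi 2 3 isT).
Qed.

Lemma kernel_real T (k : R -> @Rn R d -> R) :
  measurable_fun setT (fun z : R * @Rn R d => k z.1 z.2) ->
  (forall (t : R) xi, 0 <= t <= T -> `|k t xi| <= (1 + T) * pnorm xi ^+ 2) ->
  (forall (t t' : R) xi, `|k t xi - k t' xi| <= pnorm xi ^+ 3 * `|t - t'|) ->
  evol_kernel T (fun t xi => (k t xi)%:C%C).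
Proof.
move=> mk k1 k2; split; first exact: cmeas_real.
- by move=> t xi tT; rewrite cabs_real k1.
- move=> t t' xi; rewrite -rmorphB cabs_real; apply: (le_trans (k2 _ _ _)).
  by rewrite ler_wpM2r// ler_peMl ?exprn_ge0 ?ler1n// ltW ?pnorm_gt0.
Qed.

Lemma kernel_W0 T : 0 <= T -> evol_kernel T (fun t xi => (W0 t xi)%:C%C).
Proof.
move=> T0; apply: kernel_real; first exact: measurable_W0.
- by move=> t xi _; apply: (le_trans (W0_le _ _)); have := exprn_ege1 2 (pnorm_ge1 xi); nra.
- move=> t t' xi; apply: (le_trans (W0B _ _ _)); rewrite ler_wpM2r//.
  by apply: (le_trans (vnorm_le_pnorm xi)); exact: (@pnorm_exp_le xi 1 3).
Qed.

Lemma kernel_W1 T : 0 <= T -> evol_kernel T (fun t xi => (W1 t xi)%:C%C).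
Proof.
move=> T0; apply: kernel_real; first exact: measurable_W1.
- move=> t xi /andP[t0 tT]; apply: (le_trans (W1_le _ _)).
  by rewrite ger0_norm//; have := exprn_ege1 2 (pnorm_ge1 xi); nra.
- move=> t t' xi; apply: (le_trans (W1B _ _ _)); rewrite ler_peMl//.
  exact: exprn_ege1 (pnorm_ge1 xi).
Qed.

Lemma kernel_W1_sqnorm T : 0 <= T -> evol_kernel T (fun t xi => (W1 t xi * - sqnorm xi)%:C%C).
Proof.
move=> T0; apply: kernel_real.
- apply: measurable_funM; first exact: measurable_W1.
  by apply: measurable_funN; exact: (measurableT_comp (@measurable_sqnorm R d)).
- move=> t xi _; apply: (le_trans (W1_sqnorm_le _ _)).
  by have := pnorm_ge1 xi; nra.
- move=> t t' xi; rewrite !W1_sqnorm -opprD normrN -mulrBl normrM (ger0_norm (vnorm_ge0 _)).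
  apply: (@le_trans _ _ (`|t - t'| * vnorm xi * vnorm xi)).
    apply: ler_wpM2r; first exact: vnorm_ge0.
    by apply: (le_trans (sinB_le _ _)); rewrite -mulrBl normrM (ger0_norm (vnorm_ge0 _)).
  rewrite -mulrA -expr2 sqr_vnorm mulrC ler_wpM2r//.
  exact: le_trans (sqnorm_le_pnorm _) (@pnorm_exp_le xi 2 3 isT).
Qed.

Lemma kernel_W0_sqnorm T : 0 <= T -> evol_kernel T (fun t xi => (W0 t xi * - sqnorm xi)%:C%C).
Proof.
move=> T0; apply: kernel_real.
- apply: measurable_funM; first exact: measurable_W0.
  by apply: measurable_funN; exact: (measurableT_comp (@measurable_sqnorm R d)).
- move=> t xi _; rewrite normrM normrN (ger0_norm (sqnorm_ge0 _)).
  have := W0_le t xi; have := sqnorm_le_pnorm xi; have := sqnorm_ge0 xi.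
  have := normr_ge0 (W0 t xi); move: `|_| (sqnorm _) (_ ^+ 2) => a b c a0 b0 bc a1; nra.
- move=> t t' xi; rewrite -mulrBl normrM normrN (ger0_norm (sqnorm_ge0 _)).
  apply: (@le_trans _ _ (vnorm xi * `|t - t'| * sqnorm xi)).
    by apply: ler_wpM2r; [exact: sqnorm_ge0|exact: W0B].
  rewrite mulrAC ler_wpM2r// exprS; apply: ler_pM; rewrite ?vnorm_ge0 ?sqnorm_ge0//.
    exact: vnorm_le_pnorm.
  exact: sqnorm_le_pnorm.
Qed.

Definition duh K c t : cfun d := fun xi => time_int t (fun s => K (t - s) xi * c s xi).

(** The condition 0 <= s <= t is moved into the integrand, so that the domain of integration no
    longer depends on t and the result on integrals with a parameter applies. *)
Lemma jmeas_duh K c : jmeas K -> jmeas c -> jmeas (duh K c).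
Proof.
move=> mK mc; rewrite /jmeas /duh.
under eq_fun do rewrite time_int_mkcond.
pose H (p : (R * @Rn R d) * R) : R[i] :=
  if 0 <= p.2 <= p.1.1 then K (p.1.1 - p.2) p.1.2 * c p.2 p.1.2 else 0.
apply: (@cmeas_Cintegral R _ _ _ _ mu H).
have m11 : measurable_fun setT (fun p : (R * @Rn R d) * R => p.1.1).
  exact: measurableT_comp measurable_fst measurable_fst.
have m12 : measurable_fun setT (fun p : (R * @Rn R d) * R => p.1.2).
  exact: measurableT_comp measurable_snd measurable_fst.
have m2 : measurable_fun setT (fun p : (R * @Rn R d) * R => p.2).
  exact: measurable_snd.
have m1m2 : measurable_fun setT (fun p : (R * @Rn R d) * R => p.1.1 - p.2).
  exact: measurable_funB.
have hK := cmeas_comp mK (measurable_fun_pair m1m2 m12).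
have hc := cmeas_comp mc (measurable_fun_pair m2 m12).
have hb : measurable_fun setT (fun p : (R * @Rn R d) * R => 0 <= p.2 <= p.1.1).
  by apply: measurable_and; apply: measurable_fun_ler.
exact: (cmeas_if hb (cmeasM hK hc) (cmeas_cst _ 0)).
Qed.

Lemma jmeas_slice c t : jmeas c -> cmeas (c t).
Proof. by move=> mc; exact: (cmeas_comp mc (measurable_pair1 t)). Qed.

Lemma jmeas_slicer c xi : jmeas c -> @cmeas R _ R (fun t => c t xi).
Proof. by move=> mc; exact: (cmeas_comp mc (measurable_pair2 xi)). Qed.

Lemma cmeas_duh_integrand K c t xi : jmeas K -> jmeas c ->
  @cmeas R _ R (fun s => K (t - s) xi * c s xi).
Proof.
move=> mK mc; apply: cmeasM; last exact: jmeas_slicer.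
have mt : measurable_fun setT (fun s : R => t - s) by exact: measurable_funB.
exact: (cmeas_comp (jmeas_slicer xi mK) mt).
Qed.

End Kernels.

Ltac ge0 := repeat lazymatch goal with
  | |- is_true (0 <= _ * _) => apply: mulr_ge0
  | |- is_true (0 <= _ - _) => assumption
  | |- is_true (0 <= _ + _) => apply: addr_ge0
  | |- is_true (0 <= _ ^+ _) => apply: exprn_ge0
  | |- is_true (0 <= _^-1) => rewrite invr_ge0
  | |- is_true (0 <= `|_|) => exact: normr_ge0
  | |- is_true (0 <= 1) => exact: ler01
  | |- is_true (0 <= _%:R) => exact: ler0n
  | |- is_true (0 <= pnorm _) => exact: ltW (pnorm_gt0 _)
  | |- is_true (0 <= weight _ _) => exact: ltW (weight_gt0 _ _)
  | |- is_true (0 <= conv_const) => exact: conv_const_ge0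
  | |- is_true (0 <= _) => assumption
  end.

(** * Weighted estimates for Duhamel integrals *)

Section Duhamel.
Context {R : realType} {d : nat}.
Local Notation mu := (@lebesgue_measure R).
Local Notation cabs := (@ComplexField.Normc.normc R).
Implicit Types (xi : @Rn R d) (K : R -> @Rn R d -> R[i]) (c : R -> @cfun R d) (T : R).

Lemma weight_shift (a s : R) xi : weight (a - s) xi = weight a xi * expR (s * pnorm xi).
Proof.
rewrite /weight mulrAC -expRD; congr (expR _ * _); ring.
Qed.

#[local] Opaque weight.

(* The exponential weight narrows at unit speed in time, which pays for the
   factor pnorm xi: the integral of pnorm xi * exp(- (t - s) * pnorm xi) over
   s <= t is at most 1. *)
Lemma wbounded_duh T K (B M t : R) c : 0 <= t <= T -> 0 <= B -> 0 <= M ->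
  jmeas K -> jmeas c ->
  (forall (s : R) xi, 0 <= s <= T -> cabs (K s xi) <= B * pnorm xi) ->
  (forall s : R, 0 <= s <= T -> wbounded (T + 2 - s) M (c s)) ->
  wbounded (T + 2 - t) (2 * (B * M)) (duh K c t).
Proof.
move=> /andP[t0 tT] B0 M0 mK mc KB cM xi.
have := @cabs_time_int_pexp R t (pnorm xi) (fun s => K (t - s) xi * c s xi)
  (B * M * weight (T + 2) xi) t0 (pnorm_gt0 xi).
rewrite weight_shift => H; apply: (le_trans (H _ _ _)).
- by apply: mulr_ge0; [exact: mulr_ge0|exact/ltW/weight_gt0].
- exact: cmeas_duh_integrand.
- move=> s /andP[s0 st]; rewrite ComplexField.Normc.normcM.
  have hs : 0 <= s <= T by rewrite s0 (le_trans st).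
  have hts : 0 <= t - s <= T by apply/andP; split; lra.
  apply: (@le_trans _ _ ((B * pnorm xi) * (M * weight (T + 2 - s) xi))).
    by apply: ler_pM; rewrite ?cabs_ge0//; [exact: KB|exact: cM].
  by rewrite weight_shift le_eqVlt; apply/orP; left; apply/eqP; ring.
- by rewrite le_eqVlt; apply/orP; left; apply/eqP; ring.
Qed.

Lemma duhB T K c c' (B M t : R) xi : 0 <= t <= T ->
  jmeas K -> jmeas c -> jmeas c' ->
  (forall s : R, 0 <= s <= T -> cabs (K s xi) <= B) ->
  (forall s : R, 0 <= s <= T -> cabs (c s xi) <= M) ->
  (forall s : R, 0 <= s <= T -> cabs (c' s xi) <= M) ->
  duh K c t xi - duh K c' t xi = duh K (fun s => c s - c' s) t xi.
Proof.
move=> /andP[t0 tT] mK mc mc' KB cM cM'.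
have i1 (e : R -> cfun d) : jmeas e ->
    (forall s : R, 0 <= s <= T -> cabs (e s xi) <= M) ->
    cintegrable mu `[0, t] (fun s => K (t - s) xi * e s xi).
  move=> me eM; apply: (@cintegrable_time_cst R t _ (B * M)).
    exact: cmeas_duh_integrand.
  move=> s /andP[s0 st]; rewrite ComplexField.Normc.normcM.
  by apply: ler_pM; rewrite ?cabs_ge0//; [apply: KB|apply: eM];
    apply/andP; split; lra.
rewrite /duh /time_int -(@CintegralB R _ (measurableTypeR R) mu `[0, t]%classic _ _ (measurable_itv _)
  (i1 _ mc cM) (i1 _ mc' cM')).
by apply: eq_Cintegral => s _; rewrite -mulrBr.
Qed.

(** For kernels of quadratic growth, out of reach of the shrinking weight. The decay rate drops from
    1 to 1/2, which is harmless because this bound is never iterated: it serves for the time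
    derivative of n, for the truncation errors and for membership in Sobolev spaces. *)
Lemma wbounded_duh_kernel T K c (M t : R) : 0 <= t <= T -> 0 <= M ->
  evol_kernel T K -> jmeas c ->
  (forall s : R, 0 <= s <= T -> wbounded 1 M (c s)) ->
  wbounded 2^-1 (2 * (T * (1 + T) * M * 216)) (duh K c t).
Proof.
move=> /andP[t0 tT] M0 [mK Kb _] mc cM xi.
have T0 := le_trans t0 tT; have p1 := pnorm_ge1 xi.
have w1 := weight_gt0 1 xi.
have := @cabs_time_int_cst R t (fun s => K (t - s) xi * c s xi)
  ((1 + T) * pnorm xi ^+ 2 * (M * weight 1 xi)) t0.
move=> H; apply: (le_trans (H _ _)).
- exact: cmeas_duh_integrand.
- move=> s /andP[s0 st]; rewrite ComplexField.Normc.normcM.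
  by apply: ler_pM; rewrite ?cabs_ge0//; [apply: Kb|apply: cM];
    apply/andP; split; lra.
rewrite -[leRHS]mulrA ler_wpM2l//.
apply: (@le_trans _ _ ((1 + T) * M * (pnorm xi ^+ 3 * weight 1 xi) * T)).
  rewrite (_ : _ * t = (1 + T) * M * (pnorm xi ^+ 2 * weight 1 xi) * t); last by ring.
  apply: ler_pM => //; try ge0.
  apply: ler_wpM2l; first ge0.
  apply: ler_wpM2r; first ge0.
  exact: pnorm_exp_le.
rewrite (_ : _ * 216 * _ = (1 + T) * M * (216 * weight 2^-1 xi) * T); last by ring.
apply: ler_wpM2r => //; apply: ler_wpM2l; [ge0|exact: pnorm3_weight].
Qed.

(** On [0, t'] the two kernels differ by O(t - t'); on [t', t] a single kernel remains, over an
    interval of length t - t'. [G1] and [G2] majorize the two pieces, after both integrands have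
    been extended by zero to the whole line. *)
Lemma wbounded_duh_lip T K c (M t t' : R) : 0 <= t' <= t -> t <= T -> 0 <= M ->
  evol_kernel T K -> jmeas c ->
  (forall s : R, 0 <= s <= T -> wbounded 1 M (c s)) ->
  wbounded 2^-1 (2 * (216 * M * (2 * T + 1 + T)) * (t - t')) (duh K c t - duh K c t').
Proof.
move=> /andP[t'0 t't] tT M0 kK mc cM xi; have [mK Kb Kl] := kK.
have t0 := le_trans t'0 t't.
have T0 := le_trans t0 tT; have p1 := pnorm_ge1 xi.
have w1 := weight_gt0 1 xi.
pose F s := if 0 <= s <= t then K (t - s) xi * c s xi else 0.
pose F' s := if 0 <= s <= t' then K (t' - s) xi * c s xi else 0.
have mF u : @cmeas R _ R (fun s => if 0 <= s <= u then K (u - s) xi * c s xi else 0).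
  apply: cmeas_if; [|exact: cmeas_duh_integrand|exact: cmeas_cst].
  by apply: measurable_and; apply: measurable_fun_ler.
pose G1 := 2 * pnorm xi ^+ 3 * (t - t') * (M * weight 1 xi).
pose G2 := (1 + T) * pnorm xi ^+ 2 * (M * weight 1 xi).
have tt0 : 0 <= t - t' by rewrite subr_ge0.
have G10 : 0 <= G1 by rewrite /G1; ge0.
have G20 : 0 <= G2 by rewrite /G2; ge0.
pose G s := G1 * \1_(`[0, T]%classic : set R) s + G2 * \1_(`[t', t]%classic : set R) s.
have iI (a b : R) : mu.-integrable setT (EFin \o (\1_(`[a, b]%classic : set R))).
  by apply: integrable_indic_itv.
have iG : mu.-integrable setT (EFin \o G).
  by apply: integrable_add => //; apply: integrable_scale => //; exact: iI.
have FG s : cabs (F s - F' s) <= G s.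
  rewrite /F /F' /G !indicE !mem_setE !in_itv/=.
  have [/andP[s0 st]|sn] := boolP (0 <= s <= t); last first.
    rewrite ifF; last by apply/negP => /andP[a b]; move/negP: sn; apply; apply/andP; split; lra.
    by rewrite subrr ComplexField.Normc.normc0 addr_ge0// mulr_ge0.
  have hs : 0 <= s <= T by rewrite s0 (le_trans st tT).
  rewrite s0 (le_trans st tT) st/= andbT; have [st'|st'] := leP s t'.
    rewrite mulr1 -mulrBl ComplexField.Normc.normcM.
    apply: (@le_trans _ _ G1); last by rewrite lerDl mulr_ge0.
    apply: ler_pM; rewrite ?cabs_ge0//; last exact: cM.
    by apply: (le_trans (Kl _ _ _)); rewrite (_ : t - s - _ = t - t') ?ger0_norm ?subr_ge0//; ring.
  rewrite subr0 (ltW st') !mulr1 ComplexField.Normc.normcM.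
  apply: (@le_trans _ _ G2); last by rewrite lerDr.
  apply: ler_pM; rewrite ?cabs_ge0//; last exact: cM.
  by apply: Kb; apply/andP; split; lra.
have Iitv (a b : R) : a <= b -> \int[mu]_s \1_(`[a, b]%classic : set R) s = b - a.
  move=> ab; rewrite /Rintegral integral_indic ?setIT//= lebesgue_measure_itv/= lte_fin.
  by case: ltgtP ab => // -> _; rewrite subrr.
have iF (u : R) : 0 <= u <= T ->
    cintegrable mu setT (fun s => if 0 <= s <= u then K (u - s) xi * c s xi else 0).
  move=> /andP[u0 uT].
  apply: (@cintegrable_le R _ (measurableTypeR R) mu setT _
    (fun s => G2 * \1_(`[0, T]%classic : set R) s) measurableT (mF u)).
    by apply: integrable_scale => //; exact: iI.
  move=> s _; rewrite indicE mem_setE in_itv/=.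
  case: ifPn => [/andP[s0 su]|_]; last by rewrite ComplexField.Normc.normc0 mulr_ge0.
  rewrite s0 (le_trans su uT) mulr1 ComplexField.Normc.normcM.
  by apply: ler_pM; rewrite ?cabs_ge0//; [apply: Kb|apply: cM]; apply/andP; split; lra.
rewrite [X in cabs X](_ : _ = Cintegral mu setT (fun s => F s - F' s)); last first.
  have it : 0 <= t <= T by rewrite t0.
  have it' : 0 <= t' <= T by rewrite t'0 (le_trans t't).
  by rewrite (@CintegralB R _ (measurableTypeR R) mu setT _ _ measurableT (iF t it) (iF t' it')) -!time_int_mkcond.
apply: (le_trans (@cabs_Cintegral_le R _ (measurableTypeR R) mu setT _ _ measurableT
  (cmeasB (mF t) (mF t')) iG (fun s _ => FG s))).
rewrite -!mulrA ler_wpM2l//.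
rewrite (_ : Rintegral _ _ _ = G1 * T + G2 * (t - t')); last first.
  rewrite /G RintegralD//; try (by apply: integrable_scale => //; exact: iI).
  by rewrite !RintegralZl//; try exact: iI; rewrite !Iitv// subr0.
have P3 := pnorm3_weight xi.
have P2 : pnorm xi ^+ 2 * weight 1 xi <= 216 * weight 2^-1 xi.
  by apply: le_trans P3; rewrite ler_wpM2r ?(ltW w1)//; exact: pnorm_exp_le.
rewrite (_ : G1 * T + _ = (M * (t - t')) * (2 * T * (pnorm xi ^+ 3 * weight 1 xi) +
    (1 + T) * (pnorm xi ^+ 2 * weight 1 xi))); last by rewrite /G1 /G2; ring.
rewrite (_ : 216 * _ = (M * (t - t')) * (2 * T * (216 * weight 2^-1 xi) +
    (1 + T) * (216 * weight 2^-1 xi))); last by ring.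
apply: ler_wpM2l; first ge0.
by apply: lerD; apply: ler_wpM2l => //; ge0.
Qed.

End Duhamel.

(** * Limits of sequences with geometrically decreasing steps *)

Section GeometricLimit.
Context {R : realType}.
Local Notation cabs := (@ComplexField.Normc.normc R).

(* x + 2 C / 2^m decreases and x - 2 C / 2^m increases. *)
Lemma geometric_cauchy_lim (x : nat -> R) (C : R) :
  (forall m, `|x m.+1 - x m| <= C / 2 ^+ m) ->
  (x m @[m --> \oo] --> limn x) /\ forall m, `|x m - limn x| <= 2 * C / 2 ^+ m.
Proof.
move=> xC.
have C0 : 0 <= C by have := xC 0%N; rewrite expr0 divr1; exact: le_trans.
pose e (m : nat) : R := 2 * C / 2 ^+ m.
have eS m : e m.+1 = e m - C / 2 ^+ m.
  by rewrite /e exprS invfM; field; rewrite expf_neq0.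
have e0 m : 0 <= e m by rewrite /e divr_ge0 ?mulr_ge0 ?exprn_ge0.
have ecv : e @ \oo --> (0 : R).
  have h : `|2^-1| < 1 :> R by rewrite ger0_norm ?invr_ge0// invf_lt1// ltr1n.
  have := cvg_geometric (2 * C) h.
  by apply: cvg_trans; apply: near_eq_cvg; apply: nearW => m; rewrite /geometric/= exprVn.
have dy : nonincreasing_seq (fun m => x m + e m).
  apply/nonincreasing_seqP => m; have := xC m; rewrite ler_norml eS => /andP[_]; lra.
have iz : nondecreasing_seq (fun m => x m - e m).
  apply/nondecreasing_seqP => m; have := xC m; rewrite ler_norml eS => /andP[]; lra.
have cy : cvgn (fun m => x m + e m).
  apply: nonincreasing_is_cvgn => //; exists (x 0%N - e 0%N) => _ [m _ <-].
  have := iz 0%N m (leq0n _); rewrite /=; have := e0 m; lra.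
have cx : x m @[m --> \oo] --> limn (fun m => x m + e m).
  rewrite -[X in _ --> X]subr0.
  apply: (cvg_trans _ (cvgB cy ecv)); apply: near_eq_cvg; apply: nearW => m /=.
  by rewrite -[LHS]/((x m + e m) - e m) addrK.
have cz : x m - e m @[m --> \oo] --> limn (fun m => x m + e m).
  by rewrite -[X in _ --> X]subr0; exact: cvgB.
have lE : limn x = limn (fun m => x m + e m) by exact: cvg_lim cx.
rewrite lE; split => // m; rewrite -/(e m).
have h1 := nonincreasing_cvgn_ge dy cy m.
have h2 : x m - e m <= limn (fun m => x m + e m).
  rewrite -(cvg_lim (@Rhausdorff R) cz).
  by apply: nondecreasing_cvgn_le => //; apply/cvg_ex; eexists; exact: cz.
by rewrite ler_norml; apply/andP; split; lra.
Qed.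

Definition clim (z : nat -> R[i]) : R[i] :=
  (limn (fun m => complex.Re (z m)) +i* limn (fun m => complex.Im (z m)))%C.

Lemma cabs_clim_le (z : nat -> R[i]) (C : R) :
  (forall m, cabs (z m.+1 - z m) <= C / 2 ^+ m) ->
  forall m, cabs (clim z - z m) <= 4 * C / 2 ^+ m.
Proof.
move=> zC m.
have [_ hR] := @geometric_cauchy_lim (fun m => complex.Re (z m)) C
  (fun m => le_trans (le_trans (eq_ind_r (fun u => `|u| <= _) (Re_le_cabs _) (esym (cReB _ _))) (zC m)) (lexx _)).
have [_ hI] := @geometric_cauchy_lim (fun m => complex.Im (z m)) C
  (fun m => le_trans (le_trans (eq_ind_r (fun u => `|u| <= _) (Im_le_cabs _) (esym (cImB _ _))) (zC m)) (lexx _)).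
apply: (le_trans (cabs_le_add _)); rewrite cReB cImB /= distrC (distrC (limn _)).
apply: (le_trans (lerD (hR m) (hI m))).
by rewrite le_eqVlt; apply/orP; left; apply/eqP; ring.
Qed.

Lemma cmeas_clim dT (T : measurableType dT) (F : nat -> T -> R[i]) (C : T -> R) :
  (forall m, cmeas (F m)) ->
  (forall x m, cabs (F m.+1 x - F m x) <= C x / 2 ^+ m) ->
  cmeas (fun x => clim (fun m => F m x)).
Proof.
move=> mF FC; split.
  apply: (@measurable_fun_cvg _ _ _ _ (fun m x => complex.Re (F m x))).
    by move=> m; have [] := mF m.
  move=> x _; have [] // := @geometric_cauchy_lim (fun m => complex.Re (F m x)) (C x).
  by move=> m; rewrite -cReB; exact: le_trans (Re_le_cabs _) (FC x m).
apply: (@measurable_fun_cvg _ _ _ _ (fun m x => complex.Im (F m x))).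
  by move=> m; have [] := mF m.
move=> x _; have [] // := @geometric_cauchy_lim (fun m => complex.Im (F m x)) (C x).
by move=> m; rewrite -cImB; exact: le_trans (Im_le_cabs _) (FC x m).
Qed.

Lemma le_geometric_eq0 (x C : R) : (forall m : nat, x <= C / 2 ^+ m) -> x <= 0.
Proof.
move=> xC; have h : `|2^-1| < 1 :> R by rewrite ger0_norm ?invr_ge0// invf_lt1// ltr1n.
have hc := cvg_geometric C h.
have -> : 0 = limn (geometric C (2^-1 : R)) :> R by apply/esym; exact: cvg_lim hc.
apply: limr_ge; first by apply/cvg_ex; eexists; exact: hc.
by apply: nearW => m; rewrite /geometric/= exprVn.
Qed.
End GeometricLimit.

(** * Picard iteration for u and n, and its expansion *)

Section Picard.
Context {R : realType} {d : nat}.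
Variable T : R.
Hypothesis T0 : 0 <= T.
Local Notation cabs := (@ComplexField.Normc.normc R).
Implicit Types (xi : @Rn R d) (Z L : bool -> R -> @cfun R d) (b : bool) (t s : R).

(* The state is u for [true] and n for [false]. *)
Definition zkernel b : R -> @Rn R d -> R[i] :=
  if b then schrod else fun t xi => (W1 t xi * - sqnorm xi)%:C%C.
Definition zcoef b : R[i] := if b then - 'i%C else 1.
Definition zsource b Z s : @cfun R d :=
  conv (Z true s) (if b then Z false s else hatconj (Z true s)).

(** The time derivative of n is not part of the state: the equations for u and n are closed, and it
    is recovered from u afterwards. *)
Definition state (A : R) Z : Prop := (forall b, jmeas (Z b)) /\
  forall b s, 0 <= s <= T -> wbounded (T + 2 - s) A (Z b s).

Lemma evol_kernel_zkernel b : evol_kernel T (zkernel b).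
Proof. by case: b; [exact: kernel_schrod|exact: kernel_W1_sqnorm]. Qed.

Lemma zkernel_le b (s : R) xi : cabs (zkernel b s xi) <= 1 * pnorm xi.
Proof.
rewrite mul1r; case: b; rewrite /zkernel; first by rewrite cabs_schrod pnorm_ge1.
by rewrite cabs_real W1_sqnorm_le.
Qed.

Lemma cabs_zcoef b : cabs (zcoef b) = 1.
Proof. by case: b; rewrite /zcoef ?cabsN ?cabs_i// ComplexField.Normc.normc1. Qed.

Lemma jmeas_zsource b Z : (forall b, jmeas (Z b)) -> jmeas (zsource b Z).
Proof.
move=> mZ; case: b; rewrite /zsource.
  exact: (cmeas_conv (mZ true) (mZ false)).
have mh : @cmeas R _ _ (fun z : R * @Rn R d => hatconj (Z true z.1) z.2).
  apply: cmeas_conj.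
  have mp : measurable_fun setT (fun z : R * @Rn R d => (z.1, vopp z.2)).
    by apply: measurable_fun_pair => //; exact: (measurableT_comp (@measurable_vopp R d)).
  exact: (cmeas_comp (mZ true) mp).
exact: (cmeas_conv (mZ true) mh).
Qed.

Lemma jmeas_ifT t0 t1 (c : R -> @Rn R d -> R[i]) : jmeas c ->
  jmeas (fun t xi => if t0 <= t <= t1 then c t xi else 0).
Proof.
move=> mc; have hb : measurable_fun setT (fun z : R * @Rn R d => t0 <= z.1 <= t1).
  by apply: measurable_and; apply: measurable_fun_ler.
exact: (cmeas_if hb mc (cmeas_cst _ 0)).
Qed.

Lemma wbounded_zsource (A : R) b Z s : 0 <= A -> 0 <= s <= T -> state A Z ->
  wbounded (T + 2 - s) (conv_const (R := R) (d := d) * (A * A)) (zsource b Z s).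
Proof.
move=> A0 sT [mZ bZ]; have [s0 sT'] := andP sT.
apply: wbounded_conv => //; first lra.
- exact: jmeas_slice.
- by case: b; [|apply: cmeas_hatconj]; exact: jmeas_slice.
- exact: bZ.
- by case: b; [|apply: wbounded_hatconj]; exact: bZ.
Qed.

Lemma wbounded_zsourceB (A e : R) b Z Z' s : 0 <= A -> 0 <= e -> 0 <= s <= T ->
  state A Z -> state A Z' ->
  (forall b, wbounded (T + 2 - s) e (Z b s - Z' b s)) ->
  wbounded (T + 2 - s) (conv_const (R := R) (d := d) * (2 * A * e)) (zsource b Z s - zsource b Z' s).
Proof.
move=> A0 e0 sT [mZ bZ] [mZ' bZ'] eZ; have [s0 sT'] := andP sT.
rewrite (_ : 2 * A * e = e * A + A * e); last by ring.
have hh : wbounded (T + 2 - s) e (hatconj (Z true s) - hatconj (Z' true s)).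
  move=> xi; have := wbounded_hatconj (eZ true) xi; congr (_ <= _).
  by rewrite /hatconj -[LHS]/(cabs (Z true s (vopp xi) - Z' true s (vopp xi))^*%C) rmorphB.
apply: wbounded_convB => //; try exact: jmeas_slice; try exact: bZ; try exact: bZ'.
- by lra.
- by case: b; [|apply: cmeas_hatconj]; exact: jmeas_slice.
- by case: b; [|apply: cmeas_hatconj]; exact: jmeas_slice.
- by case: b; [|apply: wbounded_hatconj]; exact: bZ.
- by case: b.
- by case: b; [|apply: wbounded_hatconj]; exact: bZ'.
Qed.

Definition zduh b Z t xi : R[i] := zcoef b * duh (zkernel b) (zsource b Z) t xi.

Lemma wbounded_zduh (A : R) b Z t xi : 0 <= A -> 0 <= t <= T -> state A Z ->
  cabs (zduh b Z t xi) <= 2 * (conv_const (R := R) (d := d) * (A * A)) * weight (T + 2 - t) xi.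
Proof.
move=> A0 tT sZ; rewrite ComplexField.Normc.normcM cabs_zcoef mul1r.
have [mZ _] := sZ; have [mK _ _] := evol_kernel_zkernel b.
have := @wbounded_duh R d T (zkernel b) 1 (conv_const (R := R) (d := d) * (A * A)) t (zsource b Z) tT.
rewrite mul1r; apply => //.
- ge0.
- exact: jmeas_zsource.
- by move=> *; exact: zkernel_le.
- by move=> s sT; exact: wbounded_zsource.
Qed.

Lemma duh_sourceB (A : R) K b Z Z' t xi : 0 <= A -> 0 <= t <= T ->
  evol_kernel T K -> state A Z -> state A Z' ->
  duh K (zsource b Z) t xi - duh K (zsource b Z') t xi =
  duh K (fun s => zsource b Z s - zsource b Z' s) t xi.
Proof.
move=> A0 tT [mK Kb _] sZ sZ'; have [mZ _] := sZ; have [mZ' _] := sZ'.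
have h Y s : state A Y -> 0 <= s <= T ->
    cabs (zsource b Y s xi) <= conv_const (R := R) (d := d) * (A * A) * weight 1 xi.
  move=> sY sT; apply: le_trans (wbounded_zsource b A0 sT sY xi) _.
  have [s0 sT'] := andP sT.
  by apply: ler_wpM2l; [ge0|apply: le_weight; lra].
apply: (@duhB R d T K _ _ _ (conv_const (R := R) (d := d) * (A * A) * weight 1 xi)) => //.
- exact: jmeas_zsource.
- exact: jmeas_zsource.
- by move=> s sT; exact: Kb.
- by move=> s sT; exact: h.
- by move=> s sT; exact: h.
Qed.

Lemma jmeasB (c c' : R -> @cfun R d) : jmeas c -> jmeas c' -> jmeas (fun s => c s - c' s).
Proof. by move=> mc mc'; exact: (cmeasB mc mc'). Qed.

Lemma wbounded_zduhB (A e : R) b Z Z' t xi : 0 <= A -> 0 <= e -> 0 <= t <= T ->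
  state A Z -> state A Z' ->
  (forall b s, 0 <= s <= T -> wbounded (T + 2 - s) e (Z b s - Z' b s)) ->
  cabs (zduh b Z t xi - zduh b Z' t xi) <=
    2 * (conv_const (R := R) (d := d) * (2 * A * e)) * weight (T + 2 - t) xi.
Proof.
move=> A0 e0 tT sZ sZ' eZ; rewrite -mulrBr ComplexField.Normc.normcM cabs_zcoef mul1r.
have [mZ _] := sZ; have [mZ' _] := sZ'; have kK := evol_kernel_zkernel b.
have [mK _ _] := kK.
rewrite (duh_sourceB b xi A0 tT kK sZ sZ').
have := @wbounded_duh R d T (zkernel b) 1 (conv_const (R := R) (d := d) * (2 * A * e)) t
  (fun s => zsource b Z s - zsource b Z' s) tT.
rewrite mul1r; apply => //.
- ge0.
- by apply: jmeasB; exact: jmeas_zsource.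
- by move=> *; exact: zkernel_le.
- by move=> s sT; apply: wbounded_zsourceB => // b'; exact: eZ.
Qed.

(** The extension by zero outside [0, T] makes the iterates converge at every time, so that the
    limit is measurable jointly in time and frequency. *)
Definition zmap L (delta : R) Z b t : @cfun R d := fun xi =>
  if 0 <= t <= T then L b t xi + delta%:C%C * zduh b Z t xi else 0.

Lemma jmeas_zduh b Z : (forall b, jmeas (Z b)) -> jmeas (zduh b Z).
Proof.
move=> mZ; apply: cmeasM; first exact: cmeas_cst.
apply: jmeas_duh; last exact: jmeas_zsource.
by have [] := evol_kernel_zkernel b.
Qed.

Lemma jmeas_zmap L delta Z : (forall b, jmeas (L b)) -> (forall b, jmeas (Z b)) ->
  forall b, jmeas (zmap L delta Z b).
Proof.
move=> mL mZ b; apply: jmeas_ifT.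
exact: (cmeasD (mL b) (cmeasM (cmeas_cst _ (delta%:C)%C) (jmeas_zduh b mZ))).
Qed.

(** [L] takes one half of the radius A. The quadratic term, at most 2 [conv_const] A^2 times
    |delta|, fits into the other half. *)
Lemma state_zmap L (A delta : R) Z : 0 <= A -> state (A / 2) L ->
  `|delta| * (4 * conv_const (R := R) (d := d) * A) <= 1 -> state A Z ->
  state A (zmap L delta Z).
Proof.
move=> A0 [mL bL] dA sZ; split.
  by apply: jmeas_zmap => //; have [] := sZ.
move=> b s sT xi; rewrite /zmap sT.
apply: (le_trans (cabsD _ _)).
rewrite ComplexField.Normc.normcM cabs_real.
have h1 := bL b s sT xi; have h2 := wbounded_zduh b xi A0 sT sZ.
apply: (le_trans (lerD h1 (ler_wpM2l (normr_ge0 delta) h2))).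
have w0 := weight_gt0 (T + 2 - s) xi.
rewrite (_ : A / 2 * _ + _ = A / 2 * weight (T + 2 - s) xi * (1 +
   `|delta| * (4 * conv_const (R := R) (d := d) * A))); last by field.
rewrite [leRHS](_ : _ = A / 2 * weight (T + 2 - s) xi * (1 + 1)); last by field.
by apply: ler_wpM2l; [ge0|rewrite lerD2l].
Qed.

Lemma zmapB (A e : R) L delta Z Z' : 0 <= A -> 0 <= e ->
  `|delta| * (8 * conv_const (R := R) (d := d) * A) <= 1 ->
  state A Z -> state A Z' ->
  (forall b s, 0 <= s <= T -> wbounded (T + 2 - s) e (Z b s - Z' b s)) ->
  forall b s, 0 <= s <= T ->
  wbounded (T + 2 - s) (e / 2) (zmap L delta Z b s - zmap L delta Z' b s).
Proof.
move=> A0 e0 dA sZ sZ' eZ b s sT xi.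
rewrite -[X in cabs X]/(zmap L delta Z b s xi - zmap L delta Z' b s xi) /zmap sT.
rewrite opprD addrACA subrr add0r -mulrBr ComplexField.Normc.normcM cabs_real.
apply: (le_trans (ler_wpM2l (normr_ge0 delta) (wbounded_zduhB b xi A0 e0 sT sZ sZ' eZ))).
have w0 := weight_gt0 (T + 2 - s) xi.
rewrite [leLHS](_ : _ = e / 2 * weight (T + 2 - s) xi *
   (`|delta| * (8 * conv_const (R := R) (d := d) * A))); last by field.
by rewrite -[leRHS]mulr1; apply: ler_wpM2l; [ge0|].
Qed.

Definition picard_seq L delta (m : nat) : bool -> R -> @cfun R d :=
  iter m (zmap L delta) (fun _ _ _ => 0).

Definition picard_sol L delta b t : @cfun R d := fun xi =>
  clim (fun m => picard_seq L delta m b t xi).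

Section PicardFixpoint.
Variables (L : bool -> R -> @cfun R d) (A delta : R).
Hypotheses (A0 : 0 <= A) (sL : state (A / 2) L).
Hypothesis dA : `|delta| * (32 * conv_const (R := R) (d := d) * A) <= 1.
Let Zm := picard_seq L delta.
Let Zi := picard_sol L delta.

Lemma picard_state m : state A (Zm m).
Proof.
elim: m => [|m IH].
  split => [b|b s sT xi]; first exact: cmeas_cst.
  by rewrite ComplexField.Normc.normc0; have := weight_gt0 (T + 2 - s) xi => ?; ge0.
apply: state_zmap => //; apply: le_trans dA; apply: ler_wpM2l => //.
by apply: ler_wpM2r => //; apply: ler_wpM2r; [ge0|rewrite ler_nat].
Qed.

Lemma picard_step m b s : 0 <= s <= T ->
  wbounded (T + 2 - s) (A / 2 ^+ m) (Zm m.+1 b s - Zm m b s).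
Proof.
elim: m b s => [|m IH] b s sT.
  have [_ h] := picard_state 1; move=> xi.
  rewrite expr0 divr1 -[X in cabs X]/(Zm 1 b s xi - 0) subr0.
  exact: h.
rewrite exprSr invfM mulrA.
have e0 : 0 <= A / 2 ^+ m by rewrite divr_ge0// exprn_ge0.
have dA' : `|delta| * (8 * conv_const (R := R) (d := d) * A) <= 1.
  apply: le_trans dA; apply: ler_wpM2l => //.
  by apply: ler_wpM2r => //; apply: ler_wpM2r; [ge0|rewrite ler_nat].
exact: (zmapB L A0 e0 dA' (picard_state m.+1) (picard_state m) IH b sT).
Qed.

Lemma picard_step_all m b s xi :
  cabs (Zm m.+1 b s xi - Zm m b s xi) <= A * weight (T + 2 - s) xi / 2 ^+ m.
Proof.
have [sT|sT] := boolP (0 <= s <= T).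
  by rewrite mulrAC; exact: picard_step.
have Z0 k : Zm k b s xi = 0 by case: k => // k; rewrite /Zm/= /zmap (negbTE sT).
rewrite !Z0 subrr ComplexField.Normc.normc0; have := weight_gt0 (T + 2 - s) xi => ?.
by rewrite divr_ge0 ?exprn_ge0//; ge0.
Qed.

Lemma picard_limit m b s xi :
  cabs (Zi b s xi - Zm m b s xi) <= 4 * A / 2 ^+ m * weight (T + 2 - s) xi.
Proof.
have := cabs_clim_le (fun k => picard_step_all k b s xi) m.
by congr (_ <= _); ring.
Qed.

(** The radius 4 A is the distance from the limit to the zeroth iterate 0 given by [picard_limit].
    Contraction is therefore needed on the ball of radius 4 A, whence 32 = 8 * 4 in the smallness
    hypothesis. *)
Lemma picard_sol_state : state (4 * A) Zi.
Proof.
split=> [b|b s sT xi].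
  apply: (cmeas_clim (F := fun m z => Zm m b z.1 z.2) (C := fun z => A * weight (T + 2 - z.1) z.2)).
    by move=> m; have [mZ _] := picard_state m; exact: (mZ b).
  by move=> [s xi] m; exact: picard_step_all.
by have := picard_limit 0 b s xi; rewrite expr0 divr1 subr0.
Qed.

(** The limit and its image under [zmap] are both within 2 A / 2^m, times the weight, of the iterate
    m + 1. The equation thus holds at every frequency, not merely almost everywhere. *)
Lemma picard_fix b t xi : 0 <= t <= T ->
  Zi b t xi = L b t xi + delta%:C%C * zduh b Zi t xi.
Proof.
move=> tT; apply/eqP; rewrite -subr_eq0; apply/eqP/ComplexField.Normc.eq0_normc.
apply/eqP; rewrite eq_le cabs_ge0 andbT.
apply: (@le_geometric_eq0 R _ (4 * A * weight (T + 2 - t) xi)) => m.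
have -> : L b t xi + delta%:C%C * zduh b Zi t xi = zmap L delta Zi b t xi by rewrite /zmap tT.
have h1 := picard_limit m.+1 b t xi.
have s4 : state (4 * A) (Zm m).
  have [mZ bZ] := picard_state m; split => // b' s sT.
  by apply: wbounded_le (bZ b' s sT) => //; rewrite A0 ler_peMl// ler1n.
have h2 : cabs (zmap L delta Zi b t xi - Zm m.+1 b t xi) <=
    4 * A / 2 ^+ m / 2 * weight (T + 2 - t) xi.
  apply: (@zmapB (4 * A) (4 * A / 2 ^+ m)) => //.
  - ge0.
  - by rewrite divr_ge0 ?exprn_ge0//; ge0.
  - by apply: le_trans dA; rewrite le_eqVlt; apply/orP; left; apply/eqP; ring.
  - exact: picard_sol_state.
  - by move=> b' s sT xi'; exact: picard_limit.
move: h1 h2; move: (Zi b t xi) (Zm m.+1 b t xi) (zmap L delta Zi b t xi) => z1 z2 z3 h1 h2.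
rewrite (_ : z1 - z3 = (z1 - z2) - (z3 - z2)); last by rewrite opprB addrA subrK.
apply: (le_trans (cabsB _ _)); apply: (le_trans (lerD h1 h2)).
rewrite exprS invfM le_eqVlt; apply/orP; left; apply/eqP; field.
by rewrite expf_neq0.
Qed.

Lemma state_data : state (4 * A) L.
Proof.
have [mL bL] := sL; split => // b s sT; apply: wbounded_le (bL b s sT) => //.
by move: A0 => A0'; apply/andP; split; lra.
Qed.

Lemma picard_first_order b s : 0 <= s <= T ->
  wbounded (T + 2 - s) (`|delta| * (32 * conv_const (R := R) (d := d) * A ^+ 2)) (Zi b s - L b s).
Proof.
move=> sT xi; rewrite -[X in cabs X]/(Zi b s xi - L b s xi) picard_fix// addrAC subrr add0r.
rewrite ComplexField.Normc.normcM cabs_real.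
apply: (le_trans (ler_wpM2l (normr_ge0 delta) (wbounded_zduh b xi _ sT picard_sol_state))).
  ge0.
by rewrite le_eqVlt; apply/orP; left; apply/eqP; ring.
Qed.

(** Needed for the time derivative of n: its kernel grows too fast for [picard_second_order], so the
    error of the source is bounded separately and then integrated with [wbounded_duh_kernel]. *)
Lemma picard_source_first_order b s : 0 <= s <= T ->
  wbounded (T + 2 - s)
    (`|delta| * (256 * conv_const (R := R) (d := d) ^+ 2 * A ^+ 3))
    (zsource b Zi s - zsource b L s).
Proof.
move=> sT.
rewrite (_ : `|delta| * _ = conv_const (R := R) (d := d) * (2 * (4 * A) *
  (`|delta| * (32 * conv_const (R := R) (d := d) * A ^+ 2)))); last by ring.
apply: wbounded_zsourceB => //.
- ge0.
- ge0.
- exact: picard_sol_state.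
- exact: state_data.
- by move=> b'; exact: picard_first_order.
Qed.

(** The first-order error of the state is fed back into the equation: 512 = 2 * (2 * 4) * 32, the
    last factor being that of [picard_first_order]. *)
Lemma picard_second_order b t xi : 0 <= t <= T ->
  cabs (Zi b t xi - L b t xi - delta%:C%C * zduh b L t xi) <=
  delta ^+ 2 * (512 * conv_const (R := R) (d := d) ^+ 2 * A ^+ 3) * weight (T + 2 - t) xi.
Proof.
move=> tT; rewrite picard_fix// (addrAC (L b t xi)) subrr add0r -mulrBr.
rewrite ComplexField.Normc.normcM cabs_real.
have h := @wbounded_zduhB (4 * A) (`|delta| * (32 * conv_const (R := R) (d := d) * A ^+ 2))
  b Zi L t xi _ _ tT picard_sol_state state_data picard_first_order.
apply: (le_trans (ler_wpM2l (normr_ge0 delta) (h _ _))); try ge0.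
rewrite -(@real_normK R delta) ?num_real//.
by rewrite le_eqVlt; apply/orP; left; apply/eqP; ring.
Qed.

End PicardFixpoint.
End Picard.

(** * From weighted bounds to Sobolev classes *)

Section NiceFunctions.
Context {R : realType} {d : nat}.
Local Notation leb := (@lebesgue_Rn R d).
Local Notation cabs := (@ComplexField.Normc.normc R).
Implicit Types (xi : @Rn R d) (f g : @cfun R d) (isreal : bool) (s : R).

Definition hreal f : Prop := forall xi, f (vopp xi) = (f xi)^*%C.

Definition nice isreal (M : R) f : Prop :=
  [/\ cmeas f, wbounded 2^-1 M f & isreal -> hreal f].

Lemma japan_ge1 xi : 1 <= japan xi.
Proof. by rewrite -[leLHS]sqrtr1 ler_wsqrtr// lerDl sqnorm_ge0. Qed.

Lemma japan_le_pnorm xi : japan xi <= 2 * pnorm xi.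
Proof.
have p0 := pnorm_gt0 xi; have p1 := pnorm_ge1 xi.
rewrite -(ger0_norm (_ : 0 <= 2 * pnorm xi)) -?sqrtr_sqr ?ler_wsqrtr ?mulr_ge0 ?ltW//.
have := sqnorm_le_pnorm xi; nra.
Qed.

Lemma japan_powR_le s (n : nat) xi : s <= n%:R -> japan xi `^ s <= (2 * pnorm xi) ^+ n.
Proof.
move=> sn; apply: (@le_trans _ _ (japan xi `^ n%:R)).
  by rewrite ler_powR ?japan_ge1.
rewrite powR_mulrn ?(ltW (japan_gt0 _))// lerXn2r ?japan_le_pnorm// nnegrE.
  exact/ltW/japan_gt0.
by rewrite mulr_ge0// ltW// pnorm_gt0.
Qed.

(** x^n / n! <= exp x at x = [pnorm xi] / 2: the remaining decay rate 1/2 beats every power of <xi>.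
    This is why one construction serves all real k and l. *)
Lemma japan_weight_le s : exists2 C : R, 0 <= C &
  forall xi, japan xi `^ s * weight 2^-1 xi <= C * weight0 xi.
Proof.
pose n := (Num.truncn `|s|).+1.
have sn : s <= n.+1%:R.
  rewrite (le_trans (ler_norm s))// (le_trans (ltW (truncnS_gt _)))// ler_nat.
  exact: leqW.
exists (4 ^+ n.+1 * n.+1`!%:R) => [|xi]; first by rewrite mulr_ge0 ?exprn_ge0.
apply: (@le_trans _ _ ((2 * pnorm xi) ^+ n.+1 * weight 2^-1 xi)).
  by rewrite ler_wpM2r ?japan_powR_le// ltW// weight_gt0.
rewrite weightE mulrA.
rewrite ler_wpM2r ?(ltW (weight0_gt0 _))// mulNr expRN ler_pdivrMr ?expR_gt0//.
have p0 := ltW (pnorm_gt0 xi).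
have h : 0 <= 2^-1 * pnorm xi by rewrite mulr_ge0.
have := expR_ge1Dxn n h => H.
apply: (@le_trans _ _ (4 ^+ n.+1 * n.+1`!%:R * ((2^-1 * pnorm xi) ^+ n.+1 / n.+1`!%:R))).
  rewrite le_eqVlt; apply/orP; left; apply/eqP.
  have F0 : n.+1`!%:R != 0 :> R by rewrite pnatr_eq0 -lt0n fact_gt0.
  move: F0; move: (n.+1`!%:R : R) => F F0.
  by rewrite mulrA (mulrAC _ F) mulfK// -exprMn; congr (_ ^+ _); field.
by apply: ler_wpM2l; [rewrite mulr_ge0 ?exprn_ge0|lra].
Qed.

Definition weight0C : @cfun R d := fun xi => (weight0 xi)%:C%C.

Lemma wabs_weight0C xi : wabs 0 weight0C xi = weight0 xi.
Proof.
by rewrite /wabs powRr0 mul1r -[LHS]/(cabs _) cabs_real gtr0_norm ?weight0_gt0.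
Qed.

Lemma measurable_wabs_weight0C : measurable_fun setT (wabs 0 weight0C).
Proof.
rewrite (_ : wabs 0 weight0C = weight0); first exact: measurable_weight0.
by apply/funext => xi; exact: wabs_weight0C.
Qed.

Lemma weight0_le1 xi : weight0 xi <= 1.
Proof.
rewrite /weight0 exprn_ile1// ?invr_ge0 ?addr_ge0 ?sqnorm_ge0//.
by rewrite invf_le1 ?ltr_wpDr ?sqnorm_ge0// lerDl sqnorm_ge0.
Qed.

Lemma finite_norm_weight0C : finite_norm leb 2%:E (wabs 0 weight0C).
Proof.
rewrite /finite_norm unlock /Lnorm; apply: poweR_lty.
apply: le_lt_trans (@integral_weight0_lty R d); apply: ge0_le_integral => //=.
- apply/measurable_EFinP.
  apply: (@measurableT_comp _ _ _ _ _ _ (@powR R ^~ 2)) => //.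
  by apply: measurableT_comp => //; exact: measurable_wabs_weight0C.
- by apply/measurable_EFinP; exact: measurable_weight0.
- move=> xi _; rewrite lee_fin wabs_weight0C gtr0_norm ?weight0_gt0// powR_mulrn ?(ltW (weight0_gt0 _))//.
  by rewrite expr2 ler_piMl ?weight0_le1// ltW// weight0_gt0.
Qed.

(** Comparison with [weight0], which lies in L^2 because it is integrable and at most 1. The
    constant depends on s only. *)
Lemma Lnorm_wabs_le s : exists2 C : R, 0 <= C & forall (M : R) f, 0 <= M ->
  cmeas f -> wbounded 2^-1 M f -> ('N[leb]_2%:E[EFin \o wabs s f] <= (C * M)%:E)%E.
Proof.
have [C C0 hC] := japan_weight_le s.
have fw := finite_norm_weight0C.
pose N0 := fine ('N[leb]_2%:E[EFin \o wabs 0 weight0C])%E.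
have N0E : ('N[leb]_2%:E[EFin \o wabs 0 weight0C] = N0%:E)%E.
  by rewrite fineK// ge0_fin_numE ?Lnorm_ge0.
have N00 : 0 <= N0 by rewrite fine_ge0// Lnorm_ge0.
exists (C * N0) => [|M f M0 [mR mI] fM]; first exact: mulr_ge0.
apply: (@le_trans _ _ ('N[leb]_2%:E[EFin \o wabs 0 ((C * M) *: weight0C)])%E).
  apply: Lnorm2_mono; first exact: measurable_wabs.
    have [] := @measurable_ReIm_lin R d (C * M) weight0C 0.
    - exact: measurable_weight0.
    - exact: measurable_cst.
    - exact: measurable_cst.
    - exact: measurable_cst.
    by rewrite addr0; exact: measurable_wabs.
  move=> xi; rewrite wabs_ge0/=.
  rewrite [leRHS](_ : _ = M * (C * weight0 xi)); last first.
    rewrite /wabs powRr0 mul1r -[((C * M) *: weight0C) xi]/((C * M) *: weight0C xi).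
    rewrite normRcomplexZ -[`|weight0C xi|]/(cabs _) cabs_real (gtr0_norm (weight0_gt0 _)).
    by rewrite ger0_norm ?mulr_ge0//; ring.
  apply: (@le_trans _ _ (japan xi `^ s * (M * weight 2^-1 xi))).
    by rewrite ler_wpM2l ?powR_ge0//; exact: fM.
  by rewrite mulrCA ler_wpM2l.
rewrite Lnorm_wabsZ//; last exact: measurable_wabs_weight0C.
rewrite N0E -EFinM lee_fin ger0_norm ?mulr_ge0//.
by rewrite le_eqVlt; apply/orP; left; apply/eqP; ring.
Qed.

Lemma nice_sob_pred isreal s (M : R) f : 0 <= M -> nice isreal M f ->
  f \in @sob_pred R d isreal s.
Proof.
move=> M0 [mf fM fr]; rewrite inE; have [mR mI] := mf; split => //.
  have [C C0 hC] := Lnorm_wabs_le s.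
  by apply: le_lt_trans (hC M f M0 mf fM) _; rewrite ltry.
by move=> ir; apply: nearW; exact: fr.
Qed.

(** A function outside H^s is sent to the class of 0, the default value of [insubd]; hence the
    membership hypotheses in what follows. *)
Definition sob_of isreal s f : sobolev d isreal s :=
  (\pi_(@sobolev R d isreal s) (insubd (0 : sobfun d isreal s) f))%qT.

Lemma hat_sob_of isreal s f : f \in @sob_pred R d isreal s ->
  {ae leb, forall xi, hat (sob_of isreal s f) xi = f xi}.
Proof.
move=> fP; have := hat_pi (insubd (0 : sobfun d isreal s) f); apply: filterS => xi ->.
by rewrite -[sobval _]/(val _) insubdK.
Qed.

Lemma sob_of_lin isreal s (a : R) f g :
  f \in @sob_pred R d isreal s -> g \in @sob_pred R d isreal s ->
  sob_of isreal s (a *: f + g) = a *: sob_of isreal s f + sob_of isreal s g.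
Proof.
move=> fP gP.
have aP : a *: f + g \in @sob_pred R d isreal s.
  by apply: rpredD => //; exact: rpredZ.
apply: sob_piP; rewrite -[sobval _]/(val _) insubdK//.
have h1 := hat_sob_of fP; have h2 := hat_sob_of gP.
have h3 := hat_pi (a *: repr (sob_of isreal s f)).
move: h1 h2 h3; apply: filterS3 => xi E1 E2 E3.
rewrite -[RHS]/(hat (a *: sob_of isreal s f) xi + hat (sob_of isreal s g) xi) E2.
by rewrite [X in _ = X + _]E3 -[X in _ = X + _]/(a *: hat (sob_of isreal s f) xi) E1.
Qed.

Lemma sob_ofB isreal s f g :
  f \in @sob_pred R d isreal s -> g \in @sob_pred R d isreal s ->
  sob_of isreal s (f - g) = sob_of isreal s f - sob_of isreal s g.
Proof.
move=> fP gP; rewrite addrC -scaleN1r (sob_of_lin _ gP fP).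
by rewrite scaleN1r addrC.
Qed.

Lemma sob_of0 isreal s : sob_of isreal s 0 = 0.
Proof.
apply: sob_piP; apply: nearW => xi; rewrite -[sobval (insubd _ _)]/(val _) insubdK//.
exact: rpred0.
Qed.

Lemma sob_ofZ isreal s (a : R) f : f \in @sob_pred R d isreal s ->
  sob_of isreal s (a *: f) = a *: sob_of isreal s f.
Proof.
by move=> fP; have := sob_of_lin a fP (rpred0 _); rewrite !addr0 sob_of0 addr0.
Qed.

Lemma sob_of_normE isreal s f : f \in @sob_pred R d isreal s ->
  (`|sob_of isreal s f|%:E = 'N[leb]_2%:E[EFin \o wabs s f])%E.
Proof.
by move=> fP; have := sob_norm_pi (insubd (0 : sobfun d isreal s) f); rewrite -[sobval _]/(val _) insubdK.
Qed.

Lemma sob_of_norm_le isreal s : exists2 C : R, 0 <= C & forall (M : R) f, 0 <= M ->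
  f \in @sob_pred R d isreal s -> wbounded 2^-1 M f -> `|sob_of isreal s f| <= C * M.
Proof.
have [C C0 hC] := Lnorm_wabs_le s; exists C => // M f M0 fP fM.
rewrite -lee_fin sob_of_normE//; apply: hC => //.
by move: fP; rewrite inE => -[].
Qed.

(** The convergence takes place in L^2, that is, for sigma = 0. [h N] is a representative of F N - f
    with a bound at every point, whereas the equality between them is only almost everywhere. *)
Lemma cvg_Hminus_wbounded (F h : nat -> @cfun R d) f (C : R) : 0 <= C ->
  (forall N, cmeas (F N - f)) -> (forall N, cmeas (h N)) ->
  (forall N, wbounded 2^-1 (C / N.+1%:R) (h N)) ->
  (forall N, {ae leb, forall xi, (F N - f) xi = h N xi}) ->
  cvg_Hminus F f.
Proof.
move=> C0 mF mh hb Fh; exists 0.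
have [K K0 hK] := Lnorm_wabs_le 0.
apply: (@squeeze_cvge _ _ _ _ (fun=> 0%E) _ (fun N => (K * (C / N.+1%:R))%:E)).
- apply: nearW => N; rewrite Lnorm_ge0/=.
  have [mFR mFI] := mF N; have [mhR mhI] := mh N.
  rewrite (@Lnorm2_ae _ _ (wabs 0 (F N - f)) (wabs 0 (h N))).
  + by apply: hK => //; rewrite divr_ge0.
  + exact: measurable_wabs.
  + exact: measurable_wabs.
  + by apply: filterS (Fh N) => xi; rewrite /wabs => ->.
- exact: cvg_cst.
- apply: (@cvg_EFin _ _ _ _ (fun N => (K * (C / N.+1%:R))%:E)); first exact: nearW.
  have h0 : (fun N => (K * C) * harmonic N) @ \oo --> (0 : R).
    by rewrite -[X in _ --> X](mulr0 (K * C)); apply: cvgM; [exact: cvg_cst|exact: cvg_harmonic].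
  apply: (cvg_trans _ h0); apply: near_eq_cvg; apply: nearW => N /=.
  by rewrite mulrA.
Qed.
End NiceFunctions.

(** * Regularity in time and reality *)

Section Curves.
Context {R : realType} {d : nat}.
Variable T : R.
Hypothesis T0 : 0 <= T.
Local Notation cabs := (@ComplexField.Normc.normc R).
Implicit Types (xi : @Rn R d) (K : R -> @Rn R d -> R[i]) (f : @cfun R d)
  (c : R -> @cfun R d) (isreal : bool).

(** The Fourier multiplier K(t) then maps real-valued functions to real-valued functions. *)
Definition even_kernel K : Prop := forall t xi, K t (vopp xi) = (K t xi)^*%C.

Lemma even_kernel_W0 : even_kernel (fun t xi => (W0 t xi)%:C%C).
Proof. by move=> t xi; rewrite /W0 vnorm_vopp /= oppr0. Qed.

Lemma even_kernel_W1 : even_kernel (fun t xi => (W1 t xi)%:C%C).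
Proof. by move=> t xi; rewrite /W1 vnorm_vopp /= oppr0. Qed.

Lemma even_kernel_W0_sqnorm : even_kernel (fun t xi => (W0 t xi * - sqnorm xi)%:C%C).
Proof. by move=> t xi; rewrite /W0 vnorm_vopp sqnorm_vopp /= oppr0. Qed.

Lemma even_kernel_W1_sqnorm : even_kernel (fun t xi => (W1 t xi * - sqnorm xi)%:C%C).
Proof. by move=> t xi; rewrite /W1 vnorm_vopp sqnorm_vopp /= oppr0. Qed.

(** Lipschitz dependence on time in the weighted norm: a form of continuity that is stable under
    sums and Duhamel integrals, and that yields continuity with values in every H^s at once. *)
Definition curve isreal (C : R) c : Prop :=
  (forall t, 0 <= t <= T -> nice isreal C (c t)) /\
  forall t t', 0 <= t <= T -> 0 <= t' <= T ->
    wbounded 2^-1 (C * `|t - t'|) (c t - c t').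

(** 432 = 2 * 216: the factor 2 in the Lipschitz bound of an [evol_kernel], times the loss in
    [pnorm3_weight]. *)
Lemma curve_linear isreal K f (M : R) : 0 <= M -> evol_kernel T K ->
  (isreal -> even_kernel K) -> cmeas f -> wbounded 1 M f -> (isreal -> hreal f) ->
  curve isreal (432 * (1 + T) * M) (fun t xi => K t xi * f xi).
Proof.
move=> M0 [mK Kb Kl] eK mf fM rf; have P3 := @pnorm3_weight R d; split.
  move=> t tT; split.
  - by apply: cmeasM => //; exact: (jmeas_slice t mK).
  - move=> xi; rewrite ComplexField.Normc.normcM.
    apply: (@le_trans _ _ ((1 + T) * pnorm xi ^+ 3 * (M * weight 1 xi))).
      apply: ler_pM; rewrite ?cabs_ge0//.
      apply: (le_trans (Kb _ _ tT)); apply: ler_wpM2l; first exact: addr_ge0.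
      exact: pnorm_exp_le.
    apply: (@le_trans _ _ ((1 + T) * M * (432 * weight 2^-1 xi))).
      rewrite (_ : _ * _ * _ = (1 + T) * M * (pnorm xi ^+ 3 * weight 1 xi)); last by ring.
      apply: ler_wpM2l; first ge0.
      by apply: (le_trans (P3 xi)); apply: ler_wpM2r; [ge0|rewrite ler_nat].
    by rewrite le_eqVlt; apply/orP; left; apply/eqP; ring.
  - by move=> ir xi; rewrite (eK ir) (rf ir) -conjcM_eq.
move=> t t' tT t'T xi.
rewrite -[X in cabs X]/(K t xi * f xi - K t' xi * f xi) -mulrBl ComplexField.Normc.normcM.
apply: (@le_trans _ _ (2 * pnorm xi ^+ 3 * `|t - t'| * (M * weight 1 xi))).
  by apply: ler_pM; rewrite ?cabs_ge0.
rewrite (_ : _ * _ * _ = (2 * M * `|t - t'|) * (pnorm xi ^+ 3 * weight 1 xi)); last by ring.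
apply: (@le_trans _ _ ((2 * M * `|t - t'|) * (216 * weight 2^-1 xi))).
  by apply: ler_wpM2l; [ge0|exact: P3].
rewrite (_ : _ * (216 * _) = (432 * M * `|t - t'| * weight 2^-1 xi) * 1); last by ring.
rewrite [leRHS](_ : _ = (432 * M * `|t - t'| * weight 2^-1 xi) * (1 + T)); last by ring.
by apply: ler_wpM2l; [ge0|rewrite lerDl].
Qed.

Lemma cintegrable_duh K c (M : R) t xi : 0 <= t <= T -> evol_kernel T K ->
  jmeas c -> (forall s, 0 <= s <= T -> wbounded 1 M (c s)) ->
  cintegrable (@lebesgue_measure R) `[0, t] (fun s => K (t - s) xi * c s xi).
Proof.
move=> /andP[t0 tT] [mK Kb _] mc cM.
apply: (@cintegrable_time_cst R t _ ((1 + T) * pnorm xi ^+ 2 * (M * weight 1 xi))).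
  exact: cmeas_duh_integrand.
move=> s /andP[s0 st]; rewrite ComplexField.Normc.normcM.
by apply: ler_pM; rewrite ?cabs_ge0//; [apply: Kb|apply: cM]; apply/andP; split; lra.
Qed.

Lemma hreal_duh K c (M : R) t : 0 <= t <= T -> evol_kernel T K -> even_kernel K ->
  jmeas c -> (forall s, 0 <= s <= T -> wbounded 1 M (c s)) ->
  (forall s, 0 <= s <= T -> hreal (c s)) -> hreal (duh K c t).
Proof.
move=> tT kK eK mc cM rc xi.
rewrite /duh /time_int -(@Cintegral_conj R _ (measurableTypeR R) (@lebesgue_measure R) _ _
  (measurable_itv _) (cintegrable_duh xi tT kK mc cM)).
apply: eq_Cintegral => s /=; rewrite in_itv/= => /andP[s0 st].
have [t0 t1] := andP tT.
rewrite eK rc ?s0 ?(le_trans st)//.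
by rewrite -conjcM_eq.
Qed.

(** (3 T + 1) (1 + T) dominates both T (1 + T), from the size, and 2 T + 1 + T, from the Lipschitz
    bound. *)
Lemma curve_duh isreal K c (M : R) : 0 <= M -> evol_kernel T K ->
  (isreal -> even_kernel K) -> jmeas c ->
  (forall s, 0 <= s <= T -> wbounded 1 M (c s)) ->
  (isreal -> forall s, 0 <= s <= T -> hreal (c s)) ->
  curve isreal (2 * (216 * M * ((3 * T + 1) * (1 + T)))) (duh K c).
Proof.
move=> M0 kK eK mc cM rc; split.
  move=> t tT; split.
  - by apply: jmeas_slice; apply: jmeas_duh => //; have [] := kK.
  - apply: (@wbounded_le _ _ 2^-1 2^-1 (2 * (T * (1 + T) * M * 216))) => //.
      apply/andP; split; first ge0.
      rewrite (_ : _ * 216 = 216 * M * (T * (1 + T))); last by ring.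
      by do 2 (apply: ler_wpM2l; first ge0); apply: ler_wpM2r; [ge0|have := T0; lra].
    exact: wbounded_duh_kernel.
  - by move=> ir; apply: (@hreal_duh _ _ M) => //; [exact: eK|exact: rc].
have main t t' : 0 <= t <= T -> 0 <= t' <= T -> t' <= t ->
    wbounded 2^-1 (2 * (216 * M * ((3 * T + 1) * (1 + T))) * `|t - t'|) (duh K c t - duh K c t').
  move=> /andP[t0 tT] /andP[t'0 t'T] tt'.
  rewrite ger0_norm ?subr_ge0//.
  apply: (@wbounded_le _ _ 2^-1 2^-1 (2 * (216 * M * (2 * T + 1 + T)) * (t - t'))) => //.
    have tt0 : 0 <= t - t' by rewrite subr_ge0.
    apply/andP; split; first ge0.
    apply: ler_wpM2r; first ge0.
    do 2 (apply: ler_wpM2l; first ge0).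
    have := T0; nra.
  by apply: (wbounded_duh_lip _ tT) => //; rewrite t'0.
move=> t t' tT t'T; have [tt'|/ltW tt'] := leP t' t; first exact: main.
move=> xi; have := main t' t t'T tT tt' xi.
by rewrite distrC -[X in cabs X]/(duh K c t' xi - duh K c t xi) cabs_distC.
Qed.

Lemma curve_add isreal (C1 C2 : R) c1 c2 : curve isreal C1 c1 -> curve isreal C2 c2 ->
  curve isreal (C1 + C2) (fun t xi => c1 t xi + c2 t xi).
Proof.
move=> [n1 l1] [n2 l2]; split.
  move=> t tT; have [m1 b1 r1] := n1 t tT; have [m2 b2 r2] := n2 t tT; split.
  - exact: cmeasD.
  - by move=> xi; apply: (le_trans (cabsD _ _)); rewrite mulrDl; apply: lerD.
  - by move=> ir xi; rewrite r1// r2// -conjcD_eq.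
move=> t t' tT t'T xi.
rewrite -[X in cabs X]/((c1 t xi + c2 t xi) - (c1 t' xi + c2 t' xi)).
rewrite opprD addrACA; apply: (le_trans (cabsD _ _)); rewrite !mulrDl.
by apply: lerD; [exact: l1|exact: l2].
Qed.

Lemma curve_coef (z : R[i]) (C : R) c : cabs z = 1 -> curve false C c ->
  curve false C (fun t xi => z * c t xi).
Proof.
move=> z1 [n1 l1]; split.
  move=> t tT; have [m1 b1 r1] := n1 t tT; split => //.
  - by apply: cmeasM => //; exact: cmeas_cst.
  - by move=> xi; rewrite ComplexField.Normc.normcM z1 mul1r; exact: b1.
move=> t t' tT t'T xi.
rewrite -[X in cabs X]/(z * c t xi - z * c t' xi) -mulrBr ComplexField.Normc.normcM z1 mul1r.
exact: l1.
Qed.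

Lemma eq_curve isreal (C : R) c c' : (forall t, 0 <= t <= T -> c t = c' t) ->
  curve isreal C c -> curve isreal C c'.
Proof.
move=> E [n l]; split=> [t tT|t t' tT t'T]; first by rewrite -E//; exact: n.
by rewrite -!E//; exact: l.
Qed.

Lemma curve_continuous isreal s (C : R) c : 0 <= C -> curve isreal C c ->
  {within `[0, T], continuous (fun t => sob_of isreal s (c t))}.
Proof.
move=> C0 [n l]; have [D D0 hD] := @sob_of_norm_le R d isreal s.
have lip t t' : 0 <= t <= T -> 0 <= t' <= T ->
    `|sob_of isreal s (c t) - sob_of isreal s (c t')| <= D * C * `|t - t'|.
  move=> tT t'T.
  have nt := nice_sob_pred s C0 (n t tT); have nt' := nice_sob_pred s C0 (n t' t'T).
  rewrite -(sob_ofB nt nt') -mulrA; apply: hD; first by rewrite mulr_ge0.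
    exact: rpredB.
  exact: l.
apply/subspace_continuousP => t /=; rewrite in_itv/= => tT.
apply/cvgrPdist_le => e e0; rewrite near_withinE.
have DC : 0 < D * C + 1 by rewrite ltr_wpDl// mulr_ge0.
apply/nbhs_normP; exists (e / (D * C + 1)); first by rewrite /= divr_gt0.
move=> u /= tu; rewrite in_itv/= => uT; apply: (le_trans (lip t u tT uT)).
apply: (@le_trans _ _ ((D * C + 1) * `|t - u|)); first by rewrite ler_wpM2r// lerDl.
by rewrite mulrC -ler_pdivlMr// ltW.
Qed.
End Curves.

(** * Removing the frequency truncation *)

Section DuhamelLimit.
Context {R : realType} {d : nat}.
Local Notation leb := (@lebesgue_Rn R d).
Local Notation cabs := (@ComplexField.Normc.normc R).

(** Common to the three integral equations. [a] is the free evolution of the explicit datum and [a']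
    that of the representative [hat]; they agree only almost everywhere. Their difference drops out,
    and what remains is the Duhamel integral of the truncation error, of order 1 / (N + 1). *)
Lemma cvg_Hminus_duh (T t M E : R) (z : R[i]) (K : R -> @Rn R d -> R[i])
    (G cN : nat -> R -> @cfun R d) (c : R -> @cfun R d) (g a a' : @cfun R d) :
  0 <= t <= T -> 0 <= M -> 0 <= E -> cabs z = 1 -> evol_kernel T K -> jmeas c ->
  (forall N, jmeas (cN N)) ->
  (forall s, 0 <= s <= T -> wbounded 1 M (c s)) ->
  (forall N s, 0 <= s <= T -> wbounded 1 M (cN N s)) ->
  (forall N s, 0 <= s <= T -> wbounded 1 (E / N.+1%:R) (cN N s - c s)) ->
  cmeas a' -> cmeas g ->
  (forall N xi, G N t xi = a' xi + z * duh K (cN N) t xi) ->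
  {ae leb, forall xi, a' xi = a xi} ->
  {ae leb, forall xi, g xi = a xi + z * duh K c t xi} ->
  cvg_Hminus (fun N => G N t) g.
Proof.
move=> tT M0 E0 z1 kK mc mcN cM cNM cE ma' mg GE aa' gE.
have [mK Kb _] := kK.
have T0 : 0 <= T by have [t0 ?] := andP tT; exact: le_trans t0 _.
pose h N : @cfun R d := fun xi => z * duh K (fun s => cN N s - c s) t xi.
apply: (@cvg_Hminus_wbounded _ _ _ h _ (2 * (T * (1 + T) * E * 216))).
- ge0.
- move=> N; apply: cmeasB => //.
  have mD : @cmeas R _ (@Rn R d) (fun xi => a' xi + z * duh K (cN N) t xi).
    apply: cmeasD => //; apply: cmeasM; first exact: cmeas_cst.
    exact: (jmeas_slice t (jmeas_duh mK (mcN N))).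
  by congr cmeas : mD; apply/funext => xi; rewrite GE.
- move=> N; apply: cmeasM; first exact: cmeas_cst.
  exact: (jmeas_slice t (jmeas_duh mK (jmeasB (mcN N) mc))).
- move=> N xi; rewrite ComplexField.Normc.normcM z1 mul1r.
  rewrite (_ : _ / N.+1%:R = 2 * (T * (1 + T) * (E / N.+1%:R) * 216)); last by ring.
  apply: wbounded_duh_kernel => //; first by rewrite divr_ge0.
    exact: jmeasB.
  by move=> s sT; exact: cE.
- move=> N; move: aa' gE; apply: filterS2 => xi ea eg.
  rewrite -[LHS]/(G N t xi - g xi) GE eg ea /h.
  rewrite opprD addrACA subrr add0r -mulrBr.
  rewrite (@duhB R d T K (cN N) c ((1 + T) * pnorm xi ^+ 2) (M * weight 1 xi) t xi) //.
  + by move=> s sT; exact: Kb.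
  + by move=> s sT; exact: cNM.
  + by move=> s sT; exact: cM.
Qed.

Lemma jmeas_hatprod N (f g : R -> @cfun R d) : jmeas f -> jmeas g ->
  jmeas (fun s => hatprod N (f s) (g s)).
Proof.
move=> mf mg.
have mt (c : R -> @cfun R d) : jmeas c -> jmeas (fun s => trunc N (c s)).
  move=> mc; have mb : measurable_fun setT (fun z : R * @Rn R d => vnorm z.2 <= N%:R).
    exact: (measurableT_comp (measurable_vnorm_le N) measurable_snd).
  exact: (cmeas_if mb mc (cmeas_cst _ 0)).
exact: (cmeas_conv (mt _ mf) (mt _ mg)).
Qed.

Lemma hatprod_ae N (f f' g g' : @cfun R d) : cmeas f -> cmeas f' -> cmeas g -> cmeas g' ->
  {ae leb, forall xi, f xi = f' xi} -> {ae leb, forall xi, g xi = g' xi} ->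
  hatprod N f g = hatprod N f' g'.
Proof.
move=> mf mf' mg mg' ff gg; apply: conv_ae; try exact: cmeas_trunc.
  by apply: filterS ff => xi; rewrite /trunc => ->.
by apply: filterS gg => xi; rewrite /trunc => ->.
Qed.

Lemma hatconj_ae (f f' : @cfun R d) : {ae leb, forall xi, f xi = f' xi} ->
  {ae leb, forall xi, hatconj f xi = hatconj f' xi}.
Proof.
move=> /(ae_vsub ([tuple 0 | i < d] : @Rn R d)); apply: filterS => xi.
rewrite (_ : vsub _ xi = vopp xi); first by rewrite /hatconj => ->.
by apply: eq_from_tnth => i; rewrite !tnth_mktuple sub0r.
Qed.

Lemma cmeas_hat isreal (s : R) (u : @sobolev R d isreal s) : cmeas (hat u).
Proof. by have [mR mI _ _] := hatP u. Qed.
End DuhamelLimit.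

(** * Local solutions for data with decaying Fourier transform *)

Section Solution.
Context {R : realType} {d : nat}.
Local Notation leb := (@lebesgue_Rn R d).
Local Notation cabs := (@ComplexField.Normc.normc R).
Local Notation Cc := (@conv_const R d).
Variable T : R.
Hypothesis T0 : 0 <= T.
Implicit Types (xi : @Rn R d) (Y : bool -> R -> @cfun R d) (b : bool).

Lemma wbounded1_state (A : R) Y b s : 0 <= A -> 0 <= s <= T -> state T A Y ->
  wbounded 2 A (Y b s).
Proof.
move=> A0 sT [_ bY]; apply: wbounded_le (bY b s sT); last by rewrite A0/=.
by have [? ?] := andP sT; lra.
Qed.

Lemma wbounded1_zsource (A : R) Y b s : 0 <= A -> 0 <= s <= T -> state T A Y ->
  wbounded 1 (Cc * (A * A)) (zsource b Y s).
Proof.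
move=> A0 sT sY; apply: wbounded_le (wbounded_zsource b A0 sT sY).
  by have [? ?] := andP sT; lra.
by rewrite lexx andbT; ge0.
Qed.

Lemma hreal_zsource (A : R) Y s : 0 <= A -> 0 <= s <= T -> state T A Y ->
  hreal (zsource false Y s).
Proof.
move=> A0 sT [mY bY] xi; have [s0 sT'] := andP sT.
have mt : cmeas (Y true s) by exact: jmeas_slice.
have a0 : 0 <= T + 2 - s by lra.
have AA : 0 <= A * A by exact: mulr_ge0.
have [iF _] := conv_integrand_bound (xi := xi) a0 AA
  (cmeas_conv_integrand xi mt (cmeas_hatconj mt))
  (wbounded_mul xi A0 A0 (bY true s sT) (wbounded_hatconj (bY true s sT))).
exact: (conv_hatconj_vopp mt iF).
Qed.

Lemma curve_duh_zsource (A : R) K b Y : 0 <= A -> state T A Y -> evol_kernel T K ->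
  (~~ b -> even_kernel K) ->
  exists2 C : R, 0 <= C & curve T (~~ b) C (duh K (zsource b Y)).
Proof.
move=> A0 sY kK eK; have [mY _] := sY.
exists (2 * (216 * (Cc * (A * A)) * ((3 * T + 1) * (1 + T)))); first ge0.
apply: (curve_duh T0) => //.
- ge0.
- exact: jmeas_zsource.
- by move=> s sT; exact: wbounded1_zsource.
- by case: b eK => // _ _ s sT; exact: (hreal_zsource A0 sT sY).
Qed.

Lemma curve_zduh (A : R) b Y : 0 <= A -> state T A Y ->
  exists2 C : R, 0 <= C & curve T (~~ b) C (zduh b Y).
Proof.
move=> A0 sY; have eK : ~~ b -> even_kernel (@zkernel R d b).
  by case: b => // _; exact: even_kernel_W1_sqnorm.
have [C C0 cC] := curve_duh_zsource A0 sY (evol_kernel_zkernel T0 b) eK.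
exists C => //; case: b eK cC => _ cC.
  by apply: curve_coef => //; exact: cabs_zcoef.
apply: eq_curve cC => t tT; apply/funext => xi.
by rewrite /zduh /zcoef mul1r.
Qed.

Definition dkernel t xi : R[i] := (W0 t xi * - sqnorm xi)%:C%C.
Definition dduh Y t : @cfun R d := duh dkernel (zsource false Y) t.

Lemma curve_dduh (A : R) Y : 0 <= A -> state T A Y ->
  exists2 C : R, 0 <= C & curve T true C (dduh Y).
Proof.
move=> A0 sY; apply: (@curve_duh_zsource A dkernel false) => //.
  exact: kernel_W0_sqnorm.
by move=> _; exact: even_kernel_W0_sqnorm.
Qed.

Definition nice_data (M : R) (phi psi chi : @cfun R d) : Prop :=
  [/\ cmeas phi, cmeas psi & cmeas chi] /\
  [/\ wbounded (T + 2) M phi, wbounded (T + 2) M psi & wbounded (T + 2) M chi] /\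
  (hreal psi /\ hreal chi).

Variables (M : R) (phi psi chi : @cfun R d).
Hypotheses (M0 : 0 <= M) (data : nice_data M phi psi chi).

Definition lin b t : @cfun R d := fun xi =>
  if b then schrod t xi * phi xi
  else (W0 t xi)%:C%C * psi xi + (W1 t xi)%:C%C * chi xi.

Definition lin_dt t : @cfun R d := fun xi =>
  (W0 t xi)%:C%C * chi xi + (W1 t xi * - sqnorm xi)%:C%C * psi xi.

Lemma jmeas_lin b : jmeas (lin b).
Proof.
have [[m1 m2 m3] _] := data.
have mm (f : @cfun R d) : cmeas f -> @cmeas R _ (R * @Rn R d)%type (fun z => f z.2).
  by move=> mf; exact: (cmeas_comp mf measurable_snd).
case: b; rewrite /lin.
  by apply: cmeasM; [exact: jmeas_schrod|exact: mm].
apply: cmeasD; apply: cmeasM; try exact: mm.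
  by apply: cmeas_real; exact: measurable_W0.
by apply: cmeas_real; exact: measurable_W1.
Qed.

(** The factor 1 + T collects |W0| <= 1 and |W1(t)| <= T. *)
Lemma state_lin : state T ((1 + T) * M) lin.
Proof.
split=> [b|b s sT]; first exact: jmeas_lin.
have [s0 sT'] := andP sT.
have [_ [[b1 b2 b3] _]] := data.
suff : wbounded (T + 2) ((1 + T) * M) (lin b s).
  by apply: wbounded_le; [lra|rewrite lexx andbT; ge0].
move=> xi; have w := weight_gt0 (T + 2) xi.
have TM : M * weight (T + 2) xi <= (1 + T) * M * weight (T + 2) xi.
  by rewrite -mulrA ler_peMl ?lerDl//; ge0.
case: b; rewrite /lin.
  by rewrite ComplexField.Normc.normcM cabs_schrod mul1r; apply: le_trans TM; exact: b1.
apply: (le_trans (cabsD _ _)); rewrite !ComplexField.Normc.normcM !cabs_real.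
apply: (@le_trans _ _ (1 * (M * weight (T + 2) xi) + T * (M * weight (T + 2) xi))).
  apply: lerD; apply: ler_pM; rewrite ?cabs_ge0//.
  - exact: W0_le.
  - by apply: (le_trans (W1_le _ _)); rewrite ger0_norm.
by rewrite le_eqVlt; apply/orP; left; apply/eqP; ring.
Qed.

Lemma wbounded1_data (f : @cfun R d) : wbounded (T + 2) M f -> wbounded 1 M f.
Proof. by apply: wbounded_le; rewrite ?M0/=; [have := T0; lra|]. Qed.

Lemma curve_lin b : exists2 C : R, 0 <= C & curve T (~~ b) C (lin b).
Proof.
have [[m1 m2 m3] [[/wbounded1_data b1 /wbounded1_data b2 /wbounded1_data b3] [r2 r3]]] := data.
case: b; rewrite /lin.
  exists (432 * (1 + T) * M); first ge0.
  by apply: curve_linear => //; exact: kernel_schrod.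
exists (432 * (1 + T) * M + 432 * (1 + T) * M); first ge0.
apply: curve_add; apply: curve_linear => //.
- exact: kernel_W0.
- by move=> _; exact: even_kernel_W0.
- exact: kernel_W1.
- by move=> _; exact: even_kernel_W1.
Qed.

Lemma curve_lin_dt : exists2 C : R, 0 <= C & curve T true C lin_dt.
Proof.
have [[m1 m2 m3] [[/wbounded1_data b1 /wbounded1_data b2 /wbounded1_data b3] [r2 r3]]] := data.
exists (432 * (1 + T) * M + 432 * (1 + T) * M); first ge0.
apply: curve_add; apply: curve_linear => //.
- exact: kernel_W0.
- by move=> _; exact: even_kernel_W0.
- exact: kernel_W1_sqnorm.
- by move=> _; exact: even_kernel_W1_sqnorm.
Qed.

Let A : R := 2 * ((1 + T) * M).
Hypothesis small : 32 * Cc * A <= 1.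
(** The parameter of [zmap] is 1 here: the smallness that the iteration requires is put on the data,
    through [small]. *)
Let Z := picard_sol T lin 1.

Let A0 : 0 <= A. Proof. by rewrite /A; ge0. Qed.

Let sL : state T (A / 2) lin.
Proof. by rewrite /A mulrC mulKf//; exact: state_lin. Qed.

Let small1 : `|1| * (32 * Cc * A) <= 1 :> R.
Proof. by rewrite normr1 mul1r. Qed.

Lemma sol_state : state T (4 * A) Z.
Proof. exact: (picard_sol_state T0 A0 sL small1). Qed.

Lemma sol_fix b t xi : 0 <= t <= T -> Z b t xi = lin b t xi + zduh b Z t xi.
Proof.
move=> tT; rewrite (_ : Z = picard_sol T lin 1)//.
by rewrite (picard_fix T0 A0 sL small1)// mul1r.
Qed.

Definition dsol t : @cfun R d := fun xi => lin_dt t xi + dduh Z t xi.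

Let A40 : 0 <= 4 * A. Proof. by have := A0; lra. Qed.

Lemma curve_sol b : exists2 C : R, 0 <= C & curve T (~~ b) C (Z b).
Proof.
have [C1 C10 c1] := curve_lin b.
have [C2 C20 c2] := curve_zduh b A40 sol_state.
exists (C1 + C2); first exact: addr_ge0.
apply: (eq_curve _ (curve_add c1 c2)) => t tT; apply/funext => xi.
by rewrite sol_fix.
Qed.

Lemma curve_dsol : exists2 C : R, 0 <= C & curve T true C dsol.
Proof.
have [C1 C10 c1] := curve_lin_dt.
have [C2 C20 c2] := curve_dduh A40 sol_state.
exists (C1 + C2); first exact: addr_ge0.
exact: (curve_add c1 c2).
Qed.

Variables k l : R.

Definition Hkl_of (f g h : @cfun R d) : Hkl d k l :=
  (sob_of false k f, sob_of true l g, sob_of true (l - 1) h).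

Definition sol t : Hkl d k l := Hkl_of (Z true t) (Z false t) (dsol t).

Lemma curve_sob_pred isreal (s C : R) (c : R -> @cfun R d) t : 0 <= C -> curve T isreal C c ->
  0 <= t <= T -> c t \in @sob_pred R d isreal s.
Proof. by move=> C0 [n _] tT; exact: (nice_sob_pred s C0 (n t tT)). Qed.

Lemma data_sob_pred (s : R) : [/\ phi \in @sob_pred R d false s,
  psi \in @sob_pred R d true s & chi \in @sob_pred R d true s].
Proof.
have [[m1 m2 m3] [[/wbounded1_data b1 /wbounded1_data b2 /wbounded1_data b3] [r2 r3]]] := data.
have h (f : @cfun R d) : wbounded 1 M f -> wbounded 2^-1 M f.
  by apply: wbounded_le; rewrite ?M0 ?lexx//; lra.
by split; apply: (nice_sob_pred s M0); split => //; exact: h.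
Qed.

(** The equations are written with [hat], an arbitrary representative chosen separately at each
    time, which need not be measurable jointly in time and frequency. But the truncated products are
    convolutions and do not see null sets, so by [hatprod_ae] they equal those of the explicit
    solution at each time, and the time integrals are those already estimated. *)
Lemma sol_local_solution : local_solution T (Hkl_of phi psi chi) sol.
Proof.
have [C1 C10 c1] := curve_sol true; have [C2 C20 c2] := curve_sol false.
have [C3 C30 c3] := curve_dsol.
have sZ := sol_state; have [mZ bZ] := sZ.
have [[m1 m2 m3] _] := data.
split.
  split.
  - exact: (@curve_continuous R d T false k C1 (Z true) C10 c1).
  - exact: (@curve_continuous R d T true l C2 (Z false) C20 c2).
  - exact: (@curve_continuous R d T true (l - 1) C3 dsol C30 c3).
have hu s : 0 <= s <= T -> {ae leb, forall xi, hat (sol s).1.1 xi = Z true s xi}.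
  by move=> sT; apply: hat_sob_of; exact: (curve_sob_pred k C10 c1 sT).
have hn s : 0 <= s <= T -> {ae leb, forall xi, hat (sol s).1.2 xi = Z false s xi}.
  by move=> sT; apply: hat_sob_of; exact: (curve_sob_pred l C20 c2 sT).
have hd s : 0 <= s <= T -> {ae leb, forall xi, hat (sol s).2 xi = dsol s xi}.
  by move=> sT; apply: hat_sob_of; exact: (curve_sob_pred (l - 1) C30 c3 sT).
have [pk _ _] := data_sob_pred k; have [_ ql _] := data_sob_pred l.
have [_ _ rl] := data_sob_pred (l - 1).
have h1 := hat_sob_of pk; have h2 := hat_sob_of ql; have h3 := hat_sob_of rl.
pose cN b N s : @cfun R d :=
  hatprod N (Z true s) (if b then Z false s else hatconj (Z true s)).
have mS b : jmeas (fun s => if b then Z false s else hatconj (Z true s)).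
  case: b; first exact: mZ.
  apply: cmeas_conj.
  have mp : measurable_fun setT (fun z : R * @Rn R d => (z.1, vopp z.2)).
    by apply: measurable_fun_pair => //; exact: (measurableT_comp (@measurable_vopp R d)).
  exact: (cmeas_comp (mZ true) mp).
have mcN b N : jmeas (cN b N) by exact: jmeas_hatprod.
have bS b s : 0 <= s <= T -> wbounded 2 (4 * A) (if b then Z false s else hatconj (Z true s)).
  by move=> sT; case: b; [|apply: wbounded_hatconj]; exact: wbounded1_state.
have bcN b N s : 0 <= s <= T -> wbounded 1 (Cc * (4 * A * (4 * A))) (cN b N s).
  move=> sT; have AA := A40.
  apply: wbounded_conv => //; try apply: cmeas_trunc; try apply: wbounded_trunc => //.
  - exact: jmeas_slice.
  - exact: (jmeas_slice s (mS b)).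
  - by apply: (wbounded_le _ _ (wbounded1_state true AA sT sZ)); [lra|rewrite AA/=].
  - by apply: (wbounded_le _ _ (bS b s sT)); [lra|rewrite AA/=].
have dcN b N s : 0 <= s <= T ->
    wbounded 1 (Cc * (8 * (4 * A) * (4 * A)) / N.+1%:R) (cN b N s - zsource b Z s).
  move=> sT; have AA := A40; apply: wbounded_hatprod_sub => //.
  - exact: jmeas_slice.
  - exact: (jmeas_slice s (mS b)).
  - exact: wbounded1_state.
  - exact: bS.
have hpu N s : 0 <= s <= T ->
    hatprod N (hat (sol s).1.1) (hat (sol s).1.2) = cN true N s.
  move=> sT; apply: hatprod_ae; try exact: cmeas_hat; try exact: jmeas_slice.
    exact: hu.
  exact: hn.
have hpn N s : 0 <= s <= T ->
    hatprod N (hat (sol s).1.1) (hatconj (hat (sol s).1.1)) = cN false N s.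
  move=> sT; apply: hatprod_ae; try exact: cmeas_hat; try exact: jmeas_slice.
  - by apply: cmeas_hatconj; exact: cmeas_hat.
  - by apply: cmeas_hatconj; exact: jmeas_slice.
  - exact: hu.
  - by apply: hatconj_ae; exact: hu.
have E0 : 0 <= Cc * (8 * (4 * A) * (4 * A)) by have AA := A40; ge0.
have F0 : 0 <= Cc * (4 * A * (4 * A)) by have AA := A40; ge0.
have sub (t s : R) : 0 <= t <= T -> `[0, t]%classic s -> 0 <= s <= T.
  by move=> /andP[t0 tT]; rewrite /= in_itv/= => /andP[-> /le_trans]; apply.
move=> u n dtn t tT; split.
- apply: (@cvg_Hminus_duh R d T t (Cc * (4 * A * (4 * A))) (Cc * (8 * (4 * A) * (4 * A)))
    (- 'i%C) schrod (fun N => rhs_u N (hat (Hkl_of phi psi chi).1.1) u n) (cN true) (zsource true Z) (u t)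
    (fun xi => schrod t xi * phi xi)
    (fun xi => schrod t xi * hat (Hkl_of phi psi chi).1.1 xi)) => //.
  + by rewrite cabsN cabs_i.
  + exact: kernel_schrod.
  + exact: jmeas_zsource.
  + by move=> s sT; exact: wbounded1_zsource.
  + by move=> N s sT; exact: bcN.
  + by move=> N s sT; exact: dcN.
  + by apply: cmeasM; [exact: (jmeas_slice t jmeas_schrod)|exact: cmeas_hat].
  + exact: cmeas_hat.
  + move=> N xi.
    have E : duh schrod (cN true N) t xi =
        time_int t (fun s => schrod (t - s) xi * hatprod N (u s) (n s) xi).
      by apply: eq_Cintegral => s /(sub t s tT) sT; rewrite -(hpu N s sT).
    by rewrite E mulNr.
  + by apply: filterS h1 => xi ->.
  + by apply: filterS (hu t tT) => xi E; exact: (etrans E (sol_fix true xi tT)).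
- apply: (@cvg_Hminus_duh R d T t (Cc * (4 * A * (4 * A))) (Cc * (8 * (4 * A) * (4 * A)))
    1 (zkernel false) (fun N => rhs_n N (hat (Hkl_of phi psi chi).1.2) (hat (Hkl_of phi psi chi).2) u) (cN false) (zsource false Z) (n t)
    (lin false t)
    (fun xi => (W0 t xi)%:C%C * hat (Hkl_of phi psi chi).1.2 xi +
      (W1 t xi)%:C%C * hat (Hkl_of phi psi chi).2 xi)) => //.
  + by rewrite ComplexField.Normc.normc1.
  + exact: evol_kernel_zkernel.
  + exact: jmeas_zsource.
  + by move=> s sT; exact: wbounded1_zsource.
  + by move=> N s sT; exact: bcN.
  + by move=> N s sT; exact: dcN.
  + apply: cmeasD; apply: cmeasM; try exact: cmeas_hat.
      by have [mK _ _] := @kernel_W0 R d T T0; exact: (jmeas_slice t mK).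
    by have [mK _ _] := @kernel_W1 R d T T0; exact: (jmeas_slice t mK).
  + exact: cmeas_hat.
  + move=> N xi.
    have E : duh (zkernel false) (cN false N) t xi = time_int t (fun s =>
        (W1 (t - s) xi * - sqnorm xi)%:C%C * hatprod N (u s) (hatconj (u s)) xi).
      by apply: eq_Cintegral => s /(sub t s tT) sT; rewrite -(hpn N s sT).
    by rewrite E mul1r.
  + by move: h2 h3; apply: filterS2 => xi -> ->.
  + by apply: filterS (hn t tT) => xi E; exact: (etrans E (sol_fix false xi tT)).
- apply: (@cvg_Hminus_duh R d T t (Cc * (4 * A * (4 * A))) (Cc * (8 * (4 * A) * (4 * A)))
    1 dkernel (fun N => rhs_dtn N (hat (Hkl_of phi psi chi).1.2) (hat (Hkl_of phi psi chi).2) u) (cN false) (zsource false Z) (dtn t)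
    (lin_dt t)
    (fun xi => (W0 t xi)%:C%C * hat (Hkl_of phi psi chi).2 xi +
      (W1 t xi * - sqnorm xi)%:C%C * hat (Hkl_of phi psi chi).1.2 xi)) => //.
  + by rewrite ComplexField.Normc.normc1.
  + exact: kernel_W0_sqnorm.
  + exact: jmeas_zsource.
  + by move=> s sT; exact: wbounded1_zsource.
  + by move=> N s sT; exact: bcN.
  + by move=> N s sT; exact: dcN.
  + apply: cmeasD; apply: cmeasM; try exact: cmeas_hat.
      by have [mK _ _] := @kernel_W0 R d T T0; exact: (jmeas_slice t mK).
    by have [mK _ _] := @kernel_W1_sqnorm R d T T0; exact: (jmeas_slice t mK).
  + exact: cmeas_hat.
  + move=> N xi.
    have E : duh dkernel (cN false N) t xi = time_int t (fun s =>
        (W0 (t - s) xi * - sqnorm xi)%:C%C * hatprod N (u s) (hatconj (u s)) xi).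
      by apply: eq_Cintegral => s /(sub t s tT) sT; rewrite -(hpn N s sT).
    by rewrite E mul1r.
  + by move: h2 h3; apply: filterS2 => xi -> ->.
  + by apply: filterS (hd t tT) => xi E; rewrite mul1r; exact: E.
Qed.
End Solution.

(** * Homogeneity of the linear and quadratic terms *)

Section Scaling.
Context {R : realType} {d : nat}.
Local Notation leb := (@lebesgue_Rn R d).
Local Notation cabs := (@ComplexField.Normc.normc R).
Variable T : R.
Hypothesis T0 : 0 <= T.
Implicit Types (xi : @Rn R d) (Y : bool -> R -> @cfun R d) (b : bool) (f g : @cfun R d) (a : R).

Definition cscale a f : @cfun R d := fun xi => a%:C%C * f xi.

Lemma cscaleE a f : cscale a f = a *: f.
Proof.
apply/funext => xi; rewrite -[RHS]/(a *: (f xi)) /cscale; case: (f xi) => x y.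
by congr Complex; rewrite ?mul0r ?subr0 ?addr0.
Qed.

Lemma hatconj_cscale a f : hatconj (cscale a f) = cscale a (hatconj f).
Proof. by apply/funext => xi; rewrite /hatconj /cscale conjcM_eq /= oppr0. Qed.

Lemma conv_cscale a (A : R) e f g : 0 <= e -> 0 <= A -> cmeas f -> cmeas g ->
  wbounded e A f -> wbounded e A g ->
  conv (cscale a f) (cscale a g) = cscale (a ^+ 2) (conv f g).
Proof.
move=> e0 A0 mf mg bf bg; apply/funext => xi.
have AA : 0 <= A * A by exact: mulr_ge0.
have [iF _] := conv_integrand_bound (xi := xi) e0 AA
  (cmeas_conv_integrand xi mf mg) (wbounded_mul xi A0 A0 bf bg).
rewrite /cscale /conv mulrCA -(CintegralZ _ measurableT iF); congr (_ * _).
apply: eq_Cintegral => eta _; rewrite expr2 rmorphM; ring.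
Qed.

(** The scalar is real, so that the conjugation in |u|^2 leaves it unchanged and both sources scale
    by its square. *)
Lemma zsource_cscale a (A : R) b Y s : 0 <= A -> 0 <= s <= T -> state T A Y ->
  zsource b (fun b t => cscale a (Y b t)) s = cscale (a ^+ 2) (zsource b Y s).
Proof.
move=> A0 sT [mY bY]; have [s0 sT'] := andP sT.
have e0 : 0 <= T + 2 - s by lra.
case: b; rewrite /zsource ?hatconj_cscale.
  by apply: (conv_cscale a e0 A0) => //; [exact: jmeas_slice..|exact: bY|exact: bY].
apply: (conv_cscale a e0 A0) => //.
- exact: jmeas_slice.
- by apply: cmeas_hatconj; exact: jmeas_slice.
- exact: bY.
- by apply: wbounded_hatconj; exact: bY.
Qed.

Lemma duh_zsource_cscale a (A : R) K b Y t : 0 <= A -> 0 <= t <= T -> state T A Y ->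
  evol_kernel T K ->
  duh K (zsource b (fun b t => cscale a (Y b t))) t =
  cscale (a ^+ 2) (duh K (zsource b Y) t).
Proof.
move=> A0 tT sY kK; have [mY _] := sY; apply/funext => xi.
have iF := cintegrable_duh xi tT kK (jmeas_zsource b mY)
  (fun s sT => wbounded1_zsource b A0 sT sY).
rewrite /cscale /duh /time_int -(@CintegralZ R _ (measurableTypeR R)
  (@lebesgue_measure R) _ _ _ (measurable_itv _) iF).
have [t0 tT'] := andP tT.
apply: eq_Cintegral => s /=; rewrite in_itv/= => /andP[s0 st].
rewrite (@zsource_cscale a A)//; last by rewrite s0 (le_trans st).
by rewrite /cscale mulrCA.
Qed.

Lemma zduh_cscale a (A : R) b Y t : 0 <= A -> 0 <= t <= T -> state T A Y ->
  zduh b (fun b t => cscale a (Y b t)) t = cscale (a ^+ 2) (zduh b Y t).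
Proof.
move=> A0 tT sY; apply/funext => xi; rewrite /zduh.
rewrite (duh_zsource_cscale a b A0 tT sY (evol_kernel_zkernel T0 b)).
by rewrite /cscale mulrCA.
Qed.

Lemma lin_cscale a f g h b t : lin (cscale a f) (cscale a g) (cscale a h) b t =
  cscale a (lin f g h b t).
Proof.
apply/funext => xi; rewrite /lin /cscale; case: b; first by rewrite mulrCA.
by rewrite mulrDr !(mulrCA a%:C%C).
Qed.

Lemma lin_dt_cscale a g h t : lin_dt (cscale a g) (cscale a h) t = cscale a (lin_dt g h t).
Proof. by apply/funext => xi; rewrite /lin_dt /cscale mulrDr !(mulrCA a%:C%C). Qed.

Lemma nice_data_cscale a M f g h : 0 <= M -> nice_data T M f g h ->
  nice_data T (`|a| * M) (cscale a f) (cscale a g) (cscale a h).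
Proof.
move=> M0 [[m1 m2 m3] [[b1 b2 b3] [r1 r2]]].
have mm (e : @cfun R d) : cmeas e -> cmeas (cscale a e).
  by move=> me; apply: cmeasM => //; exact: cmeas_cst.
have bb (e : @cfun R d) : wbounded (T + 2) M e -> wbounded (T + 2) (`|a| * M) (cscale a e).
  by move=> be xi; rewrite ComplexField.Normc.normcM cabs_real -mulrA ler_wpM2l.
have rr (e : @cfun R d) : hreal e -> hreal (cscale a e).
  by move=> re xi; rewrite /cscale re conjcM_eq /= oppr0.
split; first by split; exact: mm.
by split; [split; exact: bb|split; exact: rr].
Qed.
End Scaling.

(** * Second-order expansion of the solution along a ray *)

Section Expansion.
Context {R : realType} {d : nat}.
Local Notation leb := (@lebesgue_Rn R d).
Local Notation cabs := (@ComplexField.Normc.normc R).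
Local Notation Cc := (@conv_const R d).
Variables (T M k l : R) (phi psi chi : @cfun R d).
Hypotheses (T0 : 0 <= T) (M0 : 0 <= M) (data : nice_data T M phi psi chi).
Implicit Types (xi : @Rn R d) (b : bool) (f g h : @cfun R d) (delta : R).

Lemma Hkl_norm_le f g h : `|Hkl_of k l f g h| <=
  `|sob_of false k f| + `|sob_of true l g| + `|sob_of true (l - 1) h|.
Proof.
rewrite -[leLHS]/(Hkl_norm _) /Hkl_norm /=.
move: (normr_ge0 (sob_of false k f)) (normr_ge0 (sob_of true l g)) (normr_ge0 (sob_of true (l - 1) h)).
move: `|sob_of false k f| `|sob_of true l g| `|sob_of true (l - 1) h| => x y z x0 y0 z0.
rewrite -(ger0_norm (addr_ge0 (addr_ge0 x0 y0) z0)) -sqrtr_sqr ler_wsqrtr//.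
nra.
Qed.

Definition sob3_pred f g h : Prop := [/\ f \in @sob_pred R d false k,
  g \in @sob_pred R d true l & h \in @sob_pred R d true (l - 1)].

Lemma Hkl_of_lin (a : R) f g h f' g' h' : sob3_pred f g h -> sob3_pred f' g' h' ->
  Hkl_of k l (a *: f + f') (a *: g + g') (a *: h + h') =
  a *: Hkl_of k l f g h + Hkl_of k l f' g' h'.
Proof.
by move=> [p1 p2 p3] [q1 q2 q3]; rewrite /Hkl_of !sob_of_lin.
Qed.

Lemma Hkl_of_cscale (a : R) f g h : sob3_pred f g h ->
  Hkl_of k l (cscale a f) (cscale a g) (cscale a h) = a *: Hkl_of k l f g h.
Proof. by move=> [p1 p2 p3]; rewrite !cscaleE /Hkl_of !sob_ofZ. Qed.

Lemma Hkl_ofB f g h f' g' h' : sob3_pred f g h -> sob3_pred f' g' h' ->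
  Hkl_of k l (f - f') (g - g') (h - h') = Hkl_of k l f g h - Hkl_of k l f' g' h'.
Proof. by move=> [p1 p2 p3] [q1 q2 q3]; rewrite /Hkl_of !sob_ofB. Qed.

Lemma sob3_pred_cscale (a : R) f g h : sob3_pred f g h ->
  sob3_pred (cscale a f) (cscale a g) (cscale a h).
Proof. by move=> [p1 p2 p3]; rewrite !cscaleE; split; exact: rpredZ. Qed.

Lemma sob3_predD f g h f' g' h' : sob3_pred f g h -> sob3_pred f' g' h' ->
  sob3_pred (f + f') (g + g') (h + h').
Proof. by move=> [p1 p2 p3] [q1 q2 q3]; split; exact: rpredD. Qed.

Definition linear_part t : Hkl d k l :=
  Hkl_of k l (lin phi psi chi true t) (lin phi psi chi false t) (lin_dt psi chi t).

(** The Duhamel integrals evaluated on the free evolution, that is, the quadratic term Q of the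
    second Picard iterate. *)
Definition quadratic_part t : Hkl d k l :=
  Hkl_of k l (zduh true (lin phi psi chi) t) (zduh false (lin phi psi chi) t)
    (dduh (lin phi psi chi) t).

Definition scaled_sol delta t : Hkl d k l :=
  sol T (cscale delta phi) (cscale delta psi) (cscale delta chi) k l t.

(** The radius [A] of the iteration is proportional to |delta|, so the cubes of [A] in the
    remainders of the iteration become |delta|^3. The constants may depend on the datum, because
    only one ray is considered at a time. *)
Lemma sol_expansion t : 0 <= t <= T ->
  exists K delta0 : R, 0 < delta0 /\ forall delta, `|delta| < delta0 ->
    local_solution T (delta *: Hkl_of k l phi psi chi) (scaled_sol delta) /\
    `|scaled_sol delta t - (delta *: linear_part t + delta ^+ 2 *: quadratic_part t)|
      <= K * `|delta| ^+ 3.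
Proof.
move=> tT; have [t0 tT'] := andP tT.
have TM : 0 <= (1 + T) * M by ge0.
have [K1 K10 hK1] := @sob_of_norm_le R d false k.
have [K2 K20 hK2] := @sob_of_norm_le R d true l.
have [K3 K30 hK3] := @sob_of_norm_le R d true (l - 1).
have C0 := @conv_const_ge0 R d.
pose A1 : R := 2 * ((1 + T) * M).
have A10 : 0 <= A1 by rewrite /A1; ge0.
have S0 : 0 <= 32 * Cc * A1 by ge0.
pose E1 : R := 512 * Cc ^+ 2 * A1 ^+ 3.
pose E3 : R := 2 * (T * (1 + T) * (256 * Cc ^+ 2 * A1 ^+ 3) * 216).
have E10 : 0 <= E1 by rewrite /E1; ge0.
have E30 : 0 <= E3 by rewrite /E3; ge0.
(* The added 1 keeps the inverse meaningful when the datum, and with it [A1], vanishes. *)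
exists (K1 * E1 + K2 * E1 + K3 * E3), (32 * Cc * A1 + 1)^-1; split.
  by rewrite invr_gt0 ltr_wpDl.
move=> delta hdelta.
have sm : `|delta| * (32 * Cc * A1) <= 1.
  have S1 : 0 < 32 * Cc * A1 + 1 by rewrite ltr_wpDl.
  move: hdelta; rewrite -[_^-1]mul1r ltr_pdivlMr// mulrDr mulr1.
  by have := normr_ge0 delta; lra.
have dd := nice_data_cscale delta M0 data.
have M'0 : 0 <= `|delta| * M by ge0.
pose A : R := 2 * ((1 + T) * (`|delta| * M)).
have AE : A = `|delta| * A1 by rewrite /A /A1; ring.
have A0 : 0 <= A by rewrite AE; ge0.
have small : 32 * Cc * A <= 1.
  by apply: le_trans sm; rewrite AE le_eqVlt; apply/orP; left; apply/eqP; ring.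
have [pphi _ _] := data_sob_pred T0 M0 data k.
have [_ ppsi _] := data_sob_pred T0 M0 data l.
have [_ _ pchi] := data_sob_pred T0 M0 data (l - 1).
split.
  rewrite -Hkl_of_cscale; last by split.
  exact: (sol_local_solution T0 M'0 dd small k l).
pose L b t := lin (cscale delta phi) (cscale delta psi) (cscale delta chi) b t.
pose Z := picard_sol T L 1.
have sZ : state T (4 * A) Z := sol_state T0 M'0 dd small.
have sLin := state_lin T0 M0 data.
have LE b s : L b s = cscale delta (lin phi psi chi b s) by exact: lin_cscale.
have LF : L = fun b s => cscale delta (lin phi psi chi b s).
  by apply/funext => b; apply/funext => s; exact: LE.
have sLA : state T (A / 2) L by rewrite /A mulrC mulKf//; exact: (state_lin T0 M'0 dd).
have small1 : `|1| * (32 * Cc * A) <= 1 :> R by rewrite normr1 mul1r.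
have zE b : zduh b L t = cscale (delta ^+ 2) (zduh b (lin phi psi chi) t).
  by rewrite LF; exact: (zduh_cscale T0 delta b TM tT sLin).
have [c1 c10 C1] := curve_lin T0 M0 data true.
have [c2 c20 C2] := curve_lin T0 M0 data false.
have [c3 c30 C3] := curve_lin_dt T0 M0 data.
have [d1 d10 D1] := curve_zduh T0 true TM sLin.
have [d2 d20 D2] := curve_zduh T0 false TM sLin.
have [d3 d30 D3] := curve_dduh T0 TM sLin.
have [e1 e10 F1] := curve_sol T0 M'0 dd small true.
have [e2 e20 F2] := curve_sol T0 M'0 dd small false.
have [e3 e30 F3] := curve_dsol T0 M'0 dd small.
have plin : sob3_pred (lin phi psi chi true t) (lin phi psi chi false t) (lin_dt psi chi t).
  by split; [exact: (curve_sob_pred k c10 C1)|exact: (curve_sob_pred l c20 C2)|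
    exact: (curve_sob_pred (l - 1) c30 C3)].
have pquad : sob3_pred (zduh true (lin phi psi chi) t) (zduh false (lin phi psi chi) t)
    (dduh (lin phi psi chi) t).
  by split; [exact: (curve_sob_pred k d10 D1)|exact: (curve_sob_pred l d20 D2)|
    exact: (curve_sob_pred (l - 1) d30 D3)].
have psol : sob3_pred (Z true t) (Z false t)
    (dsol T (cscale delta phi) (cscale delta psi) (cscale delta chi) t).
  by split; [exact: (curve_sob_pred k e10 F1)|exact: (curve_sob_pred l e20 F2)|
    exact: (curve_sob_pred (l - 1) e30 F3)].
have pquad2 := sob3_pred_cscale (delta ^+ 2) pquad.
rewrite -(Hkl_of_cscale _ pquad) -(Hkl_of_lin delta plin pquad2).
have prhs : sob3_pred
    (delta *: lin phi psi chi true t + cscale (delta ^+ 2) (zduh true (lin phi psi chi) t))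
    (delta *: lin phi psi chi false t + cscale (delta ^+ 2) (zduh false (lin phi psi chi) t))
    (delta *: lin_dt psi chi t + cscale (delta ^+ 2) (dduh (lin phi psi chi) t)).
  by rewrite -!(cscaleE delta); exact: (sob3_predD (sob3_pred_cscale delta plin) pquad2).
rewrite [scaled_sol delta t]/(Hkl_of k l (Z true t) (Z false t)
  (dsol T (cscale delta phi) (cscale delta psi) (cscale delta chi) t)) -(Hkl_ofB psol prhs).
apply: (le_trans (Hkl_norm_le _ _ _)).
have [ps1 ps2 ps3] := psol; have [pr1 pr2 pr3] := prhs.
have d3p : 0 <= `|delta| ^+ 3 by rewrite exprn_ge0.
have zbound b : wbounded 2^-1 (E1 * `|delta| ^+ 3) (Z b t -
    (delta *: lin phi psi chi b t + cscale (delta ^+ 2) (zduh b (lin phi psi chi) t))).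
  move=> xi; rewrite -cscaleE -LE -zE.
  rewrite -[X in cabs X]/(Z b t xi - (L b t xi + zduh b L t xi)) opprD addrA.
  have := picard_second_order T0 A0 sLA small1 b xi tT.
  rewrite mul1r expr1n mul1r -/Z => H; apply: (le_trans H).
  rewrite AE (_ : 512 * _ * _ = E1 * `|delta| ^+ 3); last by rewrite /E1; ring.
  by apply: ler_wpM2l; [ge0|apply: le_weight; lra].
have dbound : wbounded 2^-1 (E3 * `|delta| ^+ 3)
    (dsol T (cscale delta phi) (cscale delta psi) (cscale delta chi) t -
    (delta *: lin_dt psi chi t + cscale (delta ^+ 2) (dduh (lin phi psi chi) t))).
  move=> xi; rewrite -cscaleE -lin_dt_cscale.
  rewrite -(duh_zsource_cscale delta false TM tT sLin (kernel_W0_sqnorm T0)) -LF.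
  rewrite -[X in cabs X]/((lin_dt (cscale delta psi) (cscale delta chi) t xi +
    duh dkernel (zsource false Z) t xi) -
    (lin_dt (cscale delta psi) (cscale delta chi) t xi + duh dkernel (zsource false L) t xi)).
  rewrite opprD addrACA subrr add0r.
  have A40 : 0 <= 4 * A by ge0.
  have sL4 := state_data A0 sLA.
  rewrite (duh_sourceB false xi A40 tT (kernel_W0_sqnorm T0) sZ sL4).
  rewrite (_ : E3 * _ = 2 * (T * (1 + T) * (256 * Cc ^+ 2 * A ^+ 3) * 216)); last first.
    by rewrite AE /E3; ring.
  apply: (wbounded_duh_kernel tT _ (kernel_W0_sqnorm T0)); first ge0.
    by have [mZ _] := sZ; have [mL _] := sLA; apply: jmeasB; exact: jmeas_zsource.
  move=> s sT; have := picard_source_first_order T0 A0 sLA small1 false sT.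
  rewrite normr1 mul1r; apply: wbounded_le.
    by have [? ?] := andP sT; lra.
  by rewrite lexx andbT; ge0.
rewrite 2!mulrDl -(mulrA K1) -(mulrA K2) -(mulrA K3); apply: lerD; first apply: lerD.
- by apply: hK1; [ge0|exact: rpredB|exact: zbound].
- by apply: hK2; [ge0|exact: rpredB|exact: zbound].
- by apply: hK3; [ge0|exact: rpredB|exact: dbound].
Qed.
End Expansion.

Lemma flow_eq {R : realType} {d : nat} (k l T r : R) (Phi : Hkl d k l)
    (V : R -> Hkl d k l) (t : R) :
  locally_well_posed d k l T r -> `|Phi| < r -> local_solution T Phi V ->
  0 <= t <= T -> flow d k l T t Phi = V t.
Proof.
move=> [wp _] Phir solV tT; have [U solU uniq] := wp Phi Phir.
have solG : local_solution T Phi (get (local_solution T Phi)).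
  by apply: getPex; exists V.
by rewrite (uniq V solV t tT) /flow (uniq _ solG t tT).
Qed.

(** * Second derivatives and expansions along rays *)

Section SecondDerivative.
Context {R : realType}.

(** A mean value inequality with values in a normed space. Let s be the supremum of the points at
    which the bound from 0 holds. The local bound at s, used to its left, shows that s is such a
    point; used to its right, it rules out s < D. *)
Lemma local_lipschitz_itv (W : normedModType R) (g : R -> W) (K D : R) :
  0 <= K -> 0 <= D ->
  (forall x, 0 <= x <= D -> exists2 eta : R, 0 < eta &
     forall y, `|y - x| < eta -> `|g y - g x| <= K * `|y - x|) ->
  `|g D - g 0| <= K * D.
Proof.
move=> K0 D0 H.
pose S := [set x : R | 0 <= x <= D /\ `|g x - g 0| <= K * x].
have S0 : S 0 by split; rewrite ?lexx ?D0// subrr normr0 mulr0.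
have hS : has_sup S.
  by split; [exists 0|exists D => x [/andP[_ xD] _]].
have sD : sup S <= D.
  by apply: ge_sup; [exists 0|move=> x [/andP[_ xD] _]].
have s0 : 0 <= sup S by exact: (sup_upper_bound hS).
have [|eta eta0 He] := H (sup S); first by rewrite s0.
have Ss : S (sup S).
  have [x Sx xs] := sup_adherent eta0 hS; have [/andP[x0 xD] gx] := Sx.
  have xs' : x <= sup S by exact: (sup_upper_bound hS).
  split; first by rewrite s0.
  have h1 : `|g x - g (sup S)| <= K * `|x - sup S|.
    by apply: He; rewrite distrC ger0_norm ?subr_ge0//; lra.
  rewrite distrC in h1.
  rewrite (_ : g (sup S) - g 0 = (g (sup S) - g x) + (g x - g 0)); last by rewrite addrA subrK.
  apply: (le_trans (ler_normD _ _)); apply: (le_trans (lerD h1 gx)).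
  by rewrite distrC ger0_norm ?subr_ge0// -mulrDr subrK.
have [sltD|] := ltP (sup S) D; last first.
  by move=> Ds; have <- : sup S = D by [apply/eqP; rewrite eq_le sD]; case: Ss.
pose y := Num.min D (sup S + eta / 2).
have ys : sup S < y by rewrite /y lt_min sltD ltrDl divr_gt0.
have yD : y <= D by rewrite /y ge_min lexx.
have ye : y <= sup S + eta / 2 by rewrite /y ge_min lexx orbT.
have Sy : S y.
  split; first by rewrite yD andbT (le_trans s0)// ltW.
  have h1 : `|g y - g (sup S)| <= K * `|y - sup S|.
    by apply: He; rewrite ger0_norm ?subr_ge0 ?(ltW ys)//; lra.
  rewrite (_ : g y - g 0 = (g y - g (sup S)) + (g (sup S) - g 0)); last by rewrite addrA subrK.
  apply: (le_trans (ler_normD _ _)); apply: (le_trans (lerD h1 Ss.2)).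
  by rewrite ger0_norm ?subr_ge0 ?(ltW ys)// -mulrDr subrK.
by have := sup_upper_bound hS Sy; rewrite leNgt ys.
Qed.

Lemma differentiable_eps (V W : normedModType R) (f : V -> W) (x : V) (e : R) :
  differentiable f x -> 0 < e -> exists2 eta : R, 0 < eta &
  forall h, `|h| < eta -> `|f (h + x) - f x - 'd f x h| <= e * `|h|.
Proof.
move=> /diff_locallyP[_ /eqaddoP H] e0; have /nbhs_normP[eta /= eta0 He] := H e e0.
exists eta => // h hh; have := He h; rewrite /ball_ /= sub0r normrN => /(_ hh).
by rewrite opprD addrA.
Qed.

Lemma le0_of_le_small (x Q d : R) : 0 < d ->
  (forall e, 0 < e < d -> x <= e * Q) -> x <= 0.
Proof.
move=> d0 H; rewrite leNgt; apply/negP => x0.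
have Q0 : 0 < Q.
  have := H (d / 2) _; rewrite divr_gt0//= ltr_pdivrMr// ltr_pMr// ltr1n => /(_ isT) h.
  have : 0 < d / 2 * Q by exact: lt_le_trans h.
  by rewrite pmulr_rgt0// divr_gt0.
pose e := Num.min (d / 2) (x / (2 * Q)).
have e0 : 0 < e by rewrite /e lt_min !divr_gt0// mulr_gt0.
have ed : e < d by rewrite /e gt_min ltr_pdivrMr// ltr_pMr// ltr1n.
have ex : e <= x / (2 * Q) by rewrite /e ge_min lexx orbT.
have := H e; rewrite e0 ed => /(_ isT) h.
have : x <= x / (2 * Q) * Q by apply: (le_trans h); rewrite ler_wpM2r// ltW.
by rewrite (_ : x / (2 * Q) * Q = x / 2); [lra|field; exact: lt0r_neq0].
Qed.

(** Here u and v stand for the values of f at y Phi and x Phi, E and D for its derivatives along Phi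
    at x Phi and 0. On the right are the first-order error of f at x Phi, the first-order error of
    the derivative of f at 0, and a term quadratic in y - x. *)
Lemma quadratic_remainder (W : lmodType R) (u v E D b : W) (x y : R) :
  (u - y *: D - y ^+ 2 *: b) - (v - x *: D - x ^+ 2 *: b) =
  (u - v - (y - x) *: E) + (y - x) *: (E - D - x *: (2 *: b)) - (y - x) ^+ 2 *: b.
Proof.
transitivity ((u - v + (x - y) *: D) + (x ^+ 2 - y ^+ 2) *: b).
  rewrite !opprD !opprK addrACA (addrACA u) !scalerBl.
  by rewrite (addrC (- (y *: D))) (addrC (- (y ^+ 2 *: b))).
rewrite !scalerBr !scalerA addrA addrA subrK.
rewrite -(scaleNr (y - x) D) -(scaleNr ((y - x) * x * 2) b) -(scaleNr ((y - x) ^+ 2) b).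
rewrite -[RHS]addrA -scalerDl opprB.
by rewrite [in LHS](_ : x ^+ 2 - y ^+ 2 = - ((y - x) * x * 2) - (y - x) ^+ 2); last by ring.
Qed.

(* The second derivative at 0 along Phi of a function with a second-order
   expansion is 2 b, whence the bound. *)
Lemma twice_differentiable_quadratic (V W : normedModType R) (f : V -> W) :
  twice_differentiable f 0 -> exists C : R, forall (Phi : V) (a b : W) (K d : R),
    0 < d ->
    (forall e, `|e| < d -> `|f (e *: Phi) - (e *: a + e ^+ 2 *: b)| <= K * `|e| ^+ 3) ->
    `|b| <= C * `|Phi| ^+ 2.
Proof.
move=> [df [B [[C hC] hB]]].
have /nbhs_normP[eta1 /= eta10 He1] := df.
have /nbhs_normP[eta2 /= eta20 He2] := hB 1 ltr01.
exists (C / 2 + 1) => Phi a b K d d0 exp.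
set D := 'd f 0 Phi; pose b' := 2^-1 *: B Phi Phi.
pose P := `|Phi|.
have P0 : 0 <= P by exact: normr_ge0.
have f0 : f 0 = 0.
  have := exp 0; rewrite normr0 => /(_ d0).
  rewrite !scale0r !expr0n /= scale0r addr0 subr0 mulr0 normr_le0 => /eqP.
  by [].
have b'C : `|b'| <= C / 2 * P ^+ 2.
  rewrite normrZ ger0_norm ?invr_ge0// [leRHS](_ : _ = 2^-1 * (C * P * P)); last by ring.
  by rewrite ler_wpM2l ?invr_ge0//; exact: hC.
pose g (x : R) := f (x *: Phi) - x *: D - x ^+ 2 *: b'.
pose eta := Num.min eta1 eta2.
have eta0 : 0 < eta by rewrite /eta lt_min eta10.
pose d1 := Num.min d (eta / (P + 1)).
have d10 : 0 < d1 by rewrite /d1 lt_min d0 divr_gt0// ltr_wpDl.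
have small e x : 0 < e < d1 -> 0 <= x <= e -> `|x *: Phi| < eta.
  move=> /andP[e0 ed] /andP[x0 xe]; rewrite normrZ ger0_norm//.
  have : x < eta / (P + 1).
    by apply: (le_lt_trans xe); apply: (lt_le_trans ed); rewrite /d1 ge_min lexx orbT.
  rewrite ltr_pdivlMr ?ltr_wpDl// mulrDr mulr1 -/P; lra.
have mv e eps : 0 < e < d1 -> 0 < eps -> `|g e - g 0| <= (e * P ^+ 2 + eps) * e.
  move=> he eps0; have /andP[e0 ed] := he.
  apply: local_lipschitz_itv; rewrite ?(ltW e0)//.
    by rewrite addr_ge0 ?(ltW eps0)// mulr_ge0 ?exprn_ge0// ltW.
  move=> x xe; have /andP[x0 xe'] := xe.
  have xs := small e x he xe.
  have dfx : differentiable f (x *: Phi).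
    apply: He1; rewrite /ball_ /= sub0r normrN; apply: (lt_le_trans xs).
    by rewrite /eta ge_min lexx.
  have hBx := He2 (x *: Phi); rewrite /ball_ /= sub0r normrN in hBx.
  have {}hBx : `|'d f (x *: Phi) Phi - D - x *: B Phi Phi| <= x * P ^+ 2.
    have h : `|x *: Phi| < eta2 by apply: (lt_le_trans xs); rewrite /eta ge_min lexx orbT.
    have := hBx h Phi; rewrite add0r linearZl_LR mul1r normrZ (ger0_norm x0).
    by rewrite -mulrA -expr2.
  have P1 : 0 < 2 * (P + 1) by rewrite mulr_gt0// ltr_wpDl.
  have eP : 0 < eps / (2 * (P + 1)) by rewrite divr_gt0.
  have [eta3 eta30 He3] := differentiable_eps dfx eP.
  have b'1 : 0 < 2 * (`|b'| + 1) by rewrite mulr_gt0// ltr_wpDl.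
  exists (Num.min (eta3 / (P + 1)) (eps / (2 * (`|b'| + 1)))).
    by rewrite lt_min !divr_gt0// ltr_wpDl.
  move=> y; rewrite lt_min => /andP[y1 y2].
  have -> : g y - g x = (f (y *: Phi) - f (x *: Phi) - (y - x) *: 'd f (x *: Phi) Phi) +
      (y - x) *: ('d f (x *: Phi) Phi - D - x *: B Phi Phi) - (y - x) ^+ 2 *: b'.
    have -> : B Phi Phi = 2 *: b' by rewrite /b' scalerA divff// scale1r.
    exact: quadratic_remainder.
  have hh : `|(y - x) *: Phi| < eta3.
    rewrite normrZ; move: y1; rewrite ltr_pdivlMr ?ltr_wpDl// mulrDr mulr1.
    by have := normr_ge0 (y - x); rewrite -/P; lra.
  have := He3 _ hh; rewrite -scalerDl subrK linearZ /= => h1.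
  have h1' : `|f (y *: Phi) - f (x *: Phi) - (y - x) *: 'd f (x *: Phi) Phi| <= eps / 2 * `|y - x|.
    apply: (le_trans h1); rewrite normrZ -/P.
    rewrite mulrCA mulrC ler_wpM2r// -mulrA ler_wpM2l ?(ltW eps0)//.
    rewrite invfM -mulrA ler_piMr ?invr_ge0// mulrC ler_pdivrMr ?ltr_wpDl// mul1r lerDl//.
  have h3 : `|(y - x) ^+ 2 *: b'| <= eps / 2 * `|y - x|.
    rewrite normrZ normrX expr2 -mulrA mulrC ler_wpM2r//.
    move: y2; rewrite ltr_pdivlMr// => y2.
    have := normr_ge0 (y - x); have := normr_ge0 b'; nra.
  have h2 : `|(y - x) *: ('d f (x *: Phi) Phi - D - x *: B Phi Phi)| <= e * P ^+ 2 * `|y - x|.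
    rewrite normrZ mulrC ler_wpM2r//; apply: (le_trans hBx).
    by rewrite ler_wpM2r// exprn_ge0.
  apply: (le_trans (ler_normB _ _)); apply: (le_trans (lerD (ler_normD _ _) (lexx _))).
  by rewrite !mulrDl; move: h1' h2 h3; lra.
have main e eps : 0 < e < d1 -> 0 < eps ->
    `|e *: (a - D) + e ^+ 2 *: (b - b')| <= e ^+ 2 * (P ^+ 2 + eps) + K * e ^+ 3.
  move=> he eps0; have /andP[e0 ed] := he.
  have h1 := mv e (e * eps) he (mulr_gt0 e0 eps0).
  have h2 := exp e; rewrite (gtr0_norm e0) in h2.
  have {}h2 := h2 (lt_le_trans ed (_ : d1 <= d)).
  have {}h2 : `|f (e *: Phi) - (e *: a + e ^+ 2 *: b)| <= K * e ^+ 3.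
    by apply: h2; rewrite /d1 ge_min lexx.
  have g0 : g 0 = 0 by rewrite /g !scale0r f0 expr0n /= scale0r !subr0.
  rewrite g0 subr0 in h1.
  rewrite (_ : e *: (a - D) + _ = g e - (f (e *: Phi) - (e *: a + e ^+ 2 *: b))); last first.
    rewrite /g !scalerBr; move: (f _) (e *: a) (e *: D) (_ *: b) (_ *: b') => F p q u v.
    by rewrite opprB [RHS]addrC !addrA subrK (addrAC p u).
  apply: (le_trans (ler_normB _ _)); apply: (le_trans (lerD h1 h2)).
  by rewrite lerD2r le_eqVlt; apply/orP; left; apply/eqP; ring.
(* Dividing by e and letting e tend to 0 identifies the terms of first order; dividing by e^2 then
   bounds the difference of those of second order. *)
have aD : a = D.
  apply/eqP; rewrite -subr_eq0 -normr_le0.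
  apply: (@le0_of_le_small _ (P ^+ 2 + 1 + `|K| * d1 + `|b - b'|) _ d10) => e he.
  have /andP[e0 ed] := he.
  have h := main e 1 he ltr01.
  rewrite -(ler_pM2l e0) -[e in leLHS](gtr0_norm e0) -normrZ.
  rewrite (_ : e *: (a - D) = (e *: (a - D) + e ^+ 2 *: (b - b')) - e ^+ 2 *: (b - b')); last first.
    by rewrite addrK.
  apply: (le_trans (ler_normB _ _)); rewrite normrZ (ger0_norm (exprn_ge0 2 (ltW e0))).
  apply: (le_trans (lerD h (lexx _))).
  have Ke : K * e <= `|K| * d1.
    apply: (@le_trans _ _ (`|K| * e)); first by rewrite ler_wpM2r ?ler_norm// ltW.
    by rewrite ler_wpM2l// ltW.
  rewrite [leLHS](_ : _ = (e * e) * (P ^+ 2 + 1 + K * e + `|b - b'|)); last by ring.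
  rewrite [leRHS]mulrA ler_wpM2l ?mulr_ge0 ?(ltW e0)//.
  by rewrite lerD2r lerD2l.
have bb : `|b - b'| <= P ^+ 2.
  rewrite -subr_le0; apply: (@le0_of_le_small _ (1 + `|K|) _ d10) => e he.
  have /andP[e0 ed] := he.
  have := main e e he e0; rewrite aD subrr scaler0 add0r normrZ.
  rewrite (ger0_norm (exprn_ge0 2 (ltW e0))).
  rewrite [leRHS](_ : _ = e ^+ 2 * (P ^+ 2 + e + K * e)); last by ring.
  rewrite ler_pM2l ?exprn_gt0// => h.
  have : K * e <= `|K| * e by rewrite ler_wpM2r ?ler_norm// ltW.
  rewrite mulrDr mulr1 (mulrC e); lra.
rewrite mulrDl mul1r -(subrK b' b) addrC.
by apply: (le_trans (ler_normD _ _)); apply: lerD.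
Qed.
End SecondDerivative.

(** * Sobolev norms of functions on sets of given measure *)

Section SobolevSquares.
Context {R : realType} {d : nat}.
Local Notation leb := (@lebesgue_Rn R d).
Local Notation cabs := (@ComplexField.Normc.normc R).
Implicit Types (xi : @Rn R d) (f g : @cfun R d) (isreal : bool) (s : R).

Lemma measurable_wabs_pred isreal s f : f \in @sob_pred R d isreal s ->
  measurable_fun setT (wabs s f).
Proof. by rewrite inE => -[mR mI _ _]; exact: measurable_wabs. Qed.

Lemma measurable_sqr_wabs isreal s f : f \in @sob_pred R d isreal s ->
  measurable_fun setT (fun xi => (wabs s f xi ^+ 2)%:E).
Proof.
move=> fP; apply/measurable_EFinP; apply: measurable_funX.
exact: measurable_wabs_pred fP.
Qed.

Lemma sqr_sob_of isreal s f : f \in @sob_pred R d isreal s ->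
  ((`|sob_of isreal s f| ^+ 2)%:E = \int[leb]_xi (wabs s f xi ^+ 2)%:E)%E.
Proof.
move=> fP; rewrite -[X in (X ^+ 2)%:E]/(fine `|sob_of isreal s f|%:E) sob_of_normE//.
set I := (\int[leb]_xi _)%E.
have I0 : (0 <= I)%E by apply: integral_ge0 => xi _; rewrite lee_fin sqr_ge0.
have NI : ('N[leb]_2%:E[EFin \o wabs s f] = I `^ 2^-1)%E.
  rewrite unlock /Lnorm; congr (_ `^ _)%E; apply: eq_integral => xi _ /=.
  by rewrite ger0_norm ?wabs_ge0// powR_mulrn ?wabs_ge0.
have Ify : (I < +oo)%E.
  have : ('N[leb]_2%:E[EFin \o wabs s f] < +oo)%E by move: fP; rewrite inE => -[].
  by rewrite NI => /lty_poweRy; apply; rewrite invr_eq0.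
have If : I \is a fin_num by rewrite ge0_fin_numE.
rewrite NI -(fineK If) poweR_EFin /= -powR_mulrn ?powR_ge0// -powRrM mulVf// powRr1//.
exact: fine_ge0.
Qed.

Lemma sqr_sob_of_le isreal s f (A : set (@Rn R d)) (m v : R) :
  f \in @sob_pred R d isreal s -> measurable A -> 0 <= m ->
  (leb A <= v%:E)%E -> (forall xi, ~ A xi -> f xi = 0) ->
  (forall xi, A xi -> wabs s f xi <= m) -> `|sob_of isreal s f| ^+ 2 <= m ^+ 2 * v.
Proof.
move=> fP mA m0 vA f0 fm; rewrite -lee_fin sqr_sob_of//.
apply: (@le_trans _ _ (\int[leb]_xi (m ^+ 2 * \1_A xi)%:E)%E).
  apply: ge0_le_integral => //.
  - by move=> xi _; rewrite lee_fin sqr_ge0.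
  - exact: measurable_sqr_wabs fP.
  - by apply/measurable_EFinP; exact: measurable_funM.
  - move=> xi _; rewrite lee_fin indicE; have [xA|xA] := boolP (xi \in A).
      by rewrite mulr1 lerXn2r ?nnegrE ?wabs_ge0//; apply: fm; rewrite inE in xA.
    rewrite mulr0 /wabs f0; first by rewrite normr0 mulr0 expr0n.
    by move: xA; rewrite notin_setE.
under eq_integral do rewrite EFinM.
rewrite ge0_integralZl_EFin//.
- by rewrite integral_indic// setIT (EFinM (m ^+ 2) v) lee_wpmul2l// lee_fin sqr_ge0.
- by apply/measurable_EFinP.
- exact: sqr_ge0.
Qed.

(** Stated for two functions because in the second resonance only a sum involving n and its time
    derivative is bounded below pointwise. The factor 2 is that of (x + y)^2 <= 2 (x^2 + y^2). *)
Lemma sqr_sob_of_ge isreal isreal' s s' f g (A : set (@Rn R d)) (m v : R) :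
  f \in @sob_pred R d isreal s -> g \in @sob_pred R d isreal' s' ->
  measurable A -> 0 <= m -> (leb A = v%:E)%E ->
  (forall xi, A xi -> m <= wabs s f xi + wabs s' g xi) ->
  m ^+ 2 * v <= 2 * (`|sob_of isreal s f| ^+ 2 + `|sob_of isreal' s' g| ^+ 2).
Proof.
move=> fP gP mA m0 vA fm; rewrite mulrDr -lee_fin (EFinM (m ^+ 2)) EFinD -vA.
rewrite (EFinM 2) (EFinM 2) !sqr_sob_of//.
have mf := measurable_sqr_wabs fP; have mg := measurable_sqr_wabs gP.
rewrite -!ge0_integralZl_EFin//; try by move=> xi _; rewrite lee_fin sqr_ge0.
rewrite -ge0_integralD//; first last.
- by apply: emeasurable_funM.
- by move=> xi _; rewrite mule_ge0 ?lee_fin ?sqr_ge0.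
- by apply: emeasurable_funM.
- by move=> xi _; rewrite mule_ge0 ?lee_fin ?sqr_ge0.
apply: (@le_trans _ _ (\int[leb]_xi (m ^+ 2 * \1_A xi)%:E)%E).
  under [leRHS]eq_integral do rewrite EFinM.
  rewrite ge0_integralZl_EFin//.
  - by rewrite integral_indic// setIT.
  - by apply/measurable_EFinP.
  - exact: sqr_ge0.
apply: ge0_le_integral => //.
- by move=> xi _; rewrite lee_fin mulr_ge0 ?sqr_ge0.
- by apply/measurable_EFinP; exact: measurable_funM.
- by apply: emeasurable_funD; apply: emeasurable_funM.
- move=> xi _; rewrite -!EFinM -EFinD lee_fin indicE; have [xA|xA] := boolP (xi \in A).
    rewrite mulr1; have := fm xi; rewrite inE in xA => /(_ xA).
    have := wabs_ge0 s f xi; have := wabs_ge0 s' g xi; move: (wabs _ _ _) (wabs _ _ _) => x y.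
    move=> x0 y0 h; apply: (@le_trans _ _ ((y + x) ^+ 2)).
      by rewrite (addrC y) lerXn2r ?nnegrE ?addr_ge0.
    rewrite -subr_ge0 [X in 0 <= X](_ : _ = (x - y) ^+ 2) ?sqr_ge0//; ring.
  by rewrite mulr0 addr_ge0// mulr_ge0// sqr_ge0.
Qed.

Lemma Hkl_component1 (k l : R) (x : Hkl d k l) : `|x.1.1| <= `|x|.
Proof.
rewrite -[leRHS]/(Hkl_norm x) /Hkl_norm -[leLHS](ger0_norm (normr_ge0 _)) -sqrtr_sqr.
by rewrite ler_wsqrtr// -addrA lerDl addr_ge0// sqr_ge0.
Qed.

Lemma Hkl_component2 (k l : R) (x : Hkl d k l) : `|x.1.2| <= `|x|.
Proof.
rewrite -[leRHS]/(Hkl_norm x) /Hkl_norm -[leLHS](ger0_norm (normr_ge0 _)) -sqrtr_sqr.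
by rewrite ler_wsqrtr// (addrC (`|x.1.1| ^+ 2)) -addrA lerDl addr_ge0// sqr_ge0.
Qed.

Lemma Hkl_component3 (k l : R) (x : Hkl d k l) : `|x.2| <= `|x|.
Proof.
rewrite -[leRHS]/(Hkl_norm x) /Hkl_norm -[leLHS](ger0_norm (normr_ge0 _)) -sqrtr_sqr.
by rewrite ler_wsqrtr// lerDr addr_ge0// sqr_ge0.
Qed.

Lemma sqr_Hkl_norm (k l : R) (x : Hkl d k l) :
  `|x| ^+ 2 = `|x.1.1| ^+ 2 + `|x.1.2| ^+ 2 + `|x.2| ^+ 2.
Proof.
by rewrite -[in LHS]/(Hkl_norm x) sqr_sqrtr// !addr_ge0// sqr_ge0.
Qed.
End SobolevSquares.

(** * Boxes in frequency space *)

Section Boxes.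
Context {R : realType} {d : nat}.
Local Notation leb := (@lebesgue_Rn R d).
Variable i0 : 'I_d.
Implicit Types (xi eta : @Rn R d) (a h e : R).

(* The box of center a in the direction i0 with half-width h in this direction
   and e in the others. *)
Definition box a h e : set (@Rn R d) :=
  [set x | `|tnth x i0 - a| <= h /\ forall i, i != i0 -> `|tnth x i| <= e].

Lemma boxE a h e : box a h e = [set x | forall i, `|tnth x i - (if i == i0 then a else 0)| <=
  (if i == i0 then h else e)].
Proof.
apply/seteqP; split=> x /=.
  by move=> [x0 xi] i; case: eqP => [->//|/eqP ni]; rewrite subr0; exact: xi.
move=> H; split; first by have := H i0; rewrite eqxx.
by move=> i ni; have := H i; rewrite (negbTE ni) subr0.
Qed.

Lemma box_volume a h e : 0 <= h -> 0 <= e ->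
  leb (box a h e) = (2 * h * (2 * e) ^+ d.-1)%:E.
Proof.
move=> h0 e0; rewrite boxE lebesgue_Rn_box; last by move=> i; case: ifP.
congr EFin; rewrite (bigD1 i0)//= eqxx; congr (_ * _).
rewrite (eq_bigr (fun=> 2 * e)); last by move=> i ni; rewrite (negbTE ni).
by rewrite prodr_const; congr (_ ^+ _); rewrite cardC1 card_ord.
Qed.

Lemma measurable_box a h e : measurable (box a h e).
Proof.
rewrite boxE (_ : [set x | _] = \bigcap_(i in [set: 'I_d])
   ((fun x : @Rn R d => tnth x i) @^-1` [set x : R | `|x - (if i == i0 then a else 0)| <= (if i == i0 then h else e)])).
  apply: fin_bigcap_measurable => // i _; rewrite -[X in measurable X]setTI.
  apply: (@measurable_tnthR R d i) => //; set c := if _ then a else _; set w := if _ then h else e.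
  rewrite (_ : [set x | _] = `[c - w, c + w]%classic)//.
  by apply/seteqP; split=> x /=; rewrite in_itv/= ler_norml => /andP[? ?];
    apply/andP; split; lra.
by apply/seteqP; split=> x /= H i; [move=> _|]; exact: H.
Qed.

Lemma box_vopp a h e xi : box a h e (vopp xi) <-> box (- a) h e xi.
Proof.
rewrite /box /=; rewrite tnth_mktuple -normrN opprD opprK; split=> -[H1 H2]; split=> // i ni;
  by have := H2 i ni; rewrite tnth_mktuple normrN.
Qed.

Lemma box_vsub a h e a' h' e' xi eta : box a h e xi -> box a' h' e' eta ->
  box (a - a') (h + h') (e + e') (vsub xi eta).
Proof.
move=> [x0 x1] [y0 y1]; rewrite /box /= tnth_mktuple; split.
  rewrite (_ : _ - (a - a') = (tnth xi i0 - a) - (tnth eta i0 - a')); last by ring.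
  by apply: (le_trans (ler_normB _ _)); apply: lerD.
move=> i ni; rewrite tnth_mktuple; apply: (le_trans (ler_normB _ _)).
by apply: lerD; [exact: x1|exact: y1].
Qed.

Lemma pnorm_box a h e xi : 0 <= e -> box a h e xi -> pnorm xi <= 1 + (`|a| + h) + d%:R * e.
Proof.
move=> e0 [x0 x1]; rewrite /pnorm -addrA lerD2l (bigD1 i0)//=; apply: lerD.
  by rewrite -{1}(subrK a (tnth xi i0)) addrC; apply: (le_trans (ler_normD _ _)); rewrite lerD2l.
apply: (@le_trans _ _ (\sum_(i < d | i != i0) e)); first exact: ler_sum.
rewrite sumr_const -[e *+ _]mulr_natl ler_wpM2r// ler_nat.
by rewrite -[X in (_ <= X)%N]card_ord; exact: max_card.
Qed.

(** A displacement h along the axis changes |xi|^2 by about 2 |a| h, which forces a width of order 1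
    / N at frequency N. Across the axis the change is e^2 per coordinate, so a width independent of
    N is allowed. *)
Lemma sqnorm_box a h e xi : 0 <= e -> box a h e xi ->
  `|sqnorm xi - a ^+ 2| <= h * (2 * `|a| + h) + d%:R * e ^+ 2.
Proof.
move=> e0 [x0 x1]; rewrite /sqnorm (bigD1 i0)//= addrAC.
apply: (le_trans (ler_normD _ _)); apply: lerD.
  rewrite (_ : _ - _ = (tnth xi i0 - a) * ((tnth xi i0 - a) + 2 * a)); last by ring.
  rewrite normrM; apply: ler_pM => //; apply: (le_trans (ler_normD _ _)).
  by rewrite addrC normrM ger0_norm// lerD2l.
rewrite ger0_norm; last by rewrite sumr_ge0// => i _; exact: sqr_ge0.
apply: (@le_trans _ _ (\sum_(i < d | i != i0) e ^+ 2)).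
  apply: ler_sum => i ni; rewrite -[X in X <= _]real_normK ?num_real//.
  by rewrite lerXn2r ?nnegrE// x1.
rewrite sumr_const -[_ ^+ 2 *+ _]mulr_natl ler_wpM2r ?sqr_ge0// ler_nat.
by rewrite -[X in (_ <= X)%N]card_ord; exact: max_card.
Qed.

Lemma tnth_le_vnorm xi i : `|tnth xi i| <= vnorm xi.
Proof.
rewrite -sqrtr_sqr ler_wsqrtr// /sqnorm (bigD1 i)//= lerDl.
by rewrite sumr_ge0// => j _; exact: sqr_ge0.
Qed.

Lemma vnorm_le_sum xi : vnorm xi <= \sum_(i < d) `|tnth xi i|.
Proof.
have s0 : 0 <= \sum_(i < d) `|tnth xi i| by rewrite sumr_ge0.
rewrite -(ger0_norm s0) -sqrtr_sqr ler_wsqrtr//.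
rewrite /sqnorm expr2 mulr_suml; apply: ler_sum => i _.
rewrite -[X in X <= _]real_normK ?num_real// expr2 ler_wpM2l//.
by rewrite (bigD1 i)//= lerDl sumr_ge0.
Qed.

Lemma vnorm_box a h e xi : 0 <= a -> 0 <= e -> box a h e xi ->
  `|vnorm xi - a| <= h + d%:R * e.
Proof.
move=> a0 e0 bx; have [x0 x1] := bx; have := tnth_le_vnorm xi i0.
have := vnorm_le_sum xi; have := pnorm_box e0 bx; rewrite /pnorm (ger0_norm a0).
have de : 0 <= d%:R * e by rewrite mulr_ge0.
have := ler_norm (tnth xi i0); move: x0; rewrite ler_norml => /andP[l1 l2].
move=> h1 h2 h3 h4; rewrite ler_norml; apply/andP; split; lra.
Qed.
End Boxes.

(** * The resonant frequencies *)

Section Frequencies.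
Context {R : realType} {d : nat}.
Variables (i0 : 'I_d) (N e : R).
Hypotheses (N1 : 1 <= N) (e0 : 0 < e) (e1 : e <= 1 / 50).
Implicit Types (xi eta x y z : @Rn R d).

Let N0 : 0 < N. Proof. exact: lt_le_trans N1. Qed.

Lemma width_gt0 : 0 < e / N.
Proof. exact: divr_gt0. Qed.

Lemma width_le : e / N <= e.
Proof. by rewrite ler_pdivrMr// ler_peMr// ltW. Qed.

Lemma width_mul_le : e / N * N = e.
Proof. by rewrite divfK// gt_eqF. Qed.

(** The centres contribute nothing, by (N + 1)^2 - N^2 = 2 N + 1. The deviations are O(e) uniformly
    in N because e / N * N = e; with e / N and e at most 1, they add up to at most 21 e + 9 d e, and
    25 is a rounded value. *)
Lemma phase_bound x y z :
  box i0 (N + 1) (2 * (e / N)) (2 * e) x -> box i0 (- N) (2 * (e / N)) (2 * e) y ->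
  box i0 (2 * N + 1) (e / N) e z ->
  `|vnorm z - (sqnorm x - sqnorm y)| <= (25 + 9 * d%:R) * e.
Proof.
move=> bx bye bz.
have e0' := ltW e0; have e20 : 0 <= 2 * e by rewrite mulr_ge0.
have hx := sqnorm_box e20 bx; have hy := sqnorm_box e20 bye.
have a0 : 0 <= 2 * N + 1 by rewrite addr_ge0// mulr_ge0// ltW.
have hz := vnorm_box a0 e0' bz.
rewrite normrN (ger0_norm (ltW N0)) sqrrN in hy.
rewrite (ger0_norm (addr_ge0 (ltW N0) ler01)) in hx.
have w0 := width_gt0; have wl := width_le; have wm := width_mul_le.
rewrite (_ : _ - _ = (vnorm z - (2 * N + 1)) - (sqnorm x - (N + 1) ^+ 2) + (sqnorm y - N ^+ 2)); last by ring.
apply: (le_trans (ler_normD _ _)); apply: (le_trans (lerD (ler_normB _ _) (lexx _))).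
apply: (le_trans (lerD (lerD hz hx) hy)).
have D0 : 0 <= d%:R :> R by exact: ler0n.
move: (d%:R : R) D0 => D D0; move: (e / N) w0 wl wm => w w0 wl wm.
have E1 := e1; have E0 := e0.
have ww : w * w <= e by apply: (@le_trans _ _ (w * 1)); [rewrite ler_wpM2l ?(ltW w0)//; lra|lra].
have De : D * (e * e) <= D * e by rewrite ler_wpM2l// ler_piMl ?(ltW e0)//; lra.
rewrite [leLHS](_ : _ = w * 5 + 8 * (w * N) + 8 * (w * w) + D * e + 8 * (D * (e * e))); last by ring.
rewrite [leRHS](_ : _ = 25 * e + 9 * (D * e)) ?wm; last by ring.
lra.
Qed.

(** From <xi> <= 1 + |xi| <= N + 4 N + d N on the boxes; the same constant covers the lower bound
    <xi> >= N / 2. *)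
Definition japan_ratio : R := 5 + d%:R.

Lemma japan_box a h eps xi : N / 2 <= `|a| - h -> `|a| + h <= 4 * N -> 0 <= eps <= 1 ->
  box i0 a h eps xi -> N / japan_ratio <= japan xi <= japan_ratio * N /\ N / 2 <= vnorm xi.
Proof.
move=> ha ha' /andP[eps0 eps1] bx; have [x0 _] := bx.
have D0 : 0 <= d%:R :> R by exact: ler0n.
have hv : N / 2 <= vnorm xi.
  apply: (le_trans ha); apply: le_trans (tnth_le_vnorm xi i0).
  rewrite lerBlDr; rewrite -{1}(subrK (tnth xi i0) a).
  by apply: (le_trans (ler_normD _ _)); rewrite addrC lerD2l distrC.
have jv : vnorm xi <= japan xi by rewrite ler_wsqrtr// lerDr.
have jp : japan xi <= 1 + vnorm xi.
  have v0 := vnorm_ge0 xi.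
  rewrite -(ger0_norm (addr_ge0 ler01 v0)) -sqrtr_sqr ler_wsqrtr// -sqr_vnorm.
  by rewrite sqrrD expr1n mul1r -addrA lerD2l lerDr mulrn_wge0.
have pv := vnorm_le_sum xi; have := pnorm_box eps0 bx; rewrite /pnorm => hp.
have N1' := N1; have N0' := N0.
have de : d%:R * eps <= d%:R * N by rewrite ler_wpM2l// (le_trans eps1).
split=> //; apply/andP; split.
  apply: (le_trans _ (le_trans hv jv)); rewrite ler_wpM2l ?(ltW N0)//.
  by rewrite lef_pV2 ?posrE// /japan_ratio; lra.
by rewrite /japan_ratio mulrDl; lra.
Qed.

Lemma japan_powR_box s xi : N / japan_ratio <= japan xi <= japan_ratio * N ->
  (japan_ratio `^ `|s|)^-1 * N `^ s <= japan xi `^ s <= japan_ratio `^ `|s| * N `^ s.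
Proof.
move=> /andP[h1 h2]; have j0 := japan_gt0 xi.
have D0 : 0 <= d%:R :> R by exact: ler0n.
have r1 : 1 <= japan_ratio by rewrite /japan_ratio; lra.
have r0 : 0 < japan_ratio by exact: lt_le_trans r1.
have N0' := ltW N0.
have pos p : 0 <= p -> (japan_ratio `^ p)^-1 * N `^ p <= japan xi `^ p <= japan_ratio `^ p * N `^ p.
  move=> p0; have -> : (japan_ratio `^ p)^-1 = (japan_ratio^-1) `^ p.
    by rewrite -!powRN -(powR_inv1 (ltW r0)) -powRrM mulN1r.
  rewrite -!powRM ?invr_ge0 ?(ltW r0)//.
  by rewrite !ge0_ler_powR ?nnegrE ?mulr_ge0 ?invr_ge0 ?(ltW r0) ?(ltW j0)// mulrC.
have [s0|s0] := leP 0 s; first by rewrite ger0_norm//; exact: pos.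
rewrite (ltr0_norm s0).
have p0 : 0 <= - s by rewrite oppr_ge0 ltW.
have /andP[h3 h4] := pos _ p0.
have jp : 0 < japan xi `^ (- s) by rewrite powR_gt0.
have rp : 0 < japan_ratio `^ (- s) by rewrite powR_gt0.
have Np : 0 < N `^ (- s) by rewrite powR_gt0.
have NE (u : R) : u `^ s = (u `^ (- s))^-1 by rewrite -powRN opprK.
rewrite (NE N) (NE (japan xi)); apply/andP; split.
  by rewrite -invfM lef_pV2 ?posrE ?mulr_gt0.
rewrite -[X in _ <= X / _]invrK -invfM lef_pV2 ?posrE ?mulr_gt0 ?invr_gt0//.
Qed.
End Frequencies.

(** * Lower bounds for Duhamel integrals *)

Section Oscillation.
Context {R : realType} {d : nat}.
Local Notation leb := (@lebesgue_Rn R d).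
Local Notation mu := (@lebesgue_measure R).
Local Notation cabs := (@ComplexField.Normc.normc R).
Implicit Types (xi eta : @Rn R d) (x y t s : R) (Y : bool -> R -> @cfun R d).

Definition cis x : R[i] := (cos x +i* sin x)%C.

Lemma cisD x y : cis (x + y) = cis x * cis y.
Proof.
rewrite /cis cosD sinD; apply: complexP; rewrite ?cReM ?cImM //=.
by rewrite addrC mulrC (mulrC (sin x)) addrC (mulrC (sin y)).
Qed.

Lemma cabs_cis x : cabs (cis x) = 1.
Proof. by rewrite /= cos2Dsin2 sqrtr1. Qed.

Lemma conj_cis x : (cis x)^*%C = cis (- x).
Proof. by rewrite /cis cosN sinN. Qed.

Lemma schrod_cis t xi : schrod t xi = cis (- (t * sqnorm xi)).
Proof. by rewrite /cis cosN sinN. Qed.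

Lemma cos_ge_half x : `|x| <= 2^-1 -> 2^-1 <= cos x.
Proof.
move=> hx; have := cosB_le x 0; rewrite cos0 subr0 ler_norml => /andP[h _]; lra.
Qed.

Lemma Re_realM x (z : R[i]) : complex.Re (x%:C%C * z) = x * complex.Re z.
Proof. by rewrite cReM /= mul0r subr0. Qed.

Lemma Re_conv_ge (f g : @cfun R d) xi (w : R[i]) (J : set (@Rn R d)) (m v : R) :
  cintegrable leb setT (fun eta => f (vsub xi eta) * g eta) ->
  measurable J -> leb J = v%:E -> 0 <= m ->
  (forall eta, m * \1_J eta <= complex.Re (w * (f (vsub xi eta) * g eta))) ->
  (2 * pi) `^ (- (d%:R / 2)) * (m * v) <= complex.Re (w * conv f g xi).
Proof.
move=> iF mJ vJ m0 H; rewrite /conv.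
move: ((2 * pi) `^ _) (powR_ge0 (2 * pi) (- (d%:R / 2) : R)) => c c0.
rewrite [X in complex.Re X]mulrCA Re_realM; apply: ler_wpM2l => //.
have [iRe _] := cintegrableZ w measurableT iF.
rewrite -(CintegralZ w measurableT iF) /=.
have IJ : (\int[leb]_x (\1_J x)%:E = v%:E)%E.
  by rewrite -vJ -[in RHS](setIT J); exact: integral_indic.
have iJ : leb.-integrable setT (EFin \o \1_J).
  apply/integrableP; split; first exact/measurable_EFinP.
  under eq_integral do rewrite /= ger0_norm//.
  by rewrite IJ ltry.
have vE : \int[leb]_eta (m * \1_J eta) = m * v.
  by rewrite RintegralZl// /Rintegral IJ.
by rewrite -vE; apply: le_Rintegral => //; exact: integrable_scale.
Qed.

Lemma Re_time_ge t (F : R -> R[i]) (m : R) : 0 <= t ->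
  cintegrable mu `[0, t] F -> (forall s, 0 <= s <= t -> m <= complex.Re (F s)) ->
  t * m <= complex.Re (time_int t F).
Proof.
move=> t0 [iF _] H; rewrite /=.
have mE : \int[mu]_(s in `[0, t]) (cst m s) = t * m.
  rewrite (_ : Rintegral _ _ _ = m * fine (mu `[0, t]%classic)); last exact: Rintegral_cst.
  rewrite lebesgue_measure_itv/= lte_fin mulrC.
  move: t0; rewrite le_eqVlt => /predU1P[<-|->]; first by rewrite ltxx !mul0r.
  by rewrite -EFinB /= subr0.
by rewrite -mE; apply: le_Rintegral => //; exact: integrable_cst_itv.
Qed.

(** A lower bound on the real part of the integrand, pointwise in s and eta, is integrated over [J]
    and over [0, t]. Two kernels with complex coefficients are allowed, so that n and its time
    derivative can be recombined into a half wave. *)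
Lemma duh_pair_ge T (A : R) (K1 K2 : R -> @Rn R d -> R[i]) (z1 z2 : R[i]) b Y t xi
    (J : set (@Rn R d)) (m v : R) :
  0 <= T -> 0 <= A -> 0 <= t <= T -> evol_kernel T K1 -> evol_kernel T K2 -> state T A Y ->
  measurable J -> leb J = v%:E -> 0 <= m ->
  (forall s eta, 0 <= s <= t -> m * \1_J eta <=
     complex.Re ((z1 * K1 (t - s) xi + z2 * K2 (t - s) xi) *
       (Y true s (vsub xi eta) * (if b then Y false s else hatconj (Y true s)) eta))) ->
  t * ((2 * pi) `^ (- (d%:R / 2)) * (m * v)) <=
  complex.Re (z1 * duh K1 (zsource b Y) t xi + z2 * duh K2 (zsource b Y) t xi).
Proof.
move=> T0 A0 tT k1 k2 sY mJ vJ m0 H; have [mY bY] := sY; have [t0 tT'] := andP tT.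
have AA : 0 <= A * A by exact: mulr_ge0.
have iF K : evol_kernel T K ->
    cintegrable mu `[0, t] (fun s => K (t - s) xi * zsource b Y s xi).
  move=> kK; exact: (cintegrable_duh xi tT kK (jmeas_zsource b mY)
    (fun s sT => wbounded1_zsource b A0 sT sY)).
have i1 := @cintegrableZ R _ (measurableTypeR R) mu _ z1 _ (measurable_itv _) (iF _ k1).
have i2 := @cintegrableZ R _ (measurableTypeR R) mu _ z2 _ (measurable_itv _) (iF _ k2).
have E : z1 * duh K1 (zsource b Y) t xi + z2 * duh K2 (zsource b Y) t xi =
    time_int t (fun s => z1 * (K1 (t - s) xi * zsource b Y s xi) +
      z2 * (K2 (t - s) xi * zsource b Y s xi)).
  rewrite /duh /time_int.
  rewrite (@CintegralD R _ (measurableTypeR R) mu _ _ _ (measurable_itv _) i1 i2).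
  rewrite (@CintegralZ R _ (measurableTypeR R) mu _ _ _ (measurable_itv _) (iF _ k1)).
  by rewrite (@CintegralZ R _ (measurableTypeR R) mu _ _ _ (measurable_itv _) (iF _ k2)).
rewrite E; apply: Re_time_ge => //.
  have [a1 a2] := i1; have [b1 b2] := i2; split.
    rewrite (_ : _ \o _ = EFin \o (fun s => complex.Re (z1 * (K1 (t - s) xi * zsource b Y s xi)) +
      complex.Re (z2 * (K2 (t - s) xi * zsource b Y s xi)))).
      exact: (@integrable_add R _ (measurableTypeR R)).
    by apply/funext => s /=; rewrite cReD.
  rewrite (_ : _ \o _ = EFin \o (fun s => complex.Im (z1 * (K1 (t - s) xi * zsource b Y s xi)) +
    complex.Im (z2 * (K2 (t - s) xi * zsource b Y s xi)))).
    exact: (@integrable_add R _ (measurableTypeR R)).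
  by apply/funext => s /=; rewrite cImD.
move=> s /andP[s0 st].
rewrite (mulrA z1 (K1 (t - s) xi)) (mulrA z2 (K2 (t - s) xi)) -mulrDl.
have sT : 0 <= s <= T by rewrite s0 (le_trans st).
have a0 : 0 <= T + 2 - s by lra.
apply: (Re_conv_ge _ mJ vJ m0); last first.
  by move=> eta; apply: H; rewrite s0.
pose G : @cfun R d := if b then Y false s else hatconj (Y true s).
have mG : cmeas G.
  by rewrite /G; case: (b); [|apply: cmeas_hatconj]; exact: jmeas_slice.
have bG : wbounded (T + 2 - s) A G.
  by rewrite /G; case: (b); [|apply: wbounded_hatconj]; exact: bY.
have [] // := conv_integrand_bound (xi := xi) a0 AA
  (cmeas_conv_integrand xi (jmeas_slice s (mY true)) mG)
  (wbounded_mul xi A0 A0 (bY true s sT) bG).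
Qed.

(** On the support the weight is at least [m]. The resulting M depends on N for the data below; this
    does no harm, since only their Sobolev norms have to be uniform in N. *)
Lemma wbounded_compact a (B P : R) (f : @cfun R d) : 0 <= a -> 0 <= B ->
  (forall xi, cabs (f xi) <= B) -> (forall xi, P < pnorm xi -> f xi = 0) ->
  exists2 M : R, 0 <= M & wbounded a M f.
Proof.
move=> a0 B0 fB fP; pose m := expR (- a * P) * ((1 + P ^+ 2)^-1) ^+ d.
have P2 : 0 < 1 + P ^+ 2 by rewrite ltr_wpDr// sqr_ge0.
have m0 : 0 < m by rewrite mulr_gt0 ?expR_gt0 ?exprn_gt0 ?invr_gt0.
exists (B / m); first by rewrite divr_ge0// ltW.
move=> xi; have [Pxi|xiP] := ltP P (pnorm xi).
  by rewrite fP// ComplexField.Normc.normc0 mulr_ge0 ?divr_ge0 ?(ltW m0) ?(ltW (weight_gt0 _ _)).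
have p0 := ltW (pnorm_gt0 xi).
have mw : m <= weight a xi.
  rewrite weightE; apply: ler_pM; rewrite ?expR_ge0 ?exprn_ge0 ?invr_ge0 ?(ltW P2)//.
    by rewrite ler_expR !mulNr lerN2 ler_wpM2l.
  rewrite /weight0 lerXn2r ?nnegrE ?invr_ge0 ?(ltW P2) ?addr_ge0 ?sqnorm_ge0//.
  rewrite lef_pV2 ?posrE// ?ltr_wpDr ?sqnorm_ge0// lerD2l.
  by apply: (le_trans (sqnorm_le_pnorm xi)); rewrite lerXn2r ?nnegrE// (le_trans p0).
by apply: (le_trans (fB xi)); rewrite mulrAC ler_pdivlMr// ler_wpM2l.
Qed.
End Oscillation.

(** * The two families of data and their interactions *)

Section Resonances.
Context {R : realType} {d : nat}.
Variables (i0 : 'I_d) (N e T : R).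
Hypotheses (N1 : 1 <= N) (e0 : 0 < e) (e1 : e <= 1 / 50).
Hypothesis Te : T * ((25 + 9 * d%:R) * e) <= 2^-1.
Implicit Types (xi eta : @Rn R d) (s t alpha beta : R).
Local Notation w := (e / N).

Let N0 : 0 < N. Proof. exact: lt_le_trans N1. Qed.
Let w0 : 0 < w. Proof. exact: width_gt0. Qed.
Let w1 : w <= 1 / 50. Proof. by apply: le_trans e1; exact: width_le. Qed.

Lemma box_le a h h' eps eps' xi : h <= h' -> eps <= eps' ->
  box i0 a h eps xi -> box i0 a h' eps' xi.
Proof.
by move=> hh ee [x0 x1]; split=> [|i ni]; [exact: le_trans hh|apply: le_trans ee; exact: x1].
Qed.

Lemma box_coord a h eps xi : box i0 a h eps xi -> a - h <= tnth xi i0 <= a + h.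
Proof. by move=> [+ _]; rewrite ler_norml => /andP[? ?]; apply/andP; split; lra. Qed.

Lemma tnth_vsub xi eta i : tnth (vsub xi eta) i = tnth xi i - tnth eta i.
Proof. by rewrite tnth_mktuple. Qed.

Lemma tnth_vopp xi i : tnth (vopp xi) i = - tnth xi i.
Proof. by rewrite tnth_mktuple. Qed.

Lemma indic_box (a h eps : R) xi : box i0 a h eps xi -> \1_(box i0 a h eps) xi = 1 :> R.
Proof. by move=> H; rewrite indicE mem_set. Qed.

Lemma indic_boxN (a h eps : R) xi : ~ box i0 a h eps xi -> \1_(box i0 a h eps) xi = 0 :> R.
Proof. by move=> H; rewrite indicE memNset. Qed.

(** [Te] bounds the phase by 1/2 during the whole of [0, T], so there is no cancellation in time. *)
Lemma cos_phase_ge s (x y z : @Rn R d) : 0 <= s <= T ->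
  box i0 (N + 1) (2 * w) (2 * e) x -> box i0 (- N) (2 * w) (2 * e) y ->
  box i0 (2 * N + 1) w e z ->
  2^-1 <= cos (s * (vnorm z - (sqnorm x - sqnorm y))).
Proof.
move=> /andP[s0 sT] bx bb bz; apply: cos_ge_half; rewrite normrM (ger0_norm s0).
apply: le_trans Te; apply: ler_pM => //.
exact: (phase_bound N1 e0 e1 bx bb bz).
Qed.

(** The box has doubled widths so as to contain xi - eta for all xi in the output box and all eta in
    the wave box; the convolution then runs over the entire wave box. *)
Definition phi_case1 alpha : @cfun R d :=
  fun xi => (alpha * \1_(box i0 (- N) (2 * w) (2 * e)) xi)%:C%C.
Local Notation J1 := (box i0 (2 * N + 1) w e).
(** The reflected box makes n real. *)
Definition psi_case1 beta : @cfun R d :=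
  fun xi => (beta * (\1_J1 xi + \1_J1 (vopp xi)))%:C%C.
(* The wave with these data is exp(- i s |xi|) on J1. *)
Definition chi_case1 beta : @cfun R d :=
  fun xi => (0 +i* (- beta * vnorm xi * (\1_J1 xi - \1_J1 (vopp xi))))%C.

Lemma not_J1_vopp xi : J1 xi -> ~ J1 (vopp xi).
Proof.
move=> /box_coord + /box_coord; rewrite tnth_vopp => /andP[h1 _] /andP[h2 _].
have := w1; have := N1; lra.
Qed.

(** The factor [cis (t * sqnorm xi)] removes the phase that does not depend on s, leaving exp(i s
    (|xi|^2 - |xi - eta|^2 - |eta|)). For eta in the reflected box, xi - eta is near 3 N + 2,
    outside the support of [phi_case1]. The summand with coefficient 0 gives the expression the
    two-kernel form of [duh_pair_ge]. *)
Lemma case1_pointwise alpha beta s t xi eta : 0 <= alpha -> 0 <= beta ->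
  0 <= s <= T -> box i0 (N + 1) w e xi ->
  alpha * beta / 2 * \1_J1 eta <=
  complex.Re ((cis (t * sqnorm xi) * schrod (t - s) xi + 0 * schrod (t - s) xi) *
   (lin (phi_case1 alpha) (psi_case1 beta) (chi_case1 beta) true s (vsub xi eta) *
    lin (phi_case1 alpha) (psi_case1 beta) (chi_case1 beta) false s eta)).
Proof.
move=> a0 b0 sT bxi; rewrite mul0r addr0 /lin /psi_case1 /chi_case1.
have [bJ|nJ] := pselect (J1 eta).
  have bI : box i0 (- N) (2 * w) (2 * e) (vsub xi eta).
    have := box_vsub bxi bJ; rewrite (_ : N + 1 - (2 * N + 1) = - N); last by ring.
    by apply: box_le; lra.
  rewrite (indic_box bJ) (indic_boxN (not_J1_vopp bJ)) addr0 subr0 !mulr1 /phi_case1 (indic_box bI) mulr1.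
  have bx : box i0 (N + 1) (2 * w) (2 * e) xi.
    by apply: box_le bxi; have := w0; have := e0; lra.
  have hcos := cos_phase_ge sT bx bI bJ.
  have v0 : vnorm eta != 0.
    have /andP[h _] := box_coord bJ; have := tnth_le_vnorm eta i0.
    have := ler_norm (tnth eta i0); have := w1; have := N1 => *.
    by apply: lt0r_neq0; lra.
  rewrite (_ : (W0 s eta)%:C%C * beta%:C%C + _ = beta%:C%C * cis (- (s * vnorm eta))); last first.
    rewrite /W0 /W1 (negbTE v0) /cis cosN sinN; apply: complexP.
      by rewrite cReD !cReM /=; field.
    by rewrite cImD !cImM /=; field.
  rewrite !schrod_cis.
  rewrite (_ : _ * _ = (alpha * beta)%:C%C *
    cis (s * (sqnorm xi - sqnorm (vsub xi eta) - vnorm eta))); last first.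
    rewrite (_ : s * (_ - _ - _) = t * sqnorm xi + - ((t - s) * sqnorm xi) +
      - (s * sqnorm (vsub xi eta)) + - (s * vnorm eta)); last by ring.
    rewrite !cisD rmorphM /=; ring.
  rewrite Re_realM ler_wpM2l ?mulr_ge0// /cis /=.
  by rewrite -cosN -mulrN opprB.
rewrite (indic_boxN nJ) mulr0.
have [bJ|nJ'] := pselect (J1 (vopp eta)).
  rewrite /phi_case1 indic_boxN; first by rewrite mulr0 mulr0 mul0r mulr0.
  move=> /box_coord; rewrite tnth_vsub => /andP[_ h1].
  move: bJ => /box_coord; rewrite tnth_vopp => /andP[h2 _].
  have /andP[h3 _] := box_coord bxi.
  have := w1; have := N1; lra.
by rewrite (indic_boxN nJ') addr0 subr0 !mulr0 ?addr0 ?mulr0.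
Qed.

Local Notation I2 := (box i0 (N + 1) (2 * w) (2 * e)).
Local Notation Z2 := (box i0 (- N) w e).
(** Only the box at N + 1 is doubled: it has to contain xi - eta for xi near 2 N + 1 and - eta in
    the box at - N. *)
Definition phi_case2 alpha : @cfun R d :=
  fun xi => (alpha * (\1_I2 xi + \1_Z2 xi))%:C%C.
Local Notation J2 := (box i0 N w e).

Lemma J2_vopp eta : J2 eta <-> Z2 (vopp eta).
Proof. by rewrite box_vopp opprK. Qed.

(** With these coefficients the kernels add up to |xi|^2 exp(i t |xi|) (cos - i sin)((t - s) |xi|) =
    |xi|^2 exp(i s |xi|), a single half wave; |xi|^2 >= (N / 2)^2 on the output box. Among the
    products of the two boxes only that of xi - eta near N + 1 and - eta near - N survives: if - eta
    is near N + 1, then xi - eta is near 3 N + 2, where the datum vanishes. *)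
Lemma case2_pointwise alpha s t xi eta : 0 <= alpha ->
  0 <= s <= T -> box i0 (2 * N + 1) w e xi ->
  (N / 2) ^+ 2 * (alpha ^+ 2 / 2) * \1_J2 eta <=
  complex.Re ((- cis (t * vnorm xi) * dkernel (t - s) xi +
      ('i%C * (vnorm xi)%:C%C * cis (t * vnorm xi)) * zkernel false (t - s) xi) *
   (lin (phi_case2 alpha) 0 0 true s (vsub xi eta) *
    hatconj (lin (phi_case2 alpha) 0 0 true s) eta)).
Proof.
move=> a0 sT bxi; rewrite /hatconj /lin.
rewrite [X in complex.Re (X * _)](_ : _ = (sqnorm xi)%:C%C * cis (s * vnorm xi)); last first.
  rewrite /dkernel /zkernel W1_sqnorm -!sqr_vnorm /W0.
  rewrite (_ : s * vnorm xi = t * vnorm xi + - ((t - s) * vnorm xi)); last by ring.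
  rewrite cisD /cis cosN sinN; apply: complexP.
    by rewrite !(cReD, cReM, cImM, cImD) /=; ring.
  by rewrite !(cReD, cReM, cImM, cImD) /=; ring.
have [bJ|nJ] := pselect (J2 eta).
  have bZ := (J2_vopp eta).1 bJ.
  have bI : I2 (vsub xi eta).
    have := box_vsub bxi bJ; rewrite (_ : 2 * N + 1 - N = N + 1); last by ring.
    by apply: box_le; lra.
  have nI : ~ I2 (vopp eta).
    move=> /box_coord; rewrite tnth_vopp => /andP[h _].
    by have /andP[h' _] := box_coord bJ; have := w1; have := N1; lra.
  have nZ : ~ Z2 (vsub xi eta).
    move=> /box_coord /andP[_ h]; have /andP[h' _] := box_coord bI.
    by have := w1; have := N1; lra.
  rewrite (indic_box bJ) mulr1 /phi_case2 (indic_box bI) (indic_boxN nZ) (indic_boxN nI) (indic_box bZ).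
  rewrite addr0 add0r mulr1 !schrod_cis sqnorm_vopp conjcM_eq conj_cis opprK.
  rewrite (_ : (alpha%:C)^*%C = alpha%:C%C); last by rewrite /= oppr0.
  rewrite (_ : _ * _ = (sqnorm xi * alpha ^+ 2)%:C%C *
    cis (s * (vnorm xi - (sqnorm (vsub xi eta) - sqnorm eta)))); last first.
    rewrite (_ : s * (_ - _) = s * vnorm xi + - (s * sqnorm (vsub xi eta)) + s * sqnorm eta); last by ring.
    rewrite !cisD expr2 !rmorphM /=; ring.
  have by' : box i0 (- N) (2 * w) (2 * e) (vopp eta).
    by apply: box_le bZ; have := w0; have := e0; lra.
  have hcos := cos_phase_ge sT bI by' bxi; rewrite sqnorm_vopp in hcos.
  rewrite Re_realM /cis [leLHS]mulrA /=.
  apply: ler_pM; rewrite ?invr_ge0//; first by apply: mulr_ge0; exact: sqr_ge0.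
  apply: ler_wpM2r; first exact: sqr_ge0.
  rewrite -sqr_vnorm lerXn2r ?nnegrE ?vnorm_ge0 ?divr_ge0 ?(ltW N0)//.
  have /andP[h _] := box_coord bxi; have := tnth_le_vnorm xi i0.
  have := ler_norm (tnth xi i0); have := w1; have := N1; lra.
rewrite (indic_boxN nJ) mulr0.
have nZ : ~ Z2 (vopp eta) by move/J2_vopp.
have [bI|nI] := pselect (I2 (vopp eta)); last first.
  have p0 : phi_case2 alpha (vopp eta) = 0.
    by rewrite /phi_case2 (indic_boxN nI) (indic_boxN nZ) addr0 mulr0.
  rewrite p0 mulr0 [X in _ * (_ * X)](_ : _ = 0) ?mulr0//.
  by apply: complexP; rewrite /= ?oppr0.
move: (bI) => /box_coord; rewrite tnth_vopp => /andP[h1 _].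
have /andP[h2 _] := box_coord bxi; have h3 := w1; have h4 := N1.
have p0 : phi_case2 alpha (vsub xi eta) = 0.
  rewrite /phi_case2 !indic_boxN ?addr0 ?mulr0//.
    by move=> /box_coord; rewrite tnth_vsub => /andP[_ h]; lra.
  by move=> /box_coord; rewrite tnth_vsub => /andP[_ h]; lra.
by rewrite p0 mulr0 mul0r mulr0.
Qed.
End Resonances.

(** * Regularity of the data and volume of their supports *)

Section Profiles.
Context {R : realType} {d : nat}.
Local Notation leb := (@lebesgue_Rn R d).
Local Notation cabs := (@ComplexField.Normc.normc R).
Variables (i0 : 'I_d) (N e T : R).
Hypotheses (N1 : 1 <= N) (e0 : 0 < e) (e1 : e <= 1 / 50) (T0 : 0 <= T).
Implicit Types (xi : @Rn R d) (s alpha beta : R).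
Local Notation w := (e / N).
Local Notation ratio s := (@japan_ratio R d `^ `|s|).

Let N0 : 0 < N. Proof. exact: lt_le_trans N1. Qed.
Let w0 : 0 < w. Proof. exact: width_gt0. Qed.
Let w1 : w <= 1 / 50. Proof. by apply: le_trans e1; exact: width_le. Qed.

Lemma measurable_indic_box a h eps : measurable_fun setT (\1_(box i0 a h eps) : @Rn R d -> R).
Proof. by apply: measurable_indic; exact: measurable_box. Qed.

Lemma measurable_indic_box_vopp a h eps :
  measurable_fun setT (fun xi => \1_(box i0 a h eps) (vopp xi) : R).
Proof. exact: (measurableT_comp (measurable_indic_box a h eps) (@measurable_vopp R d)). Qed.

Let P : R := 1 + ((2 * N + 1) + 2 * w) + d%:R * (2 * e).

Lemma far_box a h eps xi : `|a| <= 2 * N + 1 -> 0 <= h <= 2 * w -> 0 <= eps <= 2 * e ->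
  P < pnorm xi -> ~ box i0 a h eps xi.
Proof.
move=> ha /andP[h0 hw] /andP[eps0 he] Pxi bx.
have := pnorm_box eps0 bx; apply/negP; rewrite -ltNge; apply: le_lt_trans Pxi.
by rewrite /P; apply: lerD; [rewrite lerD2l; exact: lerD|rewrite ler_wpM2l].
Qed.

Lemma indic_le1 (A : set (@Rn R d)) xi : 0 <= (\1_A xi : R) <= 1.
Proof. by rewrite indicE; case: (xi \in A); rewrite /= ?lexx ler01. Qed.

Lemma nice_data_of (phi psi chi : @cfun R d) (B : R) : 0 <= B ->
  cmeas phi -> cmeas psi -> cmeas chi ->
  (forall xi, cabs (phi xi) <= B) -> (forall xi, cabs (psi xi) <= B) ->
  (forall xi, cabs (chi xi) <= B) ->
  (forall xi, P < pnorm xi -> [/\ phi xi = 0, psi xi = 0 & chi xi = 0]) ->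
  hreal psi -> hreal chi -> exists2 M : R, 0 <= M & nice_data T M phi psi chi.
Proof.
move=> B0 m1 m2 m3 b1 b2 b3 far r1 r2.
have T2 : 0 <= T + 2 by rewrite addr_ge0.
have [M1 M10 h1] := wbounded_compact (P := P) T2 B0 b1 (fun xi Pxi => let: And3 H _ _ := far xi Pxi in H).
have [M2 M20 h2] := wbounded_compact (P := P) T2 B0 b2 (fun xi Pxi => let: And3 _ H _ := far xi Pxi in H).
have [M3 M30 h3] := wbounded_compact (P := P) T2 B0 b3 (fun xi Pxi => let: And3 _ _ H := far xi Pxi in H).
exists (M1 + M2 + M3); first by rewrite !addr_ge0.
split=> //; split; last by [].
by split; [apply: wbounded_le h1|apply: wbounded_le h2|apply: wbounded_le h3] => //;
  apply/andP; split => //; lra.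
Qed.

Lemma nice_case1 alpha beta : 0 <= alpha -> 0 <= beta -> exists2 M : R, 0 <= M &
  nice_data T M (phi_case1 i0 N e alpha) (psi_case1 i0 N e beta) (chi_case1 i0 N e beta).
Proof.
move=> a0 b0; have h1 := w0; have h2 := e0; have h3 := N0.
have P0 : 0 <= P.
  have de : 0 <= d%:R * (2 * e) by rewrite mulr_ge0// mulr_ge0// ltW.
  rewrite /P; lra.
pose J : set (@Rn R d) := box i0 (2 * N + 1) w e.
have farI xi : P < pnorm xi -> ~ box i0 (- N) (2 * w) (2 * e) xi.
  by apply: far_box; rewrite ?normrN ?ger0_norm ?lexx ?andbT; lra.
have farJ xi : P < pnorm xi -> ~ J xi.
  by apply: far_box; rewrite ?ger0_norm ?(ltW h1) ?(ltW h2) /=; lra.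
have farJ' xi : P < pnorm xi -> ~ J (vopp xi).
  by move=> Pxi; apply: farJ; rewrite pnorm_vopp.
have J01 xi : -1 <= (\1_J xi - \1_J (vopp xi) : R) <= 1.
  have /andP[? ?] := indic_le1 J xi; have /andP[? ?] := indic_le1 J (vopp xi).
  by apply/andP; split; lra.
have J02 xi : 0 <= (\1_J xi + \1_J (vopp xi) : R) <= 2.
  have /andP[? ?] := indic_le1 J xi; have /andP[? ?] := indic_le1 J (vopp xi).
  by apply/andP; split; lra.
apply: (@nice_data_of _ _ _ (alpha + 2 * beta + beta * P)).
- have : 0 <= beta * P by exact: mulr_ge0.
  lra.
- by apply: cmeas_real; apply: measurable_funM => //; exact: measurable_indic_box.
- apply: cmeas_real; apply: measurable_funM => //; apply: measurable_funD.
    exact: measurable_indic_box.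
  exact: measurable_indic_box_vopp.
- apply: cmeas_complex; first exact: measurable_cst.
  apply: measurable_funM; first by apply: measurable_funM => //; exact: measurable_vnorm.
  apply: measurable_funB; first exact: measurable_indic_box.
  exact: measurable_indic_box_vopp.
- move=> xi; rewrite cabs_real normrM (ger0_norm a0).
  have /andP[? ?] := indic_le1 (box i0 (- N) (2 * w) (2 * e)) xi.
  rewrite ger0_norm//; have bP : 0 <= beta * P by exact: mulr_ge0.
  apply: (@le_trans _ _ (alpha * 1)); [exact: ler_wpM2l|lra].
- move=> xi; rewrite cabs_real normrM (ger0_norm b0).
  have /andP[h4 h5] := J02 xi; rewrite -/J in h4 h5 *.
  rewrite ger0_norm//; have bP : 0 <= beta * P by exact: mulr_ge0.
  apply: (@le_trans _ _ (beta * 2)); [exact: ler_wpM2l|lra].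
- move=> xi; rewrite /chi_case1 -/J.
  have [Pxi|xiP] := ltP P (pnorm xi).
    rewrite (indic_boxN (farJ _ Pxi)) (indic_boxN (farJ' _ Pxi)) subrr mulr0 /=.
    by rewrite expr0n /= addr0 sqrtr0; have := mulr_ge0 b0 P0; lra.
  rewrite /= expr0n /= add0r sqrtr_sqr !normrM normrN (ger0_norm b0) (ger0_norm (vnorm_ge0 _)).
  have vP : vnorm xi <= P by exact: le_trans (vnorm_le_pnorm xi) xiP.
  have v0 := vnorm_ge0 xi.
  have h4 : `|\1_J xi - \1_J (vopp xi)| <= 1 :> R by rewrite ler_norml J01.
  apply: (@le_trans _ _ (beta * P)); last lra.
  rewrite -[leRHS]mulr1; apply: ler_pM => //; first exact: mulr_ge0.
  by rewrite ler_wpM2l.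
- move=> xi Pxi; split.
  + by rewrite /phi_case1 (indic_boxN (farI _ Pxi)) mulr0.
  + by rewrite /psi_case1 (indic_boxN (farJ _ Pxi)) (indic_boxN (farJ' _ Pxi)) addr0 mulr0.
  + by rewrite /chi_case1 (indic_boxN (farJ _ Pxi)) (indic_boxN (farJ' _ Pxi)) subrr mulr0.
- by move=> xi; rewrite /psi_case1 voppK addrC /= oppr0.
- by move=> xi; rewrite /chi_case1 voppK vnorm_vopp; apply: complexP => //=; rewrite -mulrN opprB.
Qed.

Lemma nice_case2 alpha : 0 <= alpha -> exists2 M : R, 0 <= M &
  nice_data T M (phi_case2 i0 N e alpha) 0 0.
Proof.
move=> a0; have h1 := w0; have h2 := e0; have h3 := N0.
have farI xi : P < pnorm xi -> ~ box i0 (N + 1) (2 * w) (2 * e) xi.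
  by apply: far_box; rewrite ?ger0_norm ?lexx ?andbT; lra.
have farZ xi : P < pnorm xi -> ~ box i0 (- N) w e xi.
  by apply: far_box; rewrite ?normrN ?ger0_norm ?(ltW h1) ?(ltW h2) /=; lra.
have c00 xi : cabs ((0 : @cfun R d) xi) = 0 by exact: ComplexField.Normc.normc0.
apply: (@nice_data_of _ _ _ (2 * alpha)).
- lra.
- apply: cmeas_real; apply: measurable_funM => //; apply: measurable_funD; exact: measurable_indic_box.
- exact: cmeas_cst.
- exact: cmeas_cst.
- move=> xi; rewrite cabs_real normrM (ger0_norm a0).
  have /andP[? ?] := indic_le1 (box i0 (N + 1) (2 * w) (2 * e)) xi.
  have /andP[? ?] := indic_le1 (box i0 (- N) w e) xi.
  rewrite ger0_norm ?addr_ge0// mulrC ler_wpM2r//; lra.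
- by move=> xi; rewrite c00; lra.
- by move=> xi; rewrite c00; lra.
- move=> xi Pxi; split=> //.
  by rewrite /phi_case2 (indic_boxN (farI _ Pxi)) (indic_boxN (farZ _ Pxi)) addr0 mulr0.
- by move=> xi; rewrite /= oppr0.
- by move=> xi; rewrite /= oppr0.
Qed.

(** N times the measure of a box, a quantity independent of N; [vol2] is the same for the boxes of
    doubled widths. *)
Definition vol : R := 2 * e * (2 * e) ^+ d.-1.
Definition vol2 : R := 2 * (2 * e) * (2 * (2 * e)) ^+ d.-1.

Lemma vol_gt0 : 0 < vol.
Proof. by rewrite /vol mulr_gt0 ?exprn_gt0 ?mulr_gt0. Qed.

Lemma box_vol a : leb (box i0 a w e) = (vol / N)%:E.
Proof.
by rewrite box_volume ?(ltW w0) ?(ltW e0)//; congr EFin; rewrite /vol; ring.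
Qed.

Lemma box_vol2 a : leb (box i0 a (2 * w) (2 * e)) = (vol2 / N)%:E.
Proof.
have h1 := w0; have h2 := e0.
rewrite box_volume; [|lra|lra].
by congr EFin; rewrite /vol2; ring.
Qed.

Lemma japan_upper s a h eps xi : `|a| = N \/ `|a| = N + 1 \/ `|a| = 2 * N + 1 ->
  0 <= h <= 2 * w -> 0 <= eps <= 2 * e -> box i0 a h eps xi ->
  (ratio s)^-1 * N `^ s <= japan xi `^ s <= ratio s * N `^ s /\ N / 2 <= vnorm xi.
Proof.
move=> ha /andP[h0 hw] /andP[eps0 he] bx.
have [] := @japan_box R d i0 N N1 a h eps xi _ _ _ bx.
- by have := w1; have := N1; case: ha => [->|[->|->]]; lra.
- by have := w1; have := N1; case: ha => [->|[->|->]]; lra.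
- by have := e1; rewrite eps0 /=; lra.
by move=> hj hv; split=> //; exact: (japan_powR_box N1).
Qed.

End Profiles.

(** * Norms of the data, uniformly in N *)

Section SobolevSize.
Context {R : realType} {d : nat}.
Local Notation leb := (@lebesgue_Rn R d).
Local Notation cabs := (@ComplexField.Normc.normc R).
Variables (i0 : 'I_d) (N e T k l : R).
Hypotheses (N1 : 1 <= N) (e0 : 0 < e) (e1 : e <= 1 / 50) (T0 : 0 <= T).
Implicit Types (xi : @Rn R d) (s : R).
Local Notation w := (e / N).
Local Notation ratio s := (@japan_ratio R d `^ `|s|).
Local Notation vol := (@vol R d e).
Local Notation vol2 := (@vol2 R d e).

Let N0 : 0 < N. Proof. exact: lt_le_trans N1. Qed.
Let w0 : 0 < w. Proof. exact: width_gt0. Qed.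

(* The amplitude of a datum of norm about 1 in H^s, supported in a box of volume
   about 1 / N at distance about N from the origin. *)
Definition amplitude s : R := Num.sqrt N / N `^ s.

Lemma amplitude_ge0 s : 0 <= amplitude s.
Proof. by rewrite divr_ge0 ?sqrtr_ge0 ?powR_ge0. Qed.

Lemma amplitudeE s : N `^ s * amplitude s = Num.sqrt N.
Proof. by rewrite /amplitude mulrCA mulfV ?mulr1// gt_eqF// powR_gt0. Qed.

Lemma sqr_amplitude s : amplitude s ^+ 2 = N `^ (1 - 2 * s).
Proof.
rewrite /amplitude expr_div_n sqr_sqrtr ?(ltW N0)// -powR_mulrn ?powR_ge0//.
rewrite -powRrM -[X in X / _](powRr1 (ltW N0)) -powRN -powRD; last first.
  by rewrite (gt_eqF N0) implybT.
by congr (_ `^ _); ring.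
Qed.

Lemma amplitudeM s s' : amplitude s * amplitude s' = N `^ (1 - s - s').
Proof.
rewrite /amplitude mulrACA -invfM -expr2 sqr_sqrtr ?(ltW N0)// -powRD; last first.
  by rewrite (gt_eqF N0) implybT.
rewrite -[X in X / _](powRr1 (ltW N0)) -powRN -powRD; last by rewrite (gt_eqF N0) implybT.
by congr (_ `^ _); ring.
Qed.

Lemma ratio_gt0 s : 0 < ratio s.
Proof. by rewrite powR_gt0// ltr_wpDr. Qed.

Lemma sqr_sob_amplitude isreal s f (A : set (@Rn R d)) (c v : R) :
  f \in @sob_pred R d isreal s -> measurable A -> 0 <= c ->
  (leb A <= (v / N)%:E)%E -> (forall xi, ~ A xi -> f xi = 0) ->
  (forall xi, A xi -> wabs s f xi <= c * Num.sqrt N) ->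
  `|sob_of isreal s f| ^+ 2 <= c ^+ 2 * v.
Proof.
move=> fP mA c0 vA f0 fc.
have := sqr_sob_of_le fP mA (mulr_ge0 c0 (sqrtr_ge0 N)) vA f0 fc.
rewrite exprMn sqr_sqrtr ?(ltW N0)// (_ : _ * N * (v / N) = c ^+ 2 * v)//.
by field; rewrite gt_eqF.
Qed.

Lemma wabs_le_amplitude s f xi (c : R) : 0 <= c ->
  japan xi `^ s <= ratio s * N `^ s -> cabs (f xi) <= c * amplitude s ->
  wabs s f xi <= c * ratio s * Num.sqrt N.
Proof.
move=> c0 hj hf; rewrite -(amplitudeE s) /wabs.
rewrite [leRHS](_ : _ = ratio s * N `^ s * (c * amplitude s)); last by ring.
apply: ler_pM => //; exact: powR_ge0.
Qed.

Local Notation phi1 := (phi_case1 i0 N e (amplitude k)).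
Local Notation psi1 := (psi_case1 i0 N e (amplitude l)).
Local Notation chi1 := (chi_case1 i0 N e (amplitude l)).
Local Notation phi2 := (phi_case2 i0 N e (amplitude k)).
Local Notation J := (box i0 (2 * N + 1) w e).
Local Notation J' := (box i0 (- (2 * N + 1)) w e).

Lemma measurable_boxU (a a' h h' eps eps' : R) :
  measurable (box i0 a h eps `|` box i0 a' h' eps' : set (@Rn R d)).
Proof. by apply: measurableU; exact: measurable_box. Qed.

Lemma box_volU a a' : (leb (box i0 a w e `|` box i0 a' w e) <= (2 * vol / N)%:E)%E.
Proof.
apply: le_trans (measureU2 _ _ _) _; try exact: measurable_box.
have b x : (leb (box i0 x w e) <= (vol / N)%:E)%E by rewrite (box_vol i0 N1 e0).
apply: le_trans (leeD (b a) (b a')) _.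
by rewrite -EFinD lee_fin [leRHS](_ : _ = vol / N + vol / N)//; ring.
Qed.

(** The bound does not involve N. In the third component, [chi_case1] carries a factor |xi| <= <xi>,
    which is compensated by the weight of H^(l-1); it is thus estimated like the second one. *)
Lemma case1_norm_le (M : R) : 0 <= M -> nice_data T M phi1 psi1 chi1 ->
  `|Hkl_of k l phi1 psi1 chi1| ^+ 2 <=
  ratio k ^+ 2 * vol2 + (2 * ratio l) ^+ 2 * (2 * vol) + (2 * ratio l) ^+ 2 * (2 * vol).
Proof.
move=> M0 data; rewrite sqr_Hkl_norm /=.
have [p1 _ _] := data_sob_pred T0 M0 data k.
have [_ p2 _] := data_sob_pred T0 M0 data l.
have [_ _ p3] := data_sob_pred T0 M0 data (l - 1).
have h1 := w0; have h2 := e0; have h3 := N0.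
have ak := amplitude_ge0 k; have al := amplitude_ge0 l.
have rl := ratio_gt0 l; have rk := ratio_gt0 k.
have far xi : ~ (J `|` J') xi -> \1_J xi = 0 :> R /\ \1_J (vopp xi) = 0 :> R.
  move=> nJ; split; apply: indic_boxN; first by move=> bJ; apply: nJ; left.
  by move=> /box_vopp bJ; apply: nJ; right.
have jJ xi : (J `|` J') xi ->
  (ratio l)^-1 * N `^ l <= japan xi `^ l <= ratio l * N `^ l /\ N / 2 <= vnorm xi.
  case=> bJ; apply: (japan_upper N1 e0 e1 l _ _ _ bJ); rewrite ?normrN.
  - by rewrite ger0_norm; [right; right|lra].
  - lra.
  - lra.
  - by rewrite ger0_norm; [right; right|lra].
  - lra.
  - lra.
have /= j1 xi := indic_le1 J xi; have j2 xi := indic_le1 J (vopp xi).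
apply: lerD; [apply: lerD|].
- apply: (sqr_sob_amplitude p1 (A := box i0 (- N) (2 * w) (2 * e))) => //.
  + exact: measurable_box.
  + exact: ltW.
  + by rewrite box_vol2.
  + by move=> xi nI; rewrite /phi_case1 (indic_boxN nI) mulr0.
  + move=> xi bI; rewrite -[ratio k]mul1r; apply: wabs_le_amplitude => //.
      suff [/andP[]] : (ratio k)^-1 * N `^ k <= japan xi `^ k <= ratio k * N `^ k /\ N / 2 <= vnorm xi by [].
      apply: (japan_upper N1 e0 e1 k _ _ _ bI); rewrite ?normrN.
      * by rewrite ger0_norm; [left|lra].
      * lra.
      * lra.
    by rewrite /phi_case1 (indic_box bI) cabs_real ger0_norm ?mulr1 ?mul1r.
- apply: (sqr_sob_amplitude p2 (A := J `|` J')) => //.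
  + exact: measurable_boxU.
  + by apply: mulr_ge0 => //; exact: ltW.
  + exact: box_volU.
  + by move=> xi /far[E1 E2]; rewrite /psi_case1 E1 E2 addr0 mulr0.
  + move=> xi bJ; apply: wabs_le_amplitude => //.
      by have [/andP[]] := jJ xi bJ.
    rewrite /psi_case1 cabs_real normrM (ger0_norm al) mulrC ler_wpM2r//.
    have /andP[a1 a2] := j1 xi; have /andP[b1 b2] := j2 xi.
    by rewrite ger0_norm; lra.
- apply: (sqr_sob_amplitude p3 (A := J `|` J')) => //.
  + exact: measurable_boxU.
  + by apply: mulr_ge0 => //; exact: ltW.
  + exact: box_volU.
  + by move=> xi /far[E1 E2]; rewrite /chi_case1 E1 E2 subr0 mulr0.
  + move=> xi bJ; apply: (@le_trans _ _ (wabs l (fun=> (2 * amplitude l)%:C%C) xi)); last first.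
      apply: wabs_le_amplitude => //; last by rewrite cabs_real ger0_norm// mulr_ge0.
      by have [/andP[]] := jJ xi bJ.
    rewrite /wabs.
    have jE : japan xi `^ l = japan xi `^ (l - 1) * japan xi.
      rewrite -[X in _ * X](powRr1 (ltW (japan_gt0 xi))) -powRD ?subrK//.
      by rewrite (gt_eqF (japan_gt0 xi)) implybT.
    rewrite jE -mulrA; apply: ler_wpM2l; first exact: powR_ge0.
    rewrite -[leLHS]/(cabs _) /chi_case1 -[leRHS]/(_ * cabs _) cabs_real.
    have v0 := vnorm_ge0 xi.
    have vj : vnorm xi <= japan xi by rewrite ler_wsqrtr// lerDr.
    have /andP[a1 a2] := j1 xi; have /andP[b1 b2] := j2 xi.
    have h : `|\1_J xi - \1_J (vopp xi)| <= 2 :> R by rewrite ler_norml; apply/andP; split; lra.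
    move: (amplitude l) al => a a0.
    rewrite /= expr0n /= add0r sqrtr_sqr !normrM normrN (ger0_norm a0) (ger0_norm v0).
    rewrite (ger0_norm (ler0n _ 2)) [leRHS](_ : _ = a * japan xi * 2); last by ring.
    by apply: ler_pM => //; [exact: mulr_ge0|exact: ler_wpM2l].
Qed.

Lemma case2_norm_le (M : R) : 0 <= M -> nice_data T M phi2 0 0 ->
  `|Hkl_of k l phi2 0 0| ^+ 2 <= (2 * ratio k) ^+ 2 * (vol2 + vol).
Proof.
move=> M0 data; rewrite sqr_Hkl_norm /= !sob_of0 !normr0 !expr0n /= !addr0.
have [p1 _ _] := data_sob_pred T0 M0 data k.
have h1 := w0; have h2 := e0; have h3 := N0.
have ak := amplitude_ge0 k; have rk := ratio_gt0 k.
apply: (sqr_sob_amplitude p1 (A := box i0 (N + 1) (2 * w) (2 * e) `|` box i0 (- N) w e)).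
- exact: measurable_boxU.
- by apply: mulr_ge0 => //; exact: ltW.
- apply: le_trans (measureU2 _ _ _) _; try exact: measurable_box.
  have b1 : (leb (box i0 (N + 1)%R (2 * w) (2 * e)) <= (vol2 / N)%:E)%E by rewrite (box_vol2 i0 N1 e0).
  have b2 : (leb (box i0 (- N)%R w e) <= (vol / N)%:E)%E by rewrite (box_vol i0 N1 e0).
  by apply: le_trans (leeD b1 b2) _; rewrite -EFinD -mulrDl.
- move=> xi nI; rewrite /phi_case2 !indic_boxN ?addr0 ?mulr0//.
    by move=> bI; apply: nI; right.
  by move=> bI; apply: nI; left.
- move=> xi bI; apply: wabs_le_amplitude => //.
    suff : (ratio k)^-1 * N `^ k <= japan xi `^ k <= ratio k * N `^ k /\ N / 2 <= vnorm xi by case=> /andP[].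
    case: bI => bI; apply: (japan_upper N1 e0 e1 k _ _ _ bI); rewrite ?normrN.
    + by rewrite ger0_norm; [right; left|lra].
    + lra.
    + lra.
    + by rewrite ger0_norm; [left|lra].
    + lra.
    + lra.
  rewrite /phi_case2 cabs_real normrM (ger0_norm ak) mulrC ler_wpM2r//.
  have /andP[a1 a2] := indic_le1 (box i0 (N + 1) (2 * w) (2 * e)) xi.
  have /andP[b1 b2] := indic_le1 (box i0 (- N) w e) xi.
  by rewrite ger0_norm; lra.
Qed.
End SobolevSize.

(** * Growth of the quadratic term *)

Section LowerBounds.
Context {R : realType} {d : nat}.
Local Notation cabs := (@ComplexField.Normc.normc R).
Variables (i0 : 'I_d) (N e T k l t : R).
Hypotheses (N1 : 1 <= N) (e0 : 0 < e) (e1 : e <= 1 / 50) (T0 : 0 <= T).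
Hypothesis Te : T * ((25 + 9 * d%:R) * e) <= 2^-1.
Hypothesis tT : 0 <= t <= T.
Implicit Types (xi eta : @Rn R d) (s : R).
Local Notation w := (e / N).
Local Notation ratio s := (@japan_ratio R d `^ `|s|).
Local Notation vol := (@vol R d e).
Local Notation kappa := ((2 * pi) `^ (- (d%:R / 2)) : R).
Local Notation ak := (amplitude N k).
Local Notation al := (amplitude N l).
Local Notation phi1 := (phi_case1 i0 N e ak).
Local Notation psi1 := (psi_case1 i0 N e al).
Local Notation chi1 := (chi_case1 i0 N e al).
Local Notation phi2 := (phi_case2 i0 N e ak).

Let N0 : 0 < N. Proof. exact: lt_le_trans N1. Qed.
Let w0 : 0 < w. Proof. exact: width_gt0. Qed.
Let powD a b : N `^ a * N `^ b = N `^ (a + b).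
Proof. by rewrite powRD// (gt_eqF N0) implybT. Qed.
Let powV : N^-1 = N `^ (-1). Proof. by rewrite powR_inv1// ltW. Qed.

Lemma sqr_powR_div (c q v : R) :
  (c * N `^ q) ^+ 2 * (v / N) = c ^+ 2 * v * N `^ (2 * q - 1).
Proof.
rewrite exprMn -[(N `^ q) ^+ 2]powR_mulrn ?powR_ge0// -powRrM powV.
rewrite [LHS](_ : _ = c ^+ 2 * v * (N `^ (q * 2) * N `^ (-1))); last by ring.
by rewrite powD (mulrC q).
Qed.

(** Powers of N: k from the Sobolev weight, 1 - k - l from the two amplitudes and - 1 from the
    volume of the convolution, hence - l pointwise; squaring and integrating over a box of measure
    of order 1 / N gives - 2 l - 1. *)
Lemma case1_quadratic_ge (M : R) : 0 <= M -> nice_data T M phi1 psi1 chi1 ->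
  ((ratio k)^-1 * (t * (kappa * (vol / 2)))) ^+ 2 * vol * N `^ (- (2 * l) - 1) <=
  4 * `|quadratic_part k l phi1 psi1 chi1 t| ^+ 2.
Proof.
move=> M0 data; set Q := quadratic_part _ _ _ _ _ _.
have [t0 tT'] := andP tT.
have TM : 0 <= (1 + T) * M by ge0.
have sY := state_lin T0 M0 data; set Y := lin _ _ _ in sY.
have [C C0 cC] := curve_zduh T0 true TM sY.
have fP := curve_sob_pred k C0 cC tT.
have h1 := w0; have h2 := e0; have h3 := N0; have h4 := N1.
have ak0 := amplitude_ge0 N k; have al0 := amplitude_ge0 N l.
have rk := @ratio_gt0 R d k; have vol0 := @vol_gt0 R d e e0.
pose q := t * (kappa * (ak * al / 2 * (vol / N))).
have q0 : 0 <= q.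
  apply: mulr_ge0 => //; apply: mulr_ge0; first exact: powR_ge0.
  apply: mulr_ge0; last by rewrite divr_ge0// ltW.
  by rewrite divr_ge0//; exact: mulr_ge0.
pose m := (ratio k)^-1 * N `^ k * q.
have rN0 : 0 <= (ratio k)^-1 * N `^ k.
  by apply: mulr_ge0; rewrite ?invr_ge0 ?powR_ge0.
have m0 : 0 <= m by exact: mulr_ge0.
have mE : m = (ratio k)^-1 * (t * (kappa * (vol / 2))) * N `^ (- l).
  rewrite /m /q amplitudeM// powV.
  rewrite [LHS](_ : _ = (ratio k)^-1 * (t * (kappa * (vol / 2))) * (N `^ k * N `^ (1 - k - l) * N `^ (-1))); last by ring.
  by rewrite !powD; congr (_ * _ `^ _); ring.
(* The bound for two functions is used with the same function twice; the second copy is only known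
   to be nonnegative, which affects nothing but the factor 4. *)
have ge xi : box i0 (N + 1) w e xi -> m <= wabs k (zduh true Y t) xi + wabs k (zduh true Y t) xi.
  move=> bX; rewrite -[leLHS]addr0; apply: lerD; last exact: wabs_ge0.
  have [/andP[hj _] _] : (ratio k)^-1 * N `^ k <= japan xi `^ k <= ratio k * N `^ k /\ N / 2 <= vnorm xi.
    apply: (japan_upper N1 e0 e1 k _ _ _ bX).
    + by rewrite ger0_norm; [right; left|lra].
    + lra.
    + lra.
  rewrite /m /wabs; apply: ler_pM => //.
  rewrite -[leRHS]/(cabs _) /zduh ComplexField.Normc.normcM cabsN cabs_i mul1r.
  rewrite -[leRHS]mul1r -(cabs_cis (t * sqnorm xi)) -ComplexField.Normc.normcM.
  apply: le_trans (Re_le_cabs _); apply: le_trans (ler_norm _).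
  have -> : cis (t * sqnorm xi) * duh (zkernel true) (zsource true Y) t xi =
     cis (t * sqnorm xi) * duh schrod (zsource true Y) t xi + 0 * duh schrod (zsource true Y) t xi.
    by rewrite mul0r addr0.
  apply: (duh_pair_ge T0 TM tT (kernel_schrod T0) (kernel_schrod T0) sY (J := box i0 (2 * N + 1) w e)).
  - exact: measurable_box.
  - by rewrite (box_vol i0 N1 e0).
  - by rewrite divr_ge0// mulr_ge0.
  - move=> s eta /andP[s0 st]; apply: (case1_pointwise N1 e0 e1 Te) => //.
    by rewrite s0 (le_trans st).
have := sqr_sob_of_ge fP fP (measurable_box _ _ _ _) m0 (box_vol i0 N1 e0 (N + 1)) ge.
rewrite mE sqr_powR_div mulrN => /le_trans; apply.
have : `|sob_of false k (zduh true Y t)| ^+ 2 <= `|Q| ^+ 2.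
  by rewrite lerXn2r ?nnegrE//; exact: (Hkl_component1 Q).
lra.
Qed.

(** Powers of N: l - 1 from the Sobolev weight, 2 from the Laplacian, 1 - 2 k from the amplitudes
    and - 1 from the convolution, hence l + 1 - 2 k pointwise. *)
Lemma case2_quadratic_ge (M : R) : 0 <= M -> nice_data T M phi2 0 0 ->
  ((ratio (l - 1))^-1 * (t * (kappa * (vol / 8)))) ^+ 2 * vol * N `^ (2 * l + 1 - 4 * k) <=
  4 * `|quadratic_part k l phi2 0 0 t| ^+ 2.
Proof.
move=> M0 data; set Q := quadratic_part _ _ _ _ _ _.
have [t0 tT'] := andP tT.
have TM : 0 <= (1 + T) * M by ge0.
have sY := state_lin T0 M0 data; set Y := lin _ _ _ in sY.
have [C C0 cC] := curve_zduh T0 false TM sY.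
have [C' C0' cC'] := curve_dduh T0 TM sY.
have gP := curve_sob_pred l C0 cC tT; have fP := curve_sob_pred (l - 1) C0' cC' tT.
have h1 := w0; have h2 := e0; have h3 := N0; have h4 := N1.
have ak0 := amplitude_ge0 N k.
have rk := @ratio_gt0 R d (l - 1); have vol0 := @vol_gt0 R d e e0.
pose q := (t * (kappa * ((N / 2) ^+ 2 * (ak ^+ 2 / 2) * (vol / N)))).
have q0 : 0 <= q.
  apply: mulr_ge0 => //; apply: mulr_ge0; first exact: powR_ge0.
  apply: mulr_ge0; last by rewrite divr_ge0// ltW.
  by apply: mulr_ge0; [exact: sqr_ge0|rewrite divr_ge0// sqr_ge0].
pose m := (ratio (l - 1))^-1 * N `^ (l - 1) * q.
have rN0 : 0 <= (ratio (l - 1))^-1 * N `^ (l - 1).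
  by apply: mulr_ge0; rewrite ?invr_ge0 ?powR_ge0.
have m0 : 0 <= m by exact: mulr_ge0.
have mE : m = (ratio (l - 1))^-1 * (t * (kappa * (vol / 8))) * N `^ (l + 1 - 2 * k).
  rewrite /m /q sqr_amplitude// powV expr_div_n -[N ^+ 2](powR_mulrn 2 (ltW N0)).
  move: (ratio (l - 1))^-1 => c.
  rewrite [LHS](_ : _ = c * (t * (kappa * (vol / 8))) *
     (N `^ (l - 1) * N `^ 2 * N `^ (1 - 2 * k) * N `^ (-1))); last by field.
  by rewrite !powD; congr (_ * _ `^ _); ring.
have ge xi : box i0 (2 * N + 1) w e xi -> m <= wabs (l - 1) (dduh Y t) xi + wabs l (zduh false Y t) xi.
  move=> bX.
  have [/andP[hj _] _] : (ratio (l - 1))^-1 * N `^ (l - 1) <= japan xi `^ (l - 1) <=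
      ratio (l - 1) * N `^ (l - 1) /\ N / 2 <= vnorm xi.
    apply: (japan_upper N1 e0 e1 (l - 1) _ _ _ bX).
    + by rewrite ger0_norm; [right; right|lra].
    + lra.
    + lra.
  have jE : japan xi `^ l = japan xi `^ (l - 1) * japan xi.
    rewrite -[X in _ * X](powRr1 (ltW (japan_gt0 xi))) -powRD ?subrK//.
    by rewrite (gt_eqF (japan_gt0 xi)) implybT.
  (* Once the weight of H^(l-1) is factored out, n keeps a factor <xi> >= |xi|, which is the
     coefficient it has in the half-wave combination. *)
  rewrite /wabs jE -mulrA -mulrDr /m; apply: ler_pM => //.
  have vj : vnorm xi <= japan xi by rewrite ler_wsqrtr// lerDr.
  apply: (@le_trans _ _ (cabs (dduh Y t xi) + vnorm xi * cabs (zduh false Y t xi))); last first.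
    by rewrite lerD2l ler_wpM2r// cabs_ge0.
  pose z1 := - cis (t * vnorm xi); pose z2 := 'i%C * (vnorm xi)%:C%C * cis (t * vnorm xi).
  have E1 : cabs (z1 * dduh Y t xi) = cabs (dduh Y t xi).
    by rewrite ComplexField.Normc.normcM cabsN cabs_cis mul1r.
  have E2 : cabs (z2 * duh (zkernel false) (zsource false Y) t xi) = vnorm xi * cabs (zduh false Y t xi).
    rewrite !ComplexField.Normc.normcM cabs_cis cabs_i cabs_real ComplexField.Normc.normc1.
    by rewrite (ger0_norm (vnorm_ge0 xi)) !mul1r mulr1.
  rewrite -E1 -E2; apply: le_trans (cabsD _ _); apply: le_trans (Re_le_cabs _).
  apply: le_trans (ler_norm _).
  apply: (duh_pair_ge T0 TM tT (kernel_W0_sqnorm T0) (evol_kernel_zkernel T0 false) sY (J := box i0 N w e)).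
  - exact: measurable_box.
  - by rewrite (box_vol i0 N1 e0).
  - by apply: mulr_ge0; [exact: sqr_ge0|rewrite divr_ge0// sqr_ge0].
  - move=> s eta /andP[s0 st]; apply: (case2_pointwise N1 e0 e1 Te) => //.
    by rewrite s0 (le_trans st).
have := sqr_sob_of_ge fP gP (measurable_box _ _ _ _) m0 (box_vol i0 N1 e0 (2 * N + 1)) ge.
rewrite mE sqr_powR_div (_ : 2 * _ - 1 = 2 * l + 1 - 4 * k); last by ring.
move=> /le_trans; apply.
have : `|sob_of true l (zduh false Y t)| ^+ 2 <= `|Q| ^+ 2.
  by rewrite lerXn2r ?nnegrE//; exact: (Hkl_component2 Q).
have : `|sob_of true (l - 1) (dduh Y t)| ^+ 2 <= `|Q| ^+ 2.
  by rewrite lerXn2r ?nnegrE//; exact: (Hkl_component3 Q).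
lra.
Qed.
End LowerBounds.

(** * Contradiction with a bounded second derivative *)

Lemma powR_unbounded {R : realType} (p c K : R) : 0 < p -> 0 < c ->
  exists2 N : R, 1 <= N & K < c * N `^ p.
Proof.
move=> p0 c0; pose x := 1 + `|K| / c.
have x1 : 1 <= x by rewrite lerDl divr_ge0// ltW.
have x0 : 0 <= x by exact: le_trans x1.
exists (x `^ p^-1).
  have -> : (1 : R) = 1 `^ p^-1 by rewrite powR1.
  by rewrite ge0_ler_powR ?invr_ge0 ?(ltW p0) ?nnegrE.
rewrite -powRrM mulVf ?gt_eqF// powRr1// /x mulrDr mulr1 mulrCA mulfV ?gt_eqF// mulr1.
by rewrite (le_lt_trans (ler_norm K))// ltrDr.
Qed.

(** The datum need not be small: delta is taken so small, depending on the datum, that delta Phi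
    lies in B_r and the iteration converges. The constant C comes from the flow alone, so it stays
    fixed while N varies. *)
Lemma quadratic_part_le {R : realType} {d : nat} (k l T r t : R) :
  0 <= T -> 0 < r -> locally_well_posed d k l T r -> 0 <= t <= T ->
  twice_differentiable (flow d k l T t) 0 ->
  exists C : R, forall (M : R) (phi psi chi : @cfun R d), 0 <= M ->
    nice_data T M phi psi chi ->
    `|quadratic_part k l phi psi chi t| <= C * `|Hkl_of k l phi psi chi| ^+ 2.
Proof.
move=> T0 r0 wp tT /twice_differentiable_quadratic[C hC].
exists C => M phi psi chi M0 data; set Phi := Hkl_of _ _ _ _ _.
have [K [delta0 [delta00 hK]]] := sol_expansion k l T0 M0 data tT.
have P1 : 0 < 1 + `|Phi| by rewrite ltr_wpDr.
apply: (hC Phi (linear_part k l phi psi chi t) _ K (Num.min delta0 (r / (1 + `|Phi|)))).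
  by rewrite lt_min delta00 divr_gt0.
move=> delta; rewrite lt_min => /andP[/hK[sol_delta bound] hr].
rewrite (flow_eq wp _ sol_delta tT)//.
rewrite normrZ; apply: le_lt_trans (_ : `|delta| * (1 + `|Phi|) < r).
  by rewrite ler_wpM2l// lerDr.
by rewrite -ltr_pdivlMr.
Qed.

Lemma sqr_le_bound {R : realType} (q C x U : R) :
  0 <= q -> q <= C * x -> 0 <= x <= U -> 4 * q ^+ 2 <= 4 * (C ^+ 2 * U ^+ 2).
Proof.
move=> q0 qC /andP[x0 xU]; rewrite ler_pM2l//.
apply: (@le_trans _ _ ((C * x) ^+ 2)); first by rewrite lerXn2r ?nnegrE// (le_trans q0).
by rewrite exprMn ler_wpM2l ?sqr_ge0// lerXn2r ?nnegrE// (le_trans x0).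
Qed.


Theorem theorem1p2 (R : realType) (d : nat) (k l T r : R) :
  (1 <= d)%N -> 0 < T -> 0 < r ->
  locally_well_posed d k l T r ->
  l < - 2^-1 \/ 2 * k - 2^-1 < l ->
  forall t : R, 0 < t <= T ->
  ~ twice_differentiable (flow d k l T t) 0.
Proof.
move=> d1 T0 r0 wp kl t /andP[t0 tT'] df.
have tT : 0 <= t <= T by rewrite (ltW t0).
have [C hC] := quadratic_part_le (ltW T0) r0 wp tT df.
(* [e] depends on T and d but not on N. The factors 1 + T and [D] give [Te]; the factor 50 gives e
   <= 1 / 50, which separates the boxes and keeps them at distance at least N / 2 from the
   origin. *)
pose D : R := 25 + 9 * d%:R; pose e : R := (50 * (1 + T) * D)^-1.
have D1 : 1 <= D by rewrite /D ler_wpDr ?mulr_ge0// ler1n.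
have D0 : 0 < D by exact: lt_le_trans D1.
have T1 : 0 < 1 + T by exact: addr_gt0.
have e0 : 0 < e by rewrite invr_gt0 !mulr_gt0.
have e1 : e <= 1 / 50.
  rewrite mul1r lef_pV2 ?posrE ?mulr_gt0// -mulrA ler_pMr// -[leLHS]mulr1.
  by apply: ler_pM => //; rewrite lerDl ltW.
have Te : T * ((25 + 9 * d%:R) * e) <= 2^-1.
  rewrite -/D (_ : _ * _ = T / (1 + T) * 50^-1); last first.
    by rewrite /e; field; rewrite !gt_eqF.
  have TT : T / (1 + T) <= 1 by rewrite ler_pdivrMr// mul1r lerDr.
  lra.
pose i0 : 'I_d := Ordinal d1.
have kappa0 : 0 < (2 * pi) `^ (- (d%:R / 2)) :> R by rewrite powR_gt0// mulr_gt0// pi_gt0.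
have vol0 : 0 < @vol R d e by exact: vol_gt0.
(* x stands for the squared norm of the datum, bounded by U uniformly in N, and q for the norm of
   the quadratic term. *)
have no_growth (c p U : R) : 0 < c -> 0 < p ->
    (forall N, 1 <= N -> exists2 x : R, 0 <= x <= U & exists2 q : R, 0 <= q <= C * x &
       c * N `^ p <= 4 * q ^+ 2) -> False.
  move=> c0 p0 h; have [N N1] := powR_unbounded (4 * (C ^+ 2 * U ^+ 2)) p0 c0.
  have [x xU [q /andP[q0 qx] hq]] := h N N1.
  by apply/negP; rewrite -leNgt (le_trans hq)// (sqr_le_bound q0 qx).
have c_gt0 (s m : R) : 0 < m ->
    0 < ((@japan_ratio R d `^ `|s|)^-1 * (t * ((2 * pi) `^ (- (d%:R / 2)) * (@vol R d e / m)))) ^+ 2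
      * @vol R d e.
  move=> m0; have rs := @ratio_gt0 R d s.
  by rewrite mulr_gt0// exprn_gt0// mulr_gt0 ?invr_gt0// mulr_gt0// mulr_gt0// divr_gt0.
case: kl => [l_small|l_large].
(* The exponent is positive exactly when l < - 1/2. *)
- apply: (no_growth _ (- (2 * l) - 1) _ (c_gt0 k 2 _)) => //; first lra.
  move=> N N1; have [M M0 data] := nice_case1 i0 N1 e0 (ltW T0) (amplitude_ge0 N k) (amplitude_ge0 N l).
  eexists; first by apply/andP; split; [|exact: (@case1_norm_le R d i0 N e T k l N1 e0 e1 (ltW T0) M M0 data)]; exact: sqr_ge0.
  eexists; first by apply/andP; split; [|exact: (hC M _ _ _ M0 data)].
  exact: (case1_quadratic_ge N1 e0 e1 (ltW T0) Te tT M0 data).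
(* The exponent is positive exactly when l > 2 k - 1/2. *)
- apply: (no_growth _ (2 * l + 1 - 4 * k) _ (c_gt0 (l - 1) 8 _)) => //; first lra.
  move=> N N1; have [M M0 data] := nice_case2 i0 N1 e0 (ltW T0) (amplitude_ge0 N k).
  eexists; first by apply/andP; split; [|exact: (@case2_norm_le R d i0 N e T k l N1 e0 e1 (ltW T0) M M0 data)]; exact: sqr_ge0.
  eexists; first by apply/andP; split; [|exact: (hC M _ _ _ M0 data)].
  exact: (@case2_quadratic_ge R d i0 N e T k l t N1 e0 e1 (ltW T0) Te tT M M0 data).
Qed.
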